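(* Let $q$ be a prime power. There exists an element of $\mathbb{F}_{q^4}$ that is primitive and $2$-normal over $\mathbb{F}_q$ if and only if $q\equiv 1\pmod 4$.
   Context: An element of $\mathbb{F}_{q^n}$ is primitive if it generates $\mathbb{F}_{q^n}^*$. For $\alpha\in\mathbb{F}_{q^n}$ let $g_\alpha(x)=\sum_{i=0}^{n-1}\alpha^{q^i}x^{n-1-i}$; $\alpha$ is $k$-normal over $\mathbb{F}_q$ if $\gcd(x^n-1,g_\alpha(x))$ in $\mathbb{F}_{q^n}[x]$ has degree $k$ (here $n=4$). *)

(* Defs.v *)
From HB Require Import structures.
From mathcomp Require Import all_boot all_order all_algebra all_field.
Set Implicit Arguments. Unset Strict Implicit. Unset Printing Implicit Defensive.
Import GRing.Theory.
Local Open Scope ring_scope.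

(* F plays the role of F_q (q = #|F|), L a field extension of F of degree n,
   i.e. a model of F_{q^n}. *)

Definition primitive_elt (L : fieldType) (alpha : L) : Prop :=
  alpha != 0 /\ forall y : L, y != 0 -> exists k : nat, y = alpha ^+ k.

Definition g_poly (L : fieldType) (q n : nat) (alpha : L) : {poly L} :=
  \sum_(i < n) (alpha ^+ (q ^ i)%N) *: 'X^(n.-1 - i).

Definition k_normal (L : fieldType) (q n k : nat) (alpha : L) : Prop :=
  (size (gcdp ('X^n - 1) (g_poly q n alpha))).-1 = k.

(* Main.v *)
Require Import Defs.
From HB Require Import structures.
From Stdlib Require Import BinPos BinNat Nnat.
From mathcomp Require Import all_boot all_order all_algebra all_field.
From mathcomp Require Import cyclic zify ring.
Set Implicit Arguments. Unset Strict Implicit. Unset Printing Implicit Defensive.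
Import Order.TTheory GRing.Theory Num.Theory.
Local Open Scope ring_scope.

(** If alpha is 2-normal, the gcd of [X^4 - 1] with [g_alpha] has degree 2. When
  q is even or q = 3 mod 4 it must be [X^2 - 1] or [X^2 + 1], since it is stable
  under the q-power map on fourth roots of unity; then [alpha^(q^2) = -/+ alpha],
  so alpha is not primitive.

  Conversely, if q = 1 mod 4, then F_(q^4) = F_q(beta) with beta^4 = c a
  nonsquare, and [a beta^s (beta - t)] is 2-normal for all a, t <> 0 in F_q, being
  a sum of two Frobenius eigenvectors. For suitable a and s it is primitive as soon
  as no odd prime l dividing N = 1 + q + q^2 + q^3 makes [beta - t] an l-th power.
  A sieve over these primes produces t, given the bound 2 sqrt(q) for the sums
  [1 + sum_t chi(beta - t)] over characters chi trivial on F_q. That bound is the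
  Riemann hypothesis for a quadratic L-function: Newton's identities express the
  character sums over extensions as power sums of its two roots, and Stepanov's
  method bounds them over the extensions of degree 4 * 2^j. The sieve succeeds for
  q >= 36000 uniformly; smaller q are checked by computation, with explicit t for
  the 26 prime powers where the sieve fails. *)

(** * Stepanov's method *)

(** Let [A n] be the sum of [chi (f theta)] over monic [f] of degree [n]. Polynomials of degree at
    most 3 take each value in F_(q^4) once, which kills [A n] for [n > 3], and triviality of [chi]
    on F_q makes [1 + A 1 + A 2 + A 3] vanish. So the L-function is [(1 - u)(1 - x u)(1 - y u)].
    Dividing out its trivial zero is why the bound concerns 1 plus a sum: the 1 is the value at the
    point at infinity. The degrees [4 * 2^j] suit Stepanov's method twice over. It wants a field of
    size [r^2] with [r = 1] modulo [N], which powers of [q^4] provide, and only quadratic extensions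
    have to be built. Bounds along powers of 2 still determine the size of both roots. The sieve
    treats odd primes of [N] only, because the factors [beta^s] and [a] can repair the logarithm of
    [beta - t] at 2 and at the primes outside [N]. Complete sieving by [k] primes costs a factor
    [2^k]; subtracting primes one at a time costs only a linear factor but needs their reciprocals
    to sum to less than 1. Hence the two lists of primes, with the smallest ones sieved
    completely. *)

Lemma poly_family_dependent (K : fieldType) (I : finType) (n : nat)
    (G : I -> {poly K}) :
  (forall i, size (G i) <= n)%N -> (n < #|I|)%N ->
  exists2 c : I -> K, (exists i, c i != 0) & \sum_i c i *: G i = 0.
Proof.
move=> sG ltnI.
pose A : 'M[K]_(#|I|, n) := \matrix_(i, j) (G (enum_val i))`_j.
have : kermx A != 0.
  rewrite -mxrank_eq0 mxrank_ker -lt0n subn_gt0.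
  exact: leq_ltn_trans (rank_leq_col A) ltnI.
case/rowV0Pn=> v /sub_kermxP vA0 v_neq0.
exists (fun i => v 0 (enum_rank i)).
  have [j vj] : exists j, v 0 j != 0.
    apply/existsP; apply: contraNT v_neq0; rewrite negb_exists => /forallP v0.
    by apply/eqP/rowP => j; rewrite mxE; apply/eqP; rewrite -[_ == _]negbK v0.
  by exists (enum_val j); rewrite enum_valK.
apply/polyP => j; rewrite coef0 coef_sum.
have [ltjn | lenj] := ltnP j n; last first.
  apply: big1 => i _; rewrite coefZ nth_default ?mulr0 //.
  exact: leq_trans (sG i) lenj.
have := congr1 (fun M : 'rV_n => M 0 (Ordinal ltjn)) vA0; rewrite !mxE => e0; rewrite -[RHS]e0 {e0}.
rewrite (reindex _ (onW_bij _ (enum_val_bij I))) /=.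
apply: eq_bigr => k _; by rewrite coefZ enum_valK !mxE.
Qed.

(** Among the terms with nonzero coefficient, the one of least order at 0 cannot cancel. This is how
    the auxiliary polynomial below is seen to be nonzero. *)
Lemma poly_distinct_orders (K : fieldType) (I : finType) (v : I -> nat)
    (g : I -> {poly K}) (c : I -> K) :
  injective v -> (forall i, (g i)`_0 != 0) -> (exists i, c i != 0) ->
  \sum_i c i *: ('X^(v i) * g i) != 0.
Proof.
move=> v_inj g0 [i0 ci0].
case: (@arg_minnP _ i0 (fun i => c i != 0) v ci0) => i ci min_i.
apply/eqP => /(congr1 (fun p : {poly K} => p`_(v i))); rewrite coef0 coef_sum.
rewrite (bigD1 i) //= big1 => [|j neq_ji]; last first.
  rewrite coefZ coefXnM; case: ltnP => [|le_vij]; first by rewrite mulr0.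
  have [-> | cj] := eqVneq (c j) 0; first by rewrite mul0r.
  have /eqP /v_inj eq_ij : v i == v j by rewrite eqn_leq le_vij min_i.
  by rewrite eq_ij eqxx in neq_ji.
rewrite addr0 coefZ coefXnM ltnn subnn => /eqP.
by rewrite mulf_eq0 (negPf ci) (negPf (g0 i)).
Qed.

(* Stepanov's auxiliary polynomial, in the form where [#|K|] is a square: the
   [r]-power map then plays the role of derivatives. *)
Lemma stepanov_at_zero (K : finFieldType) (p u d e : nat) (h : {poly K}) (z : K) :
  let r := (p ^ u)%N in
  p \in [pchar K] -> #|K| = (r ^ 2)%N -> (1 < d)%N -> (0 < e)%N -> r = (d * e).+1 ->
  h`_0 != 0 -> z != 0 ->
  (d * #|[set t : K | ('X * h).[t] ^+ (e * r.+1) == z]|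
     <= r ^ 2 + d * ((size h * d.+1 + 5) + size h) * r)%N.
Proof.
move=> r pK cardK d1 e0 Dr h0 nz_z.
have frob x y : (x + y) ^+ r = x ^+ r + y ^+ r :> K.
  rewrite exprDn_pchar //.
  by rewrite pnatX (eq_pnat _ (pcharf_eq pK)) pnat_id ?(pcharf_prime pK).
clearbody r.
set f := 'X * h; set D := size h.
have nz_h : h != 0 by apply: contraNneq h0 => ->; rewrite coef0.
have D0 : (0 < D)%N by rewrite size_poly_gt0.
have sf : size f = D.+1 by rewrite size_mul ?polyX_eq0 // size_polyX.
(* [K'] is large enough for the [d * J * e] unknowns to outnumber the [e * r + D * r + J]
   coefficients; in the final bound it enters only the error term. *)
pose K' := (D * d.+1 + 4)%N; pose J := (e + 1 + K')%N.
pose I := ('I_d * 'I_J * 'I_e)%type.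
pose G (i : I) := z ^+ i.1.1 *: 'X^(i.2 * r + i.1.2) * f ^+ ((d - 1 - i.1.1) * e).
have hf t : f.[t] = t * h.[t] by rewrite /f hornerM hornerX.
clearbody f.
have nz_f : f != 0 by rewrite -size_poly_gt0 sf.
have sfX n : size (f ^+ n) = (D * n).+1.
  by rewrite polySpred ?expf_neq0 // size_exp sf.
have bound_G i : (size (G i) <= e * r + D * r + J)%N.
  rewrite /G -scalerAl; apply: (leq_trans (size_scale_leq _ _)).
  apply: (leq_trans (size_polyMleq _ _)); rewrite size_polyXn sfX /=.
  case: i => -[[b ltb] [j ltj]] [w ltw] /=.
  have : ((w.+1 * r) <= e * r)%N by rewrite leq_pmul2r ?ltw // Dr.
  have : (D * ((d - 1 - b) * e) <= D * r)%N.
    rewrite leq_mul2l; apply/orP; right.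
    by rewrite Dr; apply/leqW/leq_mul => //; lia.
  move: (D * _)%N (D * _)%N (e * r)%N => x y w'. rewrite mulSn; lia.
have big_I : (e * r + D * r + J < #|{: I}|)%N.
  rewrite !card_prod !card_ord Dr /J /K'; nia.
have [c nz_c Gc] := poly_family_dependent bound_G big_I.
(* Since [w + b * e < d * e < r], the triple [(w, b, j)] can be read off from
   [w + b * e + j * r]. *)
pose E (i : I) := (i.2 + i.1.1 * e + i.1.2 * r)%N.
have E_inj : injective E.
  move=> [[[b ltb] [j ltj]] [w ltw]] [[[b' ltb'] [j' ltj']] [w' ltw']] /=.
  rewrite /E /= Dr => Ee.
  have Edn : (d * w + (d * e).+1 * (b + j * d) + b'
            = d * w' + (d * e).+1 * (b' + j' * d) + b)%N by nia.
  have small x y : (x < e -> y < d -> d * x + y < (d * e).+1)%N.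
    move=> ltx lty; have : (d * x.+1 <= d * e)%N by rewrite leq_mul2l ltx orbT.
    by rewrite mulnS; lia.
  have En : (b + j * d = b' + j' * d)%N.
    move: (small w b' ltw ltb') (small w' b ltw' ltb).
    case: (ltngtP (b + j * d) (b' + j' * d))%N => // lt_n.
    - have := leq_mul (leqnn (d * e).+1) lt_n; rewrite mulnS; lia.
    - have := leq_mul (leqnn (d * e).+1) lt_n; rewrite mulnS; lia.
  have Eb : b = b'.
    by have := congr1 (modn^~ d) En; rewrite !(addnC _ (_ * d)%N) !modnMDl !modn_small.
  have Ej : j = j'.
    move: En; rewrite Eb => /addnI /eqP; rewrite eqn_pmul2r 1?ltnW // => /eqP //.
  have Ew : w = w' by move: Edn; rewrite Eb Ej; nia.
  by congr (_, _, _); apply: val_inj.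
(* At a solution [t], the relations [t^(r^2) = t] and [f(t)^(e * (r + 1)) = z] turn
   [F(t)^r * f(t)^((d - 1) * e)] into the vanishing combination of the [G i], while the degree of
   [F] is only about [e * r], that is [r^2 / d]. *)
pose F := \sum_i c i ^+ r *: ('X^(E i) * h ^+ (i.1.1 * e)).
have nz_F : F != 0.
  apply: poly_distinct_orders E_inj _ _ => [i|].
    rewrite -horner_coef0 hornerE expf_neq0 // horner_coef0 //.
  by have [i ci] := nz_c; exists i; rewrite expf_neq0.
have rootF t : t \in [set t : K | f.[t] ^+ (e * r.+1) == z] -> root F t.
  rewrite inE => /eqP ft; rewrite rootE.
  have nz_ft : f.[t] != 0.
    by apply: contraNneq nz_z => ft0; rewrite -ft ft0 expr0n muln_eq0 eqn0Ngt e0.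
  have rr (x : K) : x ^+ r ^+ r = x by rewrite -exprM mulnn -cardK expf_card.
  suff: F.[t] ^+ r * f.[t] ^+ ((d - 1) * e) == 0.
    by rewrite mulf_eq0 !expf_eq0 (negPf nz_ft) andbF orbF => /andP[].
  have r0 : (0 < r)%N by rewrite Dr.
  have zr : (0 : K) ^+ r = 0 by rewrite expr0n eqn0Ngt r0.
  rewrite /F horner_sum (big_morph (fun x : K => x ^+ r) frob zr) mulr_suml.
  apply/eqP; transitivity ((\sum_i c i *: G i).[t]); last by rewrite Gc horner0.
  rewrite horner_sum; apply: eq_bigr => -[[b j] w] _; rewrite /G /E /=.
  have Dbe : (b * e * r + (d - 1) * e = b * (e * r.+1) + (d - 1 - b) * e)%N.
    by have := ltn_ord b; nia.
  rewrite !hornerZ hornerM -scalerAl hornerZ hornerM !horner_exp !hornerX.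
  have -> : t ^+ (w + b * e + j * r) * h.[t] ^+ (b * e)
          = t ^+ w * (t ^+ j) ^+ r * f.[t] ^+ (b * e).
    by rewrite hf exprMn !exprD -exprM; ring.
  have -> : z ^+ b = f.[t] ^+ (b * (e * r.+1)) by rewrite -ft -exprM mulnC.
  rewrite !exprMn !rr -(exprM _ (b * e)).
  transitivity (c (b, j, w) * (t ^+ w) ^+ r * t ^+ j * f.[t] ^+ (b * e * r + (d - 1) * e)).
    rewrite exprD; ring.
  rewrite Dbe !exprD -!exprM. ring.
have szF : (size F <= e + D * r + (e + K') * r)%N.
  apply: (leq_trans (size_sum _ _ _)); apply/bigmax_leqP => -[[b j] w] _ /=.
  apply: (leq_trans (size_scale_leq _ _)).
  rewrite size_monicM ?monicXn ?expf_neq0 // size_polyXn addSn /=.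
  rewrite [size (h ^+ _)]polySpred ?expf_neq0 // size_exp addnS.
  rewrite -/D; have [wJ [bd je]] := (ltn_ord w, (ltn_ord b, ltn_ord j)).
  have be : (b * e <= d.-1 * e)%N by rewrite leq_mul2r; lia.
  have jr : (j * r <= (e + K') * r)%N.
    by rewrite leq_mul2r; move: je; rewrite /J; lia.
  have De : ((D - 1) * (b * e) + b * e <= D * r)%N.
    rewrite -mulSnr -subSn // subSS subn0 leq_mul2l; apply/orP; right.
    by apply: (leq_trans be); rewrite Dr leqW // leq_mul2r leq_pred orbT.
  by move: wJ De jr; rewrite /E /= subn1; lia.
have lt_B : (#|[set t : K | f.[t] ^+ (e * r.+1) == z]| < size F)%N.
  rewrite cardE; apply: max_poly_roots nz_F _ (enum_uniq _).
  by apply/allP => t; rewrite mem_enum => /rootF.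
have {lt_B szF} := leq_trans lt_B szF; move: #|_| => B lt_B.
apply: (@leq_trans (d * (e + D * r + (e + K') * r))); first by rewrite leq_mul2l ltnW ?orbT.
rewrite /K' {frob rootF}; nia.
Qed.

(** Translation by [a] moves a simple root of the polynomial to 0, where the orders of vanishing are
    known exactly. *)
Lemma stepanov (K : finFieldType) (p u d e : nat) (h : {poly K}) (a z : K) :
  let r := (p ^ u)%N in
  p \in [pchar K] -> #|K| = (r ^ 2)%N -> (1 < d)%N -> (0 < e)%N -> r = (d * e).+1 ->
  h.[a] != 0 -> z != 0 ->
  (d * #|[set t : K | (('X - a%:P) * h).[t] ^+ (e * r.+1) == z]|
     <= r ^ 2 + d * ((size h * d.+1 + 5) + size h) * r)%N.
Proof.
move=> r pK cardK d1 e0 Dr ha nz_z.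
have sz : size (h \Po ('X + a%:P)) = size h.
  by rewrite size_comp_poly2 // size_XaddC.
have ha0 : (h \Po ('X + a%:P))`_0 != 0.
  by rewrite -horner_coef0 horner_comp !hornerE.
have := stepanov_at_zero pK cardK d1 e0 Dr ha0 nz_z; rewrite sz; apply: leq_trans.
rewrite leq_mul2l; apply/orP; right.
rewrite -[X in (_ <= X)%N](card_imset _ (addIr a)); apply/subset_leq_card/subsetP => t.
rewrite inE => tz; apply/imsetP; exists (t - a); last by rewrite subrK.
by move: tz; rewrite inE !hornerM horner_comp !hornerE subrK.
Qed.

(** Upper bounds on the fibres suffice. Since the [w z] sum to 0, each count [b z] may be traded for
    the nonnegative defect [M / d - b z], and the defects add up to at most [M] minus the number of
    [t] with [f(t)] nonzero, which is the error term. *)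
Lemma stepanov_char_sum (K : finFieldType) (p u d e : nat) (h : {poly K}) (a : K)
    (w : K -> algC) :
  let r := (p ^ u)%N in let f := ('X - a%:P) * h in
  p \in [pchar K] -> #|K| = (r ^ 2)%N -> (1 < d)%N -> (0 < e)%N -> r = (d * e).+1 ->
  h.[a] != 0 ->
  (forall z, z ^+ d = 1 -> `|w z| <= 1) -> \sum_(z | z ^+ d == 1) w z = 0 ->
  `|\sum_(t | f.[t] != 0) w (f.[t] ^+ (e * r.+1))|
     <= (d * ((size h * d.+1 + 5) + size h) * r + (size h).+1)%:R.
Proof.
move=> r f pK cardK d1 e0 Dr ha w1 w0.
set C := (d * _)%N in |- *.
pose b z := #|[set t : K | f.[t] ^+ (e * r.+1) == z]|.
have dd : (d != 0)%N by rewrite -lt0n ltnW.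
have nz_h : h != 0 by apply: contraNneq ha => ->; rewrite horner0.
have nz1 (z : K) : z ^+ d == 1 -> z != 0.
  by apply: contraTneq => ->; rewrite expr0n (negPf dd) eq_sym oner_eq0.
have bC z : z ^+ d == 1 -> (d * b z <= r ^ 2 + C * r)%N.
  by move/nz1; apply: stepanov.
have em : (d * (e * r.+1) = #|K|.-1)%N by rewrite cardK mulnA Dr; lia.
have img t : f.[t] != 0 -> (f.[t] ^+ (e * r.+1)) ^+ d == 1.
  move=> nz_ft; rewrite -exprM mulnC em; apply/eqP/(mulfI nz_ft).
  by rewrite mulr1 -exprS prednK ?expf_card // ltnW ?finNzRing_gt1.
have nz_e : (e * r.+1 != 0)%N by rewrite muln_eq0 eqn0Ngt e0.
have nzE t z : z ^+ d == 1 -> f.[t] ^+ (e * r.+1) == z -> f.[t] != 0.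
  move=> /nz1 nz_z; apply: contraTneq => ->.
  by rewrite expr0n (negPf nz_e) eq_sym.
have sumE (v : K -> algC) : \sum_(t | f.[t] != 0) v (f.[t] ^+ (e * r.+1))
    = \sum_(z | z ^+ d == 1) v z * (b z)%:R.
  rewrite (partition_big (fun t => f.[t] ^+ (e * r.+1)) (fun z => z ^+ d == 1)) //=.
  apply: eq_bigr => z z1; rewrite (eq_bigr (fun=> v z)); last first.
    by move=> t /andP[_ /eqP->].
  rewrite sumr_const mulr_natr; congr (_ *+ _); apply: eq_card => t.
  rewrite inE unfold_in /=; apply/andP/idP => [[_ ->] // | tz]; split=> //.
  exact: nzE z1 tz.
set M := (r ^ 2 + C * r)%N in bC.
have -> : \sum_(t | f.[t] != 0) w (f.[t] ^+ (e * r.+1))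
  = - (\sum_(z | z ^+ d == 1) w z * (M%:R / d%:R - (b z)%:R)).
  have e0' : \sum_(z | z ^+ d == 1) w z * (M%:R / d%:R) = 0.
    by rewrite -mulr_suml w0 mul0r.
  rewrite sumE -[LHS]subr0 -[X in _ - X = _]e0' -sumrB -sumrN.
  by apply: eq_bigr => z _; ring.
have d_neq0 : d%:R != 0 :> algC by rewrite pnatr_eq0.
have d_gt0 : 0 < d%:R :> algC by rewrite ltr0n lt0n.
have pos z : z ^+ d == 1 -> 0 <= M%:R / d%:R - (b z)%:R :> algC.
  by move=> z1; rewrite subr_ge0 ler_pdivlMr // -natrM ler_nat mulnC bC.
rewrite normrN; apply: (le_trans (ler_norm_sum _ _ _)).
apply: (@le_trans _ _ (\sum_(z : K | z ^+ d == 1) (M%:R / d%:R - (b z)%:R))).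
  apply: ler_sum => z z1; rewrite normrM [X in _ * X]ger0_norm ?pos //.
  by rewrite ler_piMl ?pos // w1 //; apply/eqP.
rewrite sumrB sumr_const.
have -> : \sum_(z : K | z ^+ d == 1) (b z)%:R = #|[set t | f.[t] != 0]|%:R :> algC.
  rewrite -sum1_card natr_sum; under [RHS]eq_bigl => t do rewrite inE.
  rewrite (sumE (fun=> 1)); by apply: eq_bigr => z _; rewrite mul1r.
have card_mu : (#|[pred z : K | z ^+ d == 1%R]| <= d)%N.
  rewrite cardE; apply: max_unity_roots; rewrite ?lt0n ?enum_uniq //.
  by apply/allP => z; rewrite mem_enum inE unity_rootE.
have card_root : (r ^ 2 <= #|[set t | f.[t] != 0%R]| + (size h).+1)%N.
  rewrite -cardK -(cardsC [set t | f.[t] != 0]) leq_add2l cardE.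
  have nz_f : f != 0 by rewrite mulf_neq0 ?polyXsubC_eq0.
  apply: (@leq_trans (size f)); last first.
    by rewrite size_monicM ?monicXsubC // size_XsubC.
  apply/ltnW/(max_poly_roots nz_f); last exact: enum_uniq.
  by apply/allP => t; rewrite mem_enum !inE negbK rootE.
rewrite lerBlDr -[_ *+ _]mulr_natr -natrD.
apply: (@le_trans _ _ M%:R).
  rewrite mulrAC ler_pdivrMr // ler_wpM2l // ler_nat //.
by rewrite ler_nat; move: card_root; rewrite /M; lia.
Qed.

(** * Newton's identities for multiplicative functions of polynomials *)

Definition monics (F : finFieldType) (n : nat) : seq {poly F} :=
  [seq f <- [seq val g | g : {poly_n.+1 F}] | (f \is monic) && (size f == n.+1)].

Definition irreds (F : finFieldType) (n : nat) : seq {poly F} :=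
  [seq f <- monics F n | irreducibleb f].

Section Monics.
Variable F : finFieldType.

Lemma mem_monics n (f : {poly F}) :
  (f \in monics F n) = (f \is monic) && (size f == n.+1).
Proof.
rewrite mem_filter; case: (boolP ((f \is monic) && _)) => //= /andP[_ /eqP sf].
have le_f : (size f <= n.+1)%N by rewrite sf.
by apply/mapP; exists (NPoly le_f); rewrite ?mem_enum.
Qed.

Lemma monics_uniq n : uniq (monics F n).
Proof. by rewrite filter_uniq // map_inj_uniq ?enum_uniq //; apply: val_inj. Qed.

Lemma monics0 : monics F 0 = [:: 1].
Proof.
apply: perm_small_eq => //; apply: uniq_perm; rewrite ?monics_uniq // => f.
rewrite mem_monics inE; apply/andP/eqP => [[mf sf]|->]; last first.
  by rewrite monic1 size_poly1.
have /size_poly1P[c _ Df] := sf.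
by move: mf; rewrite Df monicE lead_coefC => /eqP->.
Qed.

Lemma mem_irreds n (P : {poly F}) :
  (P \in irreds F n) = [&& irreducibleb P, P \is monic & size P == n.+1].
Proof. by rewrite mem_filter mem_monics. Qed.

Lemma irreds_uniq n : uniq (irreds F n).
Proof. exact/filter_uniq/monics_uniq. Qed.

Lemma monic_irreducible_factor (f : {poly F}) :
  (1 < size f)%N -> exists2 P : {poly F}, P \in irreds F (size P).-1 & P %| f.
Proof.
elim: {f}(size f) {-2}f (leqnn (size f)) => [|n IHn] f le_fn f_gt1.
  by move: (leq_trans f_gt1 le_fn).
have nz_f : f != 0 by rewrite -size_poly_gt0 ltnW.
case: (boolP (irreducibleb f)) => [irr_f | ].
  have nz_lc : (lead_coef f)^-1 != 0 by rewrite invr_eq0 lead_coef_eq0.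
  exists ((lead_coef f)^-1 *: f); last by rewrite dvdpZl.
  rewrite mem_irreds monicE lead_coefZ mulVf ?lead_coef_eq0 // eqxx.
  rewrite size_scale // prednK ?eqxx ?andbT 1?ltnW //.
  apply/irreducibleP; split; first by rewrite size_scale.
  move=> q q1; rewrite dvdpZr // => qf.
  rewrite (eqp_trans ((irreducibleP _ irr_f).2 q q1 qf)) // eqp_sym.
  exact: eqp_scale.
rewrite /irreducibleb f_gt1 /= negb_forall => /existsP[q].
rewrite negb_imply -ltnNge -Pdiv.Idomain.dvdpE => /andP[qf q_gt1].
have [|P iP Pq] := IHn q _ q_gt1.
  by apply: leq_trans (size_npoly q) _; rewrite -ltnS prednK // ltnW.
by exists P => //; apply: dvdp_trans Pq qf.
Qed.

(** Each irreducible [P] is counted once for every [i] up to its multiplicity in [f]: the von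
    Mangoldt function summed over divisors. The bound [n] stays fixed while irreducible factors are
    split off from [f]. *)
Lemma degree_sum_prime_powers n (f : {poly F}) :
  f != 0 -> (size f <= n.+1)%N ->
  (\sum_(1 <= e < n.+1) \sum_(P <- irreds F e) \sum_(1 <= i < n.+1)
     (P ^+ i %| f)%R * e)%N = (size f).-1.
Proof.
elim: {f}(size f) {-2}f (leqnn (size f)) => [|m IHm] f le_fm nz_f le_fn.
  by move: le_fm; rewrite leqn0 size_poly_eq0 (negPf nz_f).
have [f_gt1 | f_le1] := ltnP 1 (size f); last first.
  have -> : (size f).-1 = 0%N by move: f_le1; case: size => [|[]].
  rewrite big_nat big1 // => e /andP[e_gt0 _].
  rewrite big_seq big1 // => P; rewrite mem_irreds => /and3P[_ mP /eqP sP].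
  rewrite big_nat big1 // => i /andP[i_gt0 _].
  case: (boolP (P ^+ i %| f)) => // /dvdp_leq; rewrite nz_f => /(_ isT).
  rewrite polySpred ?expf_neq0 ?monic_neq0 // size_exp sP /=.
  move/leq_trans/(_ f_le1); rewrite ltnS leqn0 muln_eq0.
  by rewrite (gtn_eqF e_gt0) (gtn_eqF i_gt0).
have [P0 iP0 /dvdpP[g Dg]] := monic_irreducible_factor f_gt1.
have [nz_g nz_P0] : g != 0 /\ P0 != 0.
  by move: nz_f; rewrite Dg mulf_eq0 negb_or => /andP.
set d := (size P0).-1 in iP0.
have /and3P[/irreducibleP irrP0 mP0 /eqP sP0] := etrans (esym (mem_irreds _ _)) iP0.
clearbody d.
have d_gt0 : (0 < d)%N by have := irrP0.1; rewrite sP0.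
have sf : size f = (size g + d)%N by rewrite Dg size_Mmonic // sP0 addnS.
have sg0 : (0 < size g)%N by rewrite size_poly_gt0.
have d_le_n : (d <= n)%N by move: le_fn sg0; rewrite sf; move: (size g); lia.
have dvdE e P i : P \in irreds F e -> (0 < i)%N ->
    (P ^+ i %| f) = if P == P0 then (P ^+ i.-1 %| g) else (P ^+ i %| g).
  move=> iP i_gt0; have [->|neqP] := eqVneq P P0.
    by rewrite Dg mulrC -{1}(prednK i_gt0) exprS dvdp_mul2l.
  rewrite Dg Gauss_dvdpl // coprimep_expl // irreducible_poly_coprime; last first.
    by move: iP; rewrite mem_irreds => /andP[/irreducibleP].
  apply/negP => PP0; move: iP; rewrite mem_irreds => /and3P[/irreducibleP irrP mP _].
  have := irrP0.2 P _ PP0; rewrite eqp_monic // (negPf neqP) => /(_ _)/negP; apply => //.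
  by rewrite neq_ltn irrP.1 orbT.
(* From [f] to [g] the exponents of [P0] shift by one; the top exponent [n] is out of reach for [g],
   so the range need not change. *)
have top : P0 ^+ n %| g = false.
  apply/negP => /dvdp_leq; rewrite nz_g => /(_ isT).
  rewrite polySpred ?expf_neq0 // size_exp sP0 /= => le1.
  by have := leq_pmull n d_gt0; move: le1 le_fn; rewrite sf; move: (size g) (d * n)%N; lia.
have inner e P : P \in irreds F e ->
    (\sum_(1 <= i < n.+1) (P ^+ i %| f)%R * e
      = \sum_(1 <= i < n.+1) (P ^+ i %| g)%R * e + (P == P0) * e)%N.
  move=> iP; transitivity (\sum_(1 <= i < n.+1)
      (if P == P0 then P ^+ i.-1 %| g else P ^+ i %| g)%R * e)%N.
    by apply: eq_big_nat => i /andP[i_gt0 _]; rewrite (dvdE e).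
  have [eqP|] := eqVneq P P0; last by rewrite addn0.
  rewrite eqP; have n_gt0 := leq_trans d_gt0 d_le_n.
  rewrite -(prednK n_gt0) in top *; rewrite [LHS]big_add1 /= big_nat_recl //.
  by rewrite expr0 dvd1p mul1n addnC big_nat_recr //= top addn0 big_add1.
transitivity (\sum_(1 <= e < n.+1) \sum_(P <- irreds F e)
   (\sum_(1 <= i < n.+1) (P ^+ i %| g)%R * e + (P == P0) * e))%N.
  by apply: eq_bigr => e _; rewrite !big_seq; apply: eq_bigr => P; apply: inner.
under eq_bigr => e _ do rewrite big_split.
have [le_gm le_gn] : (size g <= m /\ size g <= n.+1)%N.
  by move: le_fm le_fn; rewrite sf; move: (size g); lia.
rewrite big_split /= IHm //.
rewrite (bigD1_seq d) ?iota_uniq ?mem_index_iota ?d_gt0 //=.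
rewrite (bigD1_seq P0) ?irreds_uniq //= eqxx mul1n big1_seq ?addn0; last first.
  by move=> P /andP[/negPf-> _].
rewrite big1 ?addn0 => [|e neq_ed]; first by move: sg0; rewrite sf; move: (size g); lia.
rewrite big1_seq // => P /andP[_ iP]; case: eqVneq => // eqP; rewrite eqP in iP.
by move: iP neq_ed; rewrite mem_irreds sP0 eqSS eq_sym => /and3P[_ _ ->].
Qed.
End Monics.

Lemma sum_multiples (R : nmodType) (e n : nat) (G : nat -> R) : (0 < e)%N ->
  \sum_(1 <= i < n.+1 | (e * i <= n)%N) G i
    = \sum_(1 <= j < n.+1 | (e %| j)%N) G (j %/ e)%N.
Proof.
move=> e_gt0; rewrite -big_filter -[RHS]big_filter.
rewrite -(big_map (fun j => j %/ e)%N xpredT); apply: perm_big.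
apply: uniq_perm; first by rewrite filter_uniq ?iota_uniq.
  rewrite map_inj_in_uniq ?filter_uniq ?iota_uniq // => i j.
  rewrite !mem_filter => /andP[ei _] /andP[ej _] eq_ij.
  by rewrite -(divnK ei) -(divnK ej) eq_ij.
move=> i; rewrite mem_filter mem_index_iota ltnS; apply/andP/mapP.
  case=> le_n /andP[i_gt0 _]; exists (e * i)%N; last by rewrite mulKn.
  by rewrite mem_filter dvdn_mulr // mem_index_iota ltnS le_n muln_gt0 e_gt0 i_gt0.
case=> j; rewrite mem_filter mem_index_iota ltnS => /and3P[ej j_gt0 le_n] ->.
rewrite mulnC divnK // le_n divn_gt0 // (dvdn_leq j_gt0 ej).
by rewrite (leq_trans (leq_div _ _)).
Qed.

Section Newton.
Variables (F : finFieldType) (R : comNzRingType) (X : {poly F} -> R).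
Hypotheses (X1 : X 1 = 1) (XM : forall f g, X (f * g) = X f * X g).

Definition monic_sum n := \sum_(f <- monics F n) X f.

Definition prime_power_sum e i := \sum_(P <- irreds F e) e%:R * X P ^+ i.

(** The sum of [Lambda(f) X(f)] over monic [f] of degree [n], where [Lambda(P^i)] is the degree of
    [P]: the coefficient of [u^n] in [u L'(u) / L(u)], with [L] the generating series of
    [monic_sum]. *)
Definition mangoldt_sum n :=
  \sum_(1 <= e < n.+1 | (e %| n)%N) prime_power_sum e (n %/ e)%N.

Lemma monic_sum0 : monic_sum 0 = 1.
Proof. by rewrite /monic_sum monics0 big_seq1. Qed.

Lemma XX f i : X (f ^+ i) = X f ^+ i.
Proof. by elim: i => [|i IHi]; rewrite ?expr0 // !exprS XM IHi. Qed.

Lemma monic_sum_multiples n e i (P : {poly F}) : P \in irreds F e ->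
  \sum_(f <- monics F n | P ^+ i %| f) X f
    = if (e * i <= n)%N then X P ^+ i * monic_sum (n - e * i) else 0.
Proof.
rewrite mem_irreds => /and3P[_ mP /eqP sP].
have mPi : P ^+ i \is monic by rewrite monic_exp.
have nzPi := monic_neq0 mPi.
have sPi : size (P ^+ i) = (e * i).+1.
  by rewrite polySpred // size_exp sP.
case: leqP => [le_n | lt_n]; last first.
  rewrite big1_seq // => f /andP[/dvdp_leq Pf].
  rewrite mem_monics => /andP[mf /eqP sf].
  by move: (Pf (monic_neq0 mf)); rewrite sf sPi ltnS leqNgt lt_n.
rewrite -XX mulr_sumr -big_filter.
under [RHS]eq_bigr => g _ do rewrite -XM.
rewrite -(big_map (fun g => P ^+ i * g) xpredT X); apply: perm_big.
apply: uniq_perm.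
- by rewrite filter_uniq ?monics_uniq.
- by rewrite map_inj_uniq ?monics_uniq //; apply: mulfI.
move=> f; rewrite mem_filter mem_monics; apply/andP/mapP.
  case=> /dvdpP[g Df] /andP[mf /eqP sf]; exists g; last by rewrite mulrC.
  rewrite mem_monics; move: mf sf; rewrite Df monicMr // => mg.
  by rewrite mg size_Mmonic ?monic_neq0 // sPi addnS /= => Es; apply/eqP; lia.
case=> g; rewrite mem_monics => /andP[mg /eqP sg] ->; rewrite dvdp_mulr //.
by rewrite rpredM // size_Mmonic ?monic_neq0 // sg sPi; split=> //; apply/eqP; lia.
Qed.

(** The coefficient form of [u L' = L * (u L' / L)]: the degree of each [f] is distributed over the
    prime powers dividing it, and the summations are exchanged. *)
Lemma newton_identity n :
  n%:R * monic_sum n = \sum_(1 <= j < n.+1) mangoldt_sum j * monic_sum (n - j).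
Proof.
rewrite mulr_sumr.
transitivity (\sum_(f <- monics F n) \sum_(1 <= e < n.+1) \sum_(P <- irreds F e)
    \sum_(1 <= i < n.+1) if P ^+ i %| f then e%:R * X f else 0).
  apply: eq_big_seq => f; rewrite mem_monics => /andP[mf /eqP sf].
  have le_f : (size f <= n.+1)%N by rewrite sf.
  have := degree_sum_prime_powers (monic_neq0 mf) le_f; rewrite sf /= => Dn.
  rewrite -[X in X%:R * _]Dn.
  rewrite natr_sum mulr_suml; apply: eq_bigr => e _.
  rewrite natr_sum mulr_suml; apply: eq_bigr => P _.
  rewrite natr_sum mulr_suml; apply: eq_bigr => i _.
  by case: ifP; rewrite ?mul1n ?mul0n ?mul0r.
rewrite exchange_big /=.
transitivity (\sum_(1 <= e < n.+1) \sum_(1 <= j < n.+1 | (e %| j)%N)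
    prime_power_sum e (j %/ e) * monic_sum (n - j)).
  apply: eq_big_nat => e /andP[e_gt0 _].
  rewrite exchange_big /=.
  transitivity (\sum_(P <- irreds F e) \sum_(1 <= i < n.+1 | (e * i <= n)%N)
      e%:R * X P ^+ i * monic_sum (n - e * i)).
    apply: eq_big_seq => P iP; rewrite exchange_big /=.
    rewrite [RHS]big_mkcond; apply: eq_bigr => i _; rewrite -big_mkcond /=.
    rewrite -mulr_sumr (monic_sum_multiples _ _ iP) -mulrA.
    by case: ifP; rewrite ?mulr0.
  rewrite exchange_big /=.
  under eq_bigr => i _ do rewrite -mulr_suml.
  rewrite sum_multiples //; apply: eq_bigr => j ej; first by rewrite mulnC divnK.
rewrite (exchange_big_dep xpredT) //=; apply: eq_big_nat => j /andP[j_gt0 le_jn].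
rewrite -mulr_suml /mangoldt_sum (@big_nat_widen _ _ _ 1 j.+1 n.+1) //.
congr (_ * _); apply: eq_bigl => e; rewrite ltnS.
by case: (boolP (e %| j)%N) => // /(dvdn_leq j_gt0)->.
Qed.
End Newton.

(** [1 + A 1 u + A 2 u^2 + A 3 u^3] vanishes at [u = 1], so it equals [(1 - u)(1 - x u)(1 - y u)],
    where [x] and [y] are the roots of [T^2 + (1 + A 1) T + (1 + A 1 + A 2)]. *)
Lemma newton_power_sums (A S : nat -> algC) :
  A 0%N = 1 -> (forall n, (3 < n)%N -> A n = 0) -> 1 + A 1%N + A 2%N + A 3%N = 0 ->
  (forall n, n%:R * A n = \sum_(1 <= j < n.+1) S j * A (n - j)%N) ->
  exists xy : algC * algC, 1 + A 1%N = - (xy.1 + xy.2) /\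
    forall n, (0 < n)%N -> S n = - (xy.1 ^+ n + xy.2 ^+ n + 1).
Proof.
move=> A0 A4 A123 Newton.
pose D := sqrtC ((1 + A 1%N) ^+ 2 - 4 * (1 + A 1%N + A 2%N)).
have DD : D ^+ 2 = (1 + A 1%N) ^+ 2 - 4 * (1 + A 1%N + A 2%N) by rewrite sqrtCK.
pose x := (- (1 + A 1%N) + D) / 2; pose y := (- (1 + A 1%N) - D) / 2.
have two : 2 != 0 :> algC by rewrite pnatr_eq0.
have xy_sum : x + y = - (1 + A 1%N) by rewrite /x /y; field.
have xy_prod : x * y = 1 + A 1%N + A 2%N.
  have -> : x * y = ((1 + A 1%N) ^+ 2 - D ^+ 2) / 4 by rewrite /x /y; field.
  by rewrite DD; field.
have a1 : A 1%N = - (x + y) - 1 by rewrite xy_sum; ring.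
have a2 : A 2%N = x * y + (x + y) by rewrite xy_prod xy_sum; ring.
have a3 : A 3%N = - (x * y) by apply/eqP; rewrite -addr_eq0 addrC xy_prod A123.
exists (x, y); split=> /=; first by rewrite xy_sum opprK.
clearbody x y; clear xy_sum xy_prod D DD A123.
have solve (a b c : algC) : c = a + b -> b = c - a by move=> ->; ring.
have S1 : S 1%N = - (x ^+ 1 + y ^+ 1 + 1).
  have := Newton 1%N; rewrite big_nat1 subnn A0 mulr1 mul1r => <-.
  by rewrite a1; ring.
have S2 : S 2%N = - (x ^+ 2 + y ^+ 2 + 1).
  have := Newton 2%N; rewrite big_nat_recr //= big_nat1 subnn A0 mulr1 S1.
  by rewrite [(2 - 1)%N]/= a1 a2 => /solve->; ring.
have S3 : S 3%N = - (x ^+ 3 + y ^+ 3 + 1).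
  have := Newton 3%N; rewrite big_nat_recr //= big_nat_recr //= big_nat1 subnn A0 mulr1 S1 S2.
  by rewrite [(3 - 1)%N]/= [(3 - 2)%N]/= a1 a2 a3 => /solve->; ring.
suff Sn n : [/\ S n.+1 = - (x ^+ n.+1 + y ^+ n.+1 + 1),
    S n.+2 = - (x ^+ n.+2 + y ^+ n.+2 + 1) & S n.+3 = - (x ^+ n.+3 + y ^+ n.+3 + 1)].
  by case=> // n _; have [] := Sn n.
elim: n => [|n [IH1 IH2 IH3]]; split=> //.
(* Beyond degree 3 the identity is a linear recurrence of order three with characteristic roots [x],
   [y] and 1. *)
have := Newton n.+4; rewrite A4 // mulr0; do 4!rewrite big_nat_recr //=.
rewrite big_nat big1 => [|j /andP[_ jn]].
  rewrite subnn A0 mulr1 add0r IH1 IH2 IH3.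
  have [-> [-> ->]] : (n.+4 - n.+3 = 1 /\ n.+4 - n.+2 = 2 /\ n.+4 - n.+1 = 3)%N by lia.
  by rewrite a1 a2 a3 => /solve->; rewrite !exprS; ring.
by rewrite A4 ?mulr0 //; lia.
Qed.

Lemma pow2_bound_le1 (x C : algC) : 0 <= x ->
  (forall j, x ^+ (2 ^ j) <= C) -> x <= 1.
Proof.
move=> x0 xC; rewrite real_leNgt ?ger0_real //; apply/negP => x1.
have e0 : 0 < x - 1 by rewrite subr_gt0.
have bern n : 1 + n%:R * (x - 1) <= x ^+ n.
  elim: n => [|n IHn]; first by rewrite mul0r addr0 expr0.
  rewrite exprS; apply: le_trans (ler_wpM2l x0 IHn).
  rewrite -subr_ge0.
  have -> : x * (1 + n%:R * (x - 1)) - (1 + n.+1%:R * (x - 1)) = n%:R * (x - 1) ^+ 2.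
    by rewrite -natr1; ring.
  by rewrite mulr_ge0 // exprn_ge0 // ltW.
have C0 : 0 <= C by apply: le_trans (xC 0%N); rewrite exprn_ge0.
pose b := Num.bound (C / (x - 1)).
have ltC : C < b%:R * (x - 1).
  by rewrite -ltr_pdivrMr //; apply: archi_boundP; rewrite divr_ge0 // ltW.
suff /(lt_le_trans ltC) : b%:R * (x - 1) <= C by rewrite ltxx.
apply: le_trans (xC b).
have bb : (b <= 2 ^ b)%N by apply/ltnW/ltn_expl.
apply: le_trans (bern _); rewrite -[X in X <= _]add0r lerD //.
by rewrite ler_wpM2r ?ler_nat // ltW.
Qed.

(** After scaling to [r = 1], the product [X Y] is half of [(X + Y)^2 - (X^2 + Y^2)], hence bounded
    along the powers [2^j], and [|x y| <= 1]. So the smaller root has modulus at most 1, and then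
    the powers of the other are bounded as well. *)
Lemma root_pair_bound (x y r C : algC) : 0 < r ->
  (forall j, `|x ^+ (2 ^ j) + y ^+ (2 ^ j)| <= C * r ^+ (2 ^ j)) ->
  `|x| <= r /\ `|y| <= r.
Proof.
move=> r0 bd.
have nz_r : r != 0 by rewrite gt_eqF.
wlog r1 : x y r r0 nz_r bd / r = 1.
  move=> IH; have := IH (x / r) (y / r) 1.
  rewrite ltr01 oner_neq0 !normf_div (gtr0_norm r0) !ler_pdivrMr // !mul1r.
  apply=> // j; rewrite !expr_div_n -mulrDl normf_div expr1n mulr1.
  by rewrite [`|r ^+ _|]gtr0_norm ?exprn_gt0 // ler_pdivrMr ?exprn_gt0.
move: bd; rewrite r1 {r r0 nz_r r1} => bd0.
have bd j : `|x ^+ (2 ^ j) + y ^+ (2 ^ j)| <= C by have := bd0 j; rewrite expr1n mulr1.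
have C0 : 0 <= C := le_trans (normr_ge0 _) (bd 0%N).
have xy1 : `|x * y| <= 1.
  apply: (@pow2_bound_le1 _ (C ^+ 2 + C)) => // j; rewrite -normrX exprMn.
  set X := x ^+ _; set Y := y ^+ _.
  have -> : X * Y = ((X + Y) ^+ 2 - (X ^+ 2 + Y ^+ 2)) / 2 by field.
  rewrite normf_div normr_nat ler_pdivrMr ?ltr0n //.
  apply: le_trans (ler_normB _ _) _; rewrite normrX.
  have bX : `|X ^+ 2 + Y ^+ 2| <= C.
    by have := bd j.+1; rewrite expnS mulnC !exprM.
  apply: le_trans (lerD (lerXn2r 2 _ _ (bd j)) bX) _; rewrite ?nnegrE //.
  by rewrite mulr_natr mulr2n lerDl addr_ge0 // exprn_ge0.
wlog le_xy : x y bd xy1 {bd0} / `|y| <= `|x|.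
  move=> IH; have /orP[] : (`|y| <= `|x|) || (`|x| <= `|y|).
    by apply: real_leVge; apply: normr_real.
  - exact: IH.
  - by move=> le_yx; apply/and_comm; apply: IH; rewrite 1?mulrC // => j; rewrite addrC.
suff x1 : `|x| <= 1 by split=> //; apply: le_trans x1.
have y1 : `|y| <= 1.
  rewrite -(@expr_le1 _ 2) //; apply: le_trans xy1.
  by rewrite normrM expr2 ler_wpM2r.
apply: (@pow2_bound_le1 _ (C + 1)) => // j.
rewrite -normrX -[x ^+ _](addrK (y ^+ (2 ^ j))).
apply: le_trans (ler_normB _ _) _; apply: lerD; first exact: bd.
by rewrite normrX exprn_ile1.
Qed.

(** * Finite fields *)

Lemma finField_card_pchar (K : finFieldType) :
  exists p u, p \in [pchar K] /\ #|K| = (p ^ u)%N.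
Proof.
have [p _ pK] := finPcharP K; exists p, (logn p #|K|); split=> //.
by rewrite {1}(card_pprimeChar pK).
Qed.

Lemma two_neq0_of_odd (K : finFieldType) : odd #|K| -> 1 + 1 != 0 :> K.
Proof.
have [p [u [pK cardK]]] := finField_card_pchar K.
move=> oddK; apply: contraTneq oddK => two0.
have : 2%N \in [pchar K] by rewrite inE /= -[2%:R]/(1 + 1) two0.
rewrite cardK (pcharf_eq pK) inE => /eqP <-; case: u cardK => [|u]; rewrite ?oddX // => c1.
by have := finNzRing_gt1 K; rewrite c1.
Qed.

Lemma expf_pred_card (K : finFieldType) (x : K) : x != 0 -> x ^+ #|K|.-1 = 1.
Proof.
move=> nz_x; apply: (mulfI nz_x).
by rewrite mulr1 -exprS prednK ?expf_card // ltnW ?finNzRing_gt1.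
Qed.

Lemma finField_primitive_root (K : finFieldType) :
  exists g : K, (#|K|.-1).-primitive_root g.
Proof.
have : has (#|K|.-1).-primitive_root [seq x <- enum K | x != 0].
  apply: has_prim_root; rewrite ?filter_uniq ?enum_uniq //.
  - by rewrite -ltnS prednK ?finNzRing_gt1 // ltnW ?finNzRing_gt1.
  - apply/allP => x; rewrite mem_filter unity_rootE => /andP[nz_x _]; apply/eqP.
    exact: expf_pred_card.
  - by rewrite -enumT enum_uniq.
  - have <- : #|predC1 (0 : K)| = #|K|.-1 by exact: cardC1.
    rewrite cardE; apply: uniq_leq_size (enum_uniq _) _ => x.
    by rewrite mem_enum mem_filter mem_enum andbT.
by case/hasP => g _; exists g.
Qed.

Section PrimitiveRoot.
Variables (K : finFieldType) (g : K).
Hypothesis g_prim : (#|K|.-1).-primitive_root g.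

Lemma primitive_root_neq0 : g != 0.
Proof.
apply: contra_eq_neq (prim_expr_order g_prim) => ->.
by rewrite expr0n gtn_eqF ?(prim_order_gt0 g_prim) // eq_sym oner_neq0.
Qed.

Lemma primitive_root_log y : y != 0 -> exists m, y = g ^+ m.
Proof. by move/expf_pred_card/(prim_rootP g_prim) => [m ->]; exists m. Qed.

Lemma primitive_root_primitive_elt : primitive_elt g.
Proof. by split; [exact: primitive_root_neq0 | exact: primitive_root_log]. Qed.

End PrimitiveRoot.

(** Squaring identifies 1 and -1, so it misses some [a], and [X^2 - a] is irreducible. *)
Lemma quadratic_extension (K : finFieldType) : odd #|K| ->
  exists (K' : finFieldType) (phi : {rmorphism K -> K'}), #|K'| = (#|K| ^ 2)%N.
Proof.
move=> oddK.
have two_neq0 : 1 != - 1 :> K by rewrite -addr_eq0 two_neq0_of_odd.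
have [a a_nonsq] : exists a : K, forall x, x ^+ 2 != a.
  have : ~~ [forall a : K, [exists x : K, x ^+ 2 == a]].
    apply/negP => /forallP sq; pose f a := xchoose (existsP (sq a)).
    have fK : cancel f (fun x => x ^+ 2) by move=> a; apply/eqP/(xchooseP (existsP (sq a))).
    have /can_inj sq_inj := canF_sym fK.
    by move/eqP: two_neq0; apply; apply: sq_inj; rewrite sqrrN.
  rewrite negb_forall => /existsP[a]; rewrite negb_exists => /forallP a_nonsq.
  by exists a.
pose P : {poly K} := 'X^2 - a%:P.
have mP : P \is monic by rewrite monicXnsubC.
have sP : size P = 3%N by rewrite size_XnsubC.
have iP : irreducible_poly P.
  apply: cubic_irreducible; rewrite ?sP // => x.
  by rewrite rootE !hornerE subr_eq0 a_nonsq.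
have mi : monic_irreducible_poly P by split.
exists {poly %/ P with mi}, (qpolyC P : {rmorphism K -> {poly %/ P with mi}}).
by rewrite card_qfpoly sP.
Qed.

Lemma quadratic_tower (K : finFieldType) j : odd #|K| ->
  exists (K' : finFieldType) (phi : {rmorphism K -> K'}), #|K'| = (#|K| ^ (2 ^ j))%N.
Proof.
move=> oddK; elim: j => [|j [K1 [phi1 card1]]].
  by exists K, (idfun : {rmorphism K -> K}); rewrite expn1.
have [|K2 [phi2 card2]] := @quadratic_extension K1; first by rewrite card1 oddX oddK orbT.
exists K2, (phi2 \o phi1 : {rmorphism K -> K2}).
by rewrite card2 card1 -expnM expnSr.
Qed.

(** * Frobenius and conjugates over a subfield *)

Section Subfield.
Variables (F k : finFieldType) (mu : {rmorphism F -> k}).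
Local Notation q := #|F|.

Lemma finite_frobenius : exists phi : {rmorphism k -> k}, forall x, phi x = x ^+ q.
Proof.
have [p [u [pF ->]]] := finField_card_pchar F.
have pk : p \in [pchar k] by rewrite (fmorph_pchar mu).
elim: u => [|u [phi IH]].
  by exists (idfun : {rmorphism k -> k}) => x; rewrite expr1.
exists (pFrobenius_aut pk \o phi : {rmorphism k -> k}) => x /=.
by rewrite IH pFrobenius_autE -exprM expnSr.
Qed.

Lemma frobenius_sub m (x y : k) : (x - y) ^+ (q ^ m) = x ^+ (q ^ m) - y ^+ (q ^ m).
Proof.
have [phi phiE] := finite_frobenius.
elim: m => [|m IHm]; first by rewrite !expr1.
by rewrite expnSr !exprM IHm -!phiE rmorphB.
Qed.

Lemma root_frobenius (P : {poly F}) x m :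
  root (map_poly mu P) x -> root (map_poly mu P) (x ^+ (q ^ m)).
Proof.
move=> Px; have [phi phiE] := finite_frobenius.
elim: m => [|m IHm]; first by rewrite expr1.
rewrite expnSr exprM -phiE rootE.
have {1}-> : map_poly mu P = map_poly phi (map_poly mu P).
  apply/polyP => l; rewrite !coef_map /= phiE -rmorphXn /=; congr (mu _).
  by rewrite expf_card.
by rewrite horner_map (rootP IHm) rmorph0.
Qed.

(** [X^q - X] has at most [q] roots, and the image of [F] already supplies [q] of them. *)
Lemma frobenius_fixed_image x : x ^+ q = x -> exists c, mu c = x.
Proof.
move=> xq; suff /codomP[c ->] : x \in codom mu by exists c.
apply: contraT => x_notin.
have q_gt1 := finNzRing_gt1 F.
have nz : 'X^q - 'X != 0 :> {poly k}.
  by rewrite -size_poly_eq0 size_polyDl ?size_polyN ?size_polyX size_polyXn.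
have := @max_poly_roots _ _ (x :: [seq mu c | c : F]) nz.
rewrite /= x_notin map_inj_uniq ?enum_uniq; last exact: fmorph_inj.
rewrite size_map -cardE size_polyDl ?size_polyN ?size_polyX size_polyXn // ltnn.
rewrite rootE !hornerE xq subrr eqxx /= => -> //.
apply/allP => y /mapP[c _ ->].
by rewrite rootE !hornerE -rmorphXn expf_card subrr.
Qed.

Lemma frobenius_fixed_poly (f : {poly k}) :
  (forall i, f`_i ^+ q = f`_i) -> exists g : {poly F}, map_poly mu g = f.
Proof.
move=> fq; have /fin_all_exists[c muc] : forall i : 'I_(size f), exists c, mu c = f`_i.
  by move=> i; apply/frobenius_fixed_image/fq.
exists (\poly_(i < size f) (if insub i is Some j then c j else 0)).
apply/polyP => i; rewrite coef_map coef_poly; case: ltnP => [lti|lei].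
  by rewrite insubT /= muc.
by rewrite nth_default //; apply: rmorph0.
Qed.

(** The product over the conjugates of [t], repeated when [t] lies in a smaller field, is the
    characteristic polynomial of [t] over [F]. Frobenius permutes its factors cyclically. *)
Lemma frobenius_orbit_poly n t : #|k| = (q ^ n)%N ->
  exists g : {poly F}, map_poly mu g = \prod_(j < n) ('X - (t ^+ (q ^ j))%:P).
Proof.
move=> cardk; apply: frobenius_fixed_poly => i.
have [phi phiE] := finite_frobenius; set f := \prod_(j < n) _.
suff Ef : map_poly phi f = f by rewrite -[in RHS]Ef coef_map /= phiE.
rewrite rmorph_prod.
under eq_bigr => j _ do
  rewrite rmorphB /= map_polyX map_polyC /= phiE -exprM -expnSr.
rewrite /f; case: n cardk {f} => [|n] cardk; first by rewrite !big_ord0.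
by rewrite big_ord_recr [RHS]big_ord_recl mulrC /= -cardk expf_card expr1.
Qed.

Lemma monic_dvd_irreducible_exp (P R : {poly F}) e n :
  P \in irreds F e -> R \is monic -> R %| P ^+ n -> exists m, R = P ^+ m.
Proof.
rewrite mem_irreds => /and3P[/irreducibleP iP mP _].
elim: n R => [|n IHn] R mR.
  rewrite expr0 dvdp1 => /size_poly1P[c _ Rc]; exists 0%N.
  by move: mR; rewrite Rc monicE lead_coefC => /eqP->.
move=> RPn; have [PR | PR] := boolP (P %| R); last first.
  apply: IHn => //; apply: dvdp_trans (dvd1p _).
  move: RPn; rewrite -[P ^+ n.+1]mulr1 Gauss_dvdpr //.
  by rewrite coprimep_sym coprimep_expl ?irreducible_poly_coprime.
have /dvdpP[g Dg] := PR.
move: RPn; rewrite exprSr Dg dvdp_mul2r ?monic_neq0 // => /(IHn g)[|m ->]; last first.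
  by exists m.+1; rewrite exprSr.
by rewrite Dg monicMr in mR.
Qed.

Lemma irreducible_root (f : {poly F}) t : f != 0 -> root (map_poly mu f) t ->
  exists e P, P \in irreds F e /\ root (map_poly mu P) t.
Proof.
elim: {f}(size f) {-2}f (leqnn (size f)) => [|m IHm] f le_fm nz_f ft.
  by move: le_fm; rewrite leqn0 size_poly_eq0 (negPf nz_f).
have f_gt1 : (1 < size f)%N.
  rewrite -(size_map_poly mu); apply: root_size_gt1 ft.
  by rewrite map_poly_eq0.
have [P iP /dvdpP[g Dg]] := monic_irreducible_factor f_gt1.
move: ft; rewrite Dg rmorphM rootM => /orP[gt | Pt]; last by exists (size P).-1, P.
have [nz_g nz_P] : g != 0 /\ P != 0.
  by move: nz_f; rewrite Dg mulf_eq0 negb_or => /andP.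
apply: IHm gt => //; move: iP le_fm; rewrite mem_irreds => /and3P[/irreducibleP[sP _] mP _].
by rewrite Dg size_Mmonic //; move: sP; move: (size P) (size g); lia.
Qed.

Lemma irreds_root_unique e e' (P P' : {poly F}) t :
  P \in irreds F e -> P' \in irreds F e' ->
  root (map_poly mu P) t -> root (map_poly mu P') t -> P = P'.
Proof.
rewrite !mem_irreds => /and3P[/irreducibleP iP mP _] /and3P[/irreducibleP iP' mP' _].
move=> Pt P't; have [/eqP //|neqP] := boolP (P == P').
have : ~~ (P %| P').
  apply/negP => PP'; have := iP'.2 P _ PP'; rewrite eqp_monic // (negPf neqP).
  by move=> /(_ _)/negP; apply=> //; rewrite neq_ltn iP.1 orbT.
rewrite -irreducible_poly_coprime // -(coprimep_map mu) => /coprimep_root/(_ Pt).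
by move: P't; rewrite rootE => /eqP->; rewrite eqxx.
Qed.

(** The class of [X] modulo [P] lies in a field of size [q^e], so [P] divides [X^(q^n) - X], which
    splits over [k] without repeated roots. *)
Lemma card_irreducible_roots n e P : #|k| = (q ^ n)%N -> P \in irreds F e ->
  (e %| n)%N -> #|[set t : k | root (map_poly mu P) t]| = e.
Proof.
move=> cardk; rewrite mem_irreds => /and3P[/irreducibleP iP mP /eqP sP] en.
have mi : monic_irreducible_poly P by split.
have PX : P %| 'X^(q ^ n) - 'X.
  pose x : {poly %/ P with mi} := in_qpoly P 'X.
  have xe m : x ^+ (q ^ (e * m)) = x.
    elim: m => [|m IHm]; first by rewrite muln0 expr1.
    rewrite mulnS expnD exprM; have := card_qfpoly mi; rewrite sP /= => <-.
    by rewrite expf_card.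
  have /val_eqP : in_qpoly P ('X^(q ^ n) - 'X) = 0.
    rewrite raddfB /= rmorphXn /= -[X in X ^+ _]/x -(divnK en) mulnC.
    by rewrite (xe (n %/ e)%N) subrr.
  by rewrite /= -Pdiv.IdomainMonic.modpE mk_monicE.
have : map_poly mu P %| \prod_(t <- enum k) ('X - t%:P).
  rewrite big_enum -finField_genPoly cardk.
  by have := PX; rewrite -(dvdp_map mu) rmorphB /= !map_polyXn map_polyX.
case/dvdp_prod_XsubC => m; rewrite eqp_monic ?map_monic ?monic_prod_XsubC // => /eqP DP.
have := size_map_poly mu P; rewrite DP sP size_prod_XsubC => -[<-].
rewrite cardsE; have <- := card_uniqP (mask_uniq (enum_uniq k) m).
by apply: eq_card => t; rewrite -[RHS]root_prod_XsubC -DP.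
Qed.

(** If [t] has minimal polynomial [P] of degree [e], then [orb t = P^(n / e)]; conversely each such
    [P] has exactly [e] roots in [k], which accounts for the weight [e] in [mangoldt_sum]. The
    coefficients thus become character sums over the extension [k]. *)
Lemma mangoldt_sum_field (R : comNzRingType) (X : {poly F} -> R) n
    (orb : k -> {poly F}) :
  (0 < n)%N -> #|k| = (q ^ n)%N -> X 1 = 1 -> (forall f g, X (f * g) = X f * X g) ->
  (forall t, map_poly mu (orb t) = \prod_(j < n) ('X - (t ^+ (q ^ j))%:P)) ->
  mangoldt_sum X n = \sum_t X (orb t).
Proof.
move=> n_gt0 cardk X1 XM orbE.
have key t : X (orb t) = \sum_(1 <= e < n.+1 | (e %| n)%N) \sum_(P <- irreds F e)
    if root (map_poly mu P) t then X P ^+ (n %/ e) else 0.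
  have m_orb : orb t \is monic by rewrite -(map_monic mu) orbE monic_prod_XsubC.
  have rt : root (map_poly mu (orb t)) t.
    by rewrite orbE (bigD1 (Ordinal n_gt0)) //= expr1 rootM root_XsubC eqxx.
  have [e [P [iP Pt]]] := irreducible_root (monic_neq0 m_orb) rt.
  have [irrP mP sP] := and3P (etrans (esym (mem_irreds _ _)) iP).
  have [m Dorb] : exists m, orb t = P ^+ m.
    apply: (@monic_dvd_irreducible_exp _ _ e n) => //.
    rewrite -(dvdp_map mu) orbE rmorphXn /=.
    have -> : map_poly mu P ^+ n = \prod_(j < n) map_poly mu P.
      by rewrite prodr_const card_ord.
    apply: (big_ind2 (fun a b : {poly k} => a %| b)) => // [*|j _]; first exact: dvdp_mul.
    by rewrite dvdp_XsubCl root_frobenius.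
  have Dn : n = (e * m)%N.
    have := size_map_poly mu (orb t); rewrite orbE size_prod_XsubC Dorb.
    rewrite polySpred ?expf_neq0 ?monic_neq0 // size_exp (eqP sP) /= => -[].
    by rewrite /index_enum -enumT size_enum_ord.
  have en : (e %| n)%N by rewrite Dn dvdn_mulr.
  have e_gt0 : (0 < e)%N by rewrite (dvdn_gt0 _ en).
  have e_in : e \in index_iota 1 n.+1 by rewrite mem_index_iota e_gt0 ltnS dvdn_leq.
  rewrite big_mkcond (bigD1_seq e e_in (iota_uniq _ _)) /= en.
  rewrite (bigD1_seq P iP (irreds_uniq _ _)) /= Pt.
  rewrite big1_seq => [|P' /andP[neqP iP']]; last first.
    by case: ifP => // P't; rewrite (irreds_root_unique iP iP' Pt P't) eqxx in neqP.
  rewrite big1_seq => [|e' /andP[neq_e _]]; last first.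
    case: ifP => // _.
    rewrite big1_seq // => P' /andP[_ iP']; case: ifP => // P't.
    have EP := irreds_root_unique iP iP' Pt P't; rewrite -{}EP in iP'.
    by move: iP' neq_e; rewrite mem_irreds (eqP sP) eqSS eq_sym => /and3P[_ _ ->].
  by rewrite !addr0 Dorb (XX X1 XM) Dn mulKn.
under [RHS]eq_bigr => t _ do rewrite key.
rewrite exchange_big /=; apply: eq_bigr => e en.
rewrite exchange_big /=; apply: eq_big_seq => P iP.
rewrite -big_mkcond sumr_const mulr_natl; congr (_ *+ _).
rewrite -[LHS](card_irreducible_roots cardk iP en); apply: eq_card => t.
by rewrite inE.
Qed.

End Subfield.

(** * The character sum bound *)

Lemma big_mul4 (R : comNzRingType) (G : nat -> R) M :
  \prod_(l < 4 * M) G l = \prod_(i < M) \prod_(s < 4) G (4 * i + s)%N.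
Proof.
elim: M => [|M IHM]; first by rewrite muln0 !big_ord0.
rewrite mulnS addnC !addnS addn0 !big_ord_recr /= IHM big_ord0 mul1r.
by rewrite !addnS !addn0 !mulrA.
Qed.

Section CharacterSum.
Variables (F L : finFieldType) (iota : {rmorphism F -> L}) (theta g : L).
Variable chi : L -> algC.
Local Notation q := #|F|.
Hypothesis cardL : #|L| = (q ^ 4)%N.
Hypothesis theta_free : forall f : {poly F}, (size f <= 4)%N ->
  (map_poly iota f).[theta] = 0 -> f = 0.
Hypothesis theta_frob : forall m, (0 < m < 4)%N -> theta ^+ (q ^ m) != theta.
Hypothesis oddF : odd q.
Hypothesis g_prim : (q ^ 4).-1.-primitive_root g.
Hypothesis chi0 : chi 0 = 0.
Hypothesis chiM : forall x y, chi (x * y) = chi x * chi y.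
Hypothesis chiF : forall c, c != 0 -> chi (iota c) = 1.
Hypothesis chig : chi g != 1.

(** A Dirichlet character modulo the minimal polynomial of [theta], even in the sense that it is
    trivial on nonzero constants. *)
Let X (f : {poly F}) := chi (map_poly iota f).[theta].

Let q_gt1 : (1 < q)%N. Proof. exact: finNzRing_gt1. Qed.

Let q_gt0 : (0 < q)%N. Proof. exact: ltnW. Qed.

Let g_prim' : (#|L|.-1).-primitive_root g.
Proof. by rewrite cardL. Qed.

Let nz_g : g != 0 := primitive_root_neq0 g_prim'.

Let g_gen := primitive_root_log g_prim'.

Lemma chi1 : chi 1 = 1.
Proof. by rewrite -(chiF (oner_neq0 F)) rmorph1. Qed.

Lemma chiX x m : chi (x ^+ m) = chi x ^+ m.
Proof. by elim: m => [|m IHm]; rewrite ?expr0 ?chi1 // !exprS chiM IHm. Qed.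

Lemma norm_chi y : y != 0 -> `|chi y| = 1.
Proof.
move=> nz_y; have L1 : (0 < #|L|.-1)%N by have := finNzRing_gt1 L; case: #|L| => [|[]].
have : chi y ^+ #|L|.-1 = 1 by rewrite -chiX expf_pred_card ?chi1.
by move/(congr1 Num.norm)/eqP; rewrite normrX normr1 pexpr_eq1 // => /eqP.
Qed.

Lemma sum_chi : \sum_y chi y = 0.
Proof.
have : \sum_y chi y = chi g * \sum_y chi y.
  rewrite {1}(reindex_inj (mulfI nz_g)) mulr_sumr.
  by apply: eq_bigr => y _; rewrite chiM.
move/eqP; rewrite -subr_eq0 -{1}[X in X - _]mul1r -mulrBl mulf_eq0 subr_eq0.
by rewrite eq_sym (negPf chig) => /eqP.
Qed.

Lemma evalM f h : X (f * h) = X f * X h.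
Proof. by rewrite /X rmorphM hornerM chiM. Qed.

Lemma eval1 : X 1 = 1.
Proof. by rewrite /X rmorph1 hornerC chi1. Qed.

(** 1, [theta], [theta^2], [theta^3] form an [F]-basis of [L], so the arguments of [chi] run over
    [L] exactly once, whatever [c]. *)
Lemma sum_small_polys c : \sum_(r : {poly_4 F}) chi (c + (map_poly iota r).[theta]) = 0.
Proof.
rewrite -[RHS]sum_chi; pose h (r : {poly_4 F}) := c + (map_poly iota r).[theta].
have h_inj : injective h.
  move=> r s /addrI Ers; apply/val_inj/eqP; rewrite -subr_eq0; apply/eqP.
  apply: theta_free; last by rewrite rmorphB hornerD hornerN Ers subrr.
  apply: leq_trans (size_polyD _ _) _; rewrite size_polyN geq_max.
  by rewrite !size_npoly.
have h_bij : bijective h by apply: inj_card_bij; rewrite // cardL card_npoly.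
by rewrite [RHS](reindex h) //; apply: onW_bij.
Qed.

(* For [n > 3], adding polynomials of degree at most 3 permutes the monic ones of
   degree [n], while their values at [theta] run over all of [L]. *)
Lemma monic_sum_vanish n : (3 < n)%N -> monic_sum X n = 0.
Proof.
move=> n_gt3; have shift (r : {poly_4 F}) : monic_sum X n = \sum_(f <- monics F n) X (f + val r).
  rewrite -(big_map (fun f => f + val r) xpredT X); apply: perm_big.
  have sr (f : {poly F}) : size f = n.+1 -> (size (val r) < size f)%N.
    by move->; apply: leq_ltn_trans (size_npoly r) _; rewrite ltnS.
  apply: uniq_perm; first exact: monics_uniq.
    by rewrite map_inj_uniq ?monics_uniq //; apply: addIr.
  move=> f; rewrite mem_monics; apply/andP/mapP.
    case=> mf /eqP sf; exists (f - val r); last by rewrite subrK.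
    have sN : (size (- val r) < size f)%N by rewrite size_polyN sr.
    by rewrite mem_monics monicE lead_coefDl // size_polyDl // sf -monicE mf eqxx.
  case=> h; rewrite mem_monics => /andP[mh /eqP sh] ->.
  by rewrite monicE lead_coefDl ?sr // size_polyDl ?sr // sh -monicE mh eqxx.
have : #|{: {poly_4 F}}|%:R * monic_sum X n = 0.
  rewrite mulr_natl -sumr_const (eq_bigr _ (fun r _ => shift r)) exchange_big big1 //= => f _.
  rewrite -[RHS](sum_small_polys (map_poly iota f).[theta]); apply: eq_bigr => r _.
  by rewrite /X rmorphD hornerD.
move/eqP; rewrite mulf_eq0 pnatr_eq0 card_npoly expn_eq0 andbT => /orP[|/eqP //].
by rewrite gtn_eqF // ltnW ?finNzRing_gt1.
Qed.

(** A nonzero polynomial of degree at most 3 is a scalar times a monic one and [chi] ignores the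
    scalar, so [q - 1] times the left side is the sum of [chi] over [L]. This is the trivial zero of
    the L-function at [u = 1]. *)
Lemma monic_sum_low : 1 + monic_sum X 1 + monic_sum X 2 + monic_sum X 3 = 0.
Proof.
have XZ c f : c != 0 -> X (c *: f) = X f.
  move=> nz_c; rewrite /X map_polyZ /= hornerZ chiM.
  by rewrite chiF ?mul1r.
pose m4 := monics F 0 ++ monics F 1 ++ monics F 2 ++ monics F 3.
have mem_m4 f : (f \in m4) = (f \is monic) && (size f <= 4)%N.
  rewrite !mem_cat !mem_monics; case mf: (f \is monic) => //=.
  have : size f != 0%N by rewrite size_poly_eq0 monic_neq0.
  by move: (size f) => [|[|[|[|[|m]]]]].
have uniq_m4 : uniq m4.
  rewrite !cat_uniq !monics_uniq /= ?andbT.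
  apply/and3P; split; apply/hasPn => f f_in; apply/negP => f_in';
    have {f_in'} : f \in monics F _ := f_in'; move: f_in;
    rewrite ?mem_cat !mem_monics; case: (f \is monic) => //=;
    by move: (size f) => [|[|[|[|[|m]]]]].
pose U := [seq c <- enum F | c != 0].
have uniq_U : uniq U by rewrite filter_uniq ?enum_uniq.
have sumE : \sum_(r : {poly_4 F}) X (val r) = \sum_(f <- m4) \sum_(c <- U) X (c *: f).
  rewrite (bigD1 (0 : {poly_4 F})) //= {1}/X rmorph0 horner0 chi0 add0r.
  transitivity (\sum_(f <- [seq c *: f | f <- m4, c <- U]) X f); last exact: big_allpairs_dep.
  rewrite -(big_filter _ (fun r => r != 0)) -(big_map val xpredT X).
  apply: perm_big; apply: uniq_perm.
  - by rewrite map_inj_uniq ?filter_uniq ?index_enum_uniq //; apply: val_inj.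
  - apply: allpairs_uniq => // -[f c] [f' c'] /allpairsP[[f1 c1] /= [mf Uc [-> ->]]].
    case/allpairsP=> -[f2 c2] /= [mf' Uc' [-> ->]] /= Ecf.
    move: mf mf' Uc Uc'; rewrite !mem_m4 !mem_filter !monicE.
    case/andP=> /eqP lf _ /andP[/eqP lf' _] /andP[nz_c _] _.
    have Ec : c1 = c2 by have := congr1 lead_coef Ecf; rewrite !lead_coefZ lf lf' !mulr1.
    by move: Ecf; rewrite -Ec => /(scalerI nz_c)->.
  move=> f; apply/mapP/allpairsP.
    case=> r; rewrite mem_filter => /andP[nz_r _] ->.
    have nz_v : val r != 0 by [].
    have nz_lc : lead_coef (val r) != 0 by rewrite lead_coef_eq0.
    exists ((lead_coef (val r))^-1 *: val r, lead_coef (val r)) => /=.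
    rewrite mem_m4 mem_filter nz_lc mem_enum monicE lead_coefZ mulVf // eqxx.
    by rewrite size_scale ?invr_eq0 // size_npoly scalerA mulfV // scale1r.
  case=> -[h c] /= []; rewrite mem_m4 mem_filter => /andP[mh sh] /andP[nz_c _] ->.
  have sch : (size (c *: h) <= 4)%N by rewrite size_scale.
  exists (NPoly sch) => //; rewrite mem_filter mem_index_enum andbT.
  by rewrite -val_eqE /= scaler_eq0 negb_or nz_c monic_neq0.
have : \sum_(r : {poly_4 F}) X (val r) = 0.
  by rewrite -[RHS](sum_small_polys 0); apply: eq_bigr => r _; rewrite add0r.
rewrite {}sumE (eq_bigr (fun f => (size U)%:R * X f)) => [|f _]; last first.
  rewrite big_filter (eq_bigr (fun=> X f)); last by move=> c; apply: XZ.
  by rewrite -big_filter big_const_seq count_predT iter_addr_0 mulr_natl.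
have nz_U : (size U)%:R != 0 :> algC.
  rewrite pnatr_eq0; apply/eqP => /size0nil U0.
  by have := mem_filter (fun c : F => c != 0) 1 (enum F); rewrite -/U U0 oner_neq0 mem_enum.
rewrite -big_distrr /= => /eqP; rewrite mulf_eq0 (negPf nz_U) /= !big_cat /=.
by rewrite -/(monic_sum X 0) monic_sum0 ?eval1 // !addrA => /eqP.
Qed.

Lemma monic_sum1 : monic_sum X 1 = \sum_(t : F) chi (theta - iota t).
Proof.
have -> : monic_sum X 1 = \sum_(f <- [seq 'X - t%:P | t : F]) X f.
  apply: perm_big; apply: uniq_perm; first exact: monics_uniq.
    rewrite map_inj_uniq ?enum_uniq // => s t /(congr1 (fun f : {poly F} => - f.[0])).
    by rewrite !hornerE !opprK.
  move=> f; rewrite mem_monics; apply/andP/mapP; last first.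
    by case=> t _ ->; rewrite monicXsubC size_XsubC.
  case=> mf /eqP sf; exists (- f`_0); rewrite ?mem_enum //.
  apply/polyP => -[|[|i]]; rewrite !coefE //= ?subr0 ?opprK ?add0r //.
    by move: mf; rewrite monicE lead_coefE sf => /eqP.
  by rewrite nth_default ?sf.
rewrite big_map big_enum; apply: eq_bigr => t _.
by rewrite /X rmorphB /= map_polyX map_polyC !hornerE.
Qed.

Lemma chi_quotient x y : x != 0 -> y != 0 -> x ^+ q.-1 = y ^+ q.-1 -> chi x = chi y.
Proof.
move=> nz_x nz_y Exy; have nz_xy : x / y != 0 by rewrite mulf_neq0 ?invr_eq0.
have [c Dc] : exists c, iota c = x / y.
  apply: frobenius_fixed_image; rewrite -(prednK (ltnW q_gt1)) exprS.
  by rewrite expr_div_n Exy divff ?mulr1 // expf_neq0.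
have nz_c : c != 0 by apply: contraNneq nz_xy => c0; rewrite -Dc c0 rmorph0.
by rewrite -[x](divfK nz_y) chiM -Dc chiF ?mul1r.
Qed.

Let N := (1 + q + q ^ 2 + q ^ 3)%N.

Let ND : (q ^ 4 - 1 = q.-1 * N)%N.
Proof. by rewrite subn1 predn_exp !big_ord_recl big_ord0 /= expn0 expn1 addn0 !addnA. Qed.

(** By [chi_quotient], [chi] is a function of [y^(q - 1)], which ranges over the [N]-th roots of
    unity. [W] is this function carried into [k], where the residue symbol of Stepanov's bound takes
    its values. *)
Lemma chi_on_extension (k : finFieldType) (lambda : {rmorphism L -> k}) :
  exists W : k -> algC,
    [/\ forall y, y != 0 -> W (lambda (y ^+ q.-1)) = chi y,
        forall z, z ^+ N = 1 -> `|W z| <= 1 &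
        \sum_(z | z ^+ N == 1) W z = 0].
Proof.
pose W z := if [pick y : L | (y != 0) && (lambda (y ^+ q.-1) == z)] is Some y
            then chi y else 0.
have WE y : y != 0 -> W (lambda (y ^+ q.-1)) = chi y.
  rewrite /W => nz_y; case: pickP => [x /andP[nz_x /eqP/fmorph_inj Exy]|/(_ y)].
    exact: chi_quotient.
  by rewrite nz_y eqxx.
have pre z : z ^+ N = 1 -> exists2 y, y != 0 & lambda (y ^+ q.-1) = z.
  move=> zN; have [u Du] : exists u, lambda u = z.
    apply: frobenius_fixed_image; rewrite cardL.
    have -> : (q ^ 4 = (N * q.-1).+1)%N by rewrite mulnC -ND subn1 prednK ?expn_gt0 ?q_gt0.
    by rewrite exprS exprM zN expr1n mulr1.
  have nz_u : u != 0.
    apply: contra_eq_neq zN => u0; rewrite -Du u0 rmorph0 expr0n /N.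
    by rewrite addSn eq_sym oner_neq0.
  have [m Dm] := g_gen nz_u.
  have : ((q ^ 4).-1 %| m * N)%N.
    rewrite (prim_order_dvd g_prim) exprM -Dm; apply/eqP/(fmorph_inj lambda).
    by rewrite rmorphXn /= Du zN rmorph1.
  rewrite -subn1 ND dvdn_pmul2r // => /dvdnP[m' Dm'].
  by exists (g ^+ m'); rewrite ?expf_neq0 // -exprM -Dm' -Dm.
exists W; split=> // [z /pre[y nz_y <-]|].
  by rewrite WE // norm_chi.
pose z0 := lambda (g ^+ q.-1).
have z0N : z0 ^+ N = 1.
  rewrite /z0 -rmorphXn /= -exprM -ND subn1 (prim_expr_order g_prim); exact: rmorph1.
have nz_z0 : z0 != 0 by rewrite fmorph_eq0 expf_neq0.
set s := \sum_(z | _) _; have : s = chi g * s.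
  rewrite /s {1}(reindex_inj (mulfI nz_z0)) mulr_sumr; apply: eq_big => z.
    by rewrite exprMn z0N mul1r.
  rewrite exprMn z0N mul1r => /eqP/pre[y nz_y <-].
  by rewrite /z0 -rmorphM -exprMn !WE ?mulf_neq0 // chiM.
move/eqP; rewrite -subr_eq0 -{1}[X in X - _]mul1r -mulrBl mulf_eq0 subr_eq0.
by rewrite eq_sym (negPf chig) => /eqP.
Qed.

(* Over the field [k] of degree [4 * 2^j.+1], [chi] of the orbit polynomial of [t] at
   [theta] is a fixed power of [prod_(s < 4) (theta^(q^(4-s)) - t)^(q^s)], a polynomial
   in [t] of bounded degree to which Stepanov's bound applies. *)
Lemma mangoldt_sum_bound : exists C : nat, forall j,
  `|mangoldt_sum X (4 * 2 ^ j.+1)| <= (C * q ^ (4 * 2 ^ j))%:R.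
Proof.
(* [H] bounds the size of [h] below, whose factors have degrees [q], [q^2] and [q^3]. *)
pose H := (1 + q + q ^ 2 + q ^ 3)%N.
exists (N * ((H * N.+1 + 5) + H) + H.+1)%N => j.
have oddL : odd #|L| by rewrite cardL oddX oddF orbT.
have [k [lambda cardk]] := quadratic_tower j.+1 oddL.
have [W [WE W1 W0]] := chi_on_extension lambda.
set n := (4 * 2 ^ j.+1)%N; have n_gt0 : (0 < n)%N by rewrite muln_gt0 expn_gt0.
have cardkn : #|k| = (q ^ n)%N by rewrite cardk cardL -expnM.
pose mu : {rmorphism F -> k} := lambda \o iota.
have /fin_all_exists[orb orbE] t := frobenius_orbit_poly mu t cardkn.
rewrite (mangoldt_sum_field n_gt0 cardkn eval1 evalM orbE).
pose a := lambda theta.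
(* For [s = 0] the factor is [theta - t], because [theta^(q^4) = theta]. It becomes ['X - a%:P], its
   sign goes into [h], and [a] is no root of [h] since the conjugates of [theta] differ from
   [theta]. *)
pose h : {poly k} := - \prod_(s < 3) ((a ^+ (q ^ (3 - s)))%:P - 'X) ^+ (q ^ s.+1).
have nz_lin (c : k) : c%:P - 'X != 0 by rewrite -opprB oppr_eq0 polyXsubC_eq0.
have sz_lin (c : k) m : size ((c%:P - 'X) ^+ m) = m.+1.
  rewrite polySpred ?expf_neq0 // size_exp.
  by rewrite -opprB size_polyN size_XsubC mul1n.
have sh : (size h <= H)%N.
  rewrite size_polyN !big_ord_recl big_ord0 mulr1 /=.
  rewrite size_mul ?mulf_neq0 ?expf_neq0 // size_mul ?expf_neq0 //.
  by rewrite !sz_lin !addnS !addSn /= expn1 /H !addnA.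
have ha : h.[a] != 0.
  rewrite hornerN oppr_eq0 horner_prod; apply/prodf_neq0 => s _.
  rewrite horner_exp !hornerE expf_neq0 // subr_eq0 -rmorphXn /=.
  by rewrite (inj_eq (fmorph_inj lambda)) theta_frob //; case: s => [[|[|[|]]]].
set r := (q ^ (4 * 2 ^ j))%N.
have [p [u [pF Dq]]] := finField_card_pchar F.
have Dr : r = (p ^ (u * (4 * 2 ^ j)))%N by rewrite /r Dq -expnM.
have pk : p \in [pchar k] by rewrite (fmorph_pchar mu).
pose e := ((r - 1) %/ N)%N.
have r_gt1 : (1 < r)%N by rewrite -(exp1n (4 * 2 ^ j)) ltn_exp2r ?muln_gt0 ?expn_gt0.
have N_dvd : (N %| r - 1)%N.
  rewrite subn1 /r expnM; apply: dvdn_trans (dvdn_pred_predX _ _).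
  by rewrite -subn1 ND dvdn_mull.
have rNe : r = (N * e).+1.
  by rewrite /e mulnC divnK // subn1 prednK // ltnW.
have e_gt0 : (0 < e)%N.
  by move: r_gt1; rewrite [r in (1 < r)%N]rNe ltnS muln_gt0 => /andP[].
have cardkr : #|k| = (r ^ 2)%N by rewrite cardkn /r -expnM /n expnSr mulnA.
have N_gt1 : (1 < N)%N by do 2!apply: ltn_addr; rewrite add1n ltnS.
set f := ('X - a%:P) * h.
(* The exponents [l < n] are grouped as [l = 4 * i + s]: as [a^(q^4) = a], the factor for [l] is the
   [q^(4 * i)]-th power of the one for [s]. *)
pose M := (2 ^ j.+1)%N; pose E := (\sum_(i < M) (q ^ 4) ^ i)%N.
have aq i : a ^+ (q ^ (4 * i)) = a.
  elim: i => [|i IHi]; first by rewrite muln0 expr1.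
  by rewrite mulnS expnD exprM -cardL /a -rmorphXn /= expf_card.
have orb_f t : lambda (map_poly iota (orb t)).[theta] = f.[t] ^+ E.
  rewrite -horner_map -map_poly_comp -/mu orbE horner_prod.
  under eq_bigr => l _ do rewrite hornerXsubC.
  rewrite [LHS](big_mul4 (fun l => a - t ^+ (q ^ l)) M) -prodrXr; apply: eq_bigr => i _.
  rewrite big_ord_recl addn0 hornerM hornerXsubC hornerN mulrN -mulNr opprB.
  rewrite -expnM exprMn (frobenius_sub mu) aq; congr (_ * _).
  rewrite horner_prod -prodrXl; apply: eq_bigr => s _.
  rewrite horner_exp !hornerE -exprM -expnD (frobenius_sub mu) -exprM -expnD.
  have -> : (3 - s + (s.+1 + 4 * i) = 4 * i.+1)%N.
    by rewrite addnA addnS (subnK (ltnW (ltn_ord s))) mulnS.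
  rewrite aq; congr (a - t ^+ (q ^ _)%N); change (4 * i + 1 + s = s.+1 + 4 * i)%N.
  by rewrite addn1 addSnnS addnC.
(* Multiplied by [N], both sides become [r^2 - 1]. *)
have ED : (e * r.+1 = E * q.-1)%N.
  apply/eqP; rewrite -(eqn_pmul2l (ltnW N_gt1)); apply/eqP.
  have -> : (N * (E * q.-1) = (r ^ 2).-1)%N.
    by rewrite mulnCA [(N * _)%N]mulnC -ND subn1 mulnC -predn_exp -expnM -/n -cardkn cardkr.
  by rewrite mulnA rNe -mulnn; move: (N * e)%N => x; rewrite mulSn addSn /= -mulnS.
have E_gt0 : (0 < E)%N.
  have : (0 < e * r.+1)%N by rewrite muln_gt0 e_gt0.
  by rewrite ED muln_gt0 => /andP[].
have key t : chi (map_poly iota (orb t)).[theta] =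
    if f.[t] != 0 then W (f.[t] ^+ (e * r.+1)) else 0.
  have [ft | nz_ft] := eqVneq f.[t] 0.
    suff -> : (map_poly iota (orb t)).[theta] = 0 by [].
    by apply: (fmorph_inj lambda); rewrite orb_f ft rmorph0 expr0n gtn_eqF.
  rewrite ED exprM -orb_f -rmorphXn /= WE //.
  by rewrite -(fmorph_eq0 lambda) orb_f expf_neq0.
rewrite (eq_bigr _ (fun t _ => key t)) -big_mkcond.
have := @stepanov_char_sum k p (u * (4 * 2 ^ j)) N e h a W pk.
rewrite -Dr => /(_ cardkr N_gt1 e_gt0 rNe ha W1 W0) bd.
apply: le_trans bd _; rewrite ler_nat mulnDl leq_add //.
  by rewrite leq_mul2r leq_mul2l leq_add ?leq_add2r ?leq_mul2r ?sh ?orbT.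
apply: (@leq_trans H.+1); first by rewrite ltnS.
by rewrite leq_pmulr // ltnW.
Qed.

(** The sum is [-(x + y)]. The available degrees are [8 * 2^j], so the roots are bounded through
    their eighth powers, [|x^8| <= q^4]. *)
Lemma projective_line_char_sum :
  `|1 + \sum_(t : F) chi (theta - iota t)| <= 2 * sqrtC q%:R.
Proof.
rewrite -monic_sum1.
have [[x y] /= [-> Sxy]] := newton_power_sums (monic_sum0 eval1) monic_sum_vanish
  monic_sum_low (newton_identity eval1 evalM).
have [C bdC] := mangoldt_sum_bound.
have rq : (q%:R ^+ 4 : algC) = sqrtC q%:R ^+ 8.
  by rewrite -[8%N]/(2 * 4)%N exprM sqrtCK.
have s0 : 0 <= sqrtC (q%:R : algC) by rewrite sqrtC_ge0 ler0n.
have q0 : 0 < (q%:R ^+ 4 : algC) by rewrite exprn_gt0 // ltr0n.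
have [] := @root_pair_bound (x ^+ 8) (y ^+ 8) (q%:R ^+ 4) (C.+1)%:R q0.
  move=> j; have -> : x ^+ 8 ^+ (2 ^ j) + y ^+ 8 ^+ (2 ^ j)
      = - mangoldt_sum X (4 * 2 ^ j.+1) - 1.
    rewrite Sxy ?muln_gt0 ?expn_gt0 // expnS mulnA -!exprM; ring.
  apply: le_trans (ler_normB _ _) _; rewrite normrN normr1.
  rewrite -exprM -natrX -natr1 mulrDl mul1r -natrM lerD ?bdC //.
  by rewrite ler1n expn_gt0 q_gt0.
rewrite !normrX rq !ler_pXn2r ?nnegrE // => bx by_.
rewrite normrN (le_trans (ler_normD _ _)) // mulr_natl mulr2n lerD //.
Qed.

End CharacterSum.

(** * The sieve *)

Section Sieve.
Variables (T : finType) (e : T -> nat) (R : nat) (zeta B : algC).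
Hypothesis zeta_prim : R.-primitive_root zeta.
Hypothesis char_bound : forall b, ~~ (R %| b)%N -> `|\sum_p zeta ^+ (b * e p)| <= B.

(** [l] divides [R] exactly once: a shift by a multiple of [R / l] can then change residues modulo
    [l], but modulo no other prime divisor of [R]. *)
Definition sieve_prime l := [&& prime l, (l %| R)%N & ~~ (l %| R %/ l)%N].

(** The twist [b] is carried along because removing the multiples of a prime produces sums with
    shifted twists. *)
Definition sifted_sum (K : seq nat) b : algC :=
  \sum_(p | all (fun l => ~~ (l %| e p)%N) K) zeta ^+ (b * e p).

Definition density (K : seq nat) : algC := \prod_(l <- K) (1 - l%:R^-1).

Lemma density_gt0 K : all sieve_prime K -> 0 < density K.
Proof.
elim: K => [_|l K IHK /= /andP[/and3P[pl _ _] /IHK dK]].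
  by rewrite /density big_nil.
by rewrite /density big_cons mulr_gt0 // subr_gt0 invf_lt1 ?ltr1n ?ltr0n ?prime_gt0 ?prime_gt1.
Qed.

Lemma dvdn_indicator l m : sieve_prime l ->
  (l %| m)%N%:R = l%:R^-1 * \sum_(j < l) zeta ^+ (j * (R %/ l) * m) :> algC.
Proof.
case/and3P=> pl lR _; have l_gt0 := prime_gt0 pl.
have nz_l : l%:R != 0 :> algC by rewrite pnatr_eq0 -lt0n.
have z_prim : l.-primitive_root (zeta ^+ (R %/ l)).
  exact: dvdn_prim_root.
set z := zeta ^+ _ in z_prim.
have -> : \sum_(j < l) zeta ^+ (j * (R %/ l) * m) = \sum_(j < l) (z ^+ m) ^+ j.
  apply: eq_bigr => j _; rewrite /z -!exprM; congr (zeta ^+ _).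
  by rewrite [LHS]mulnAC [LHS]mulnC [(j * m)%N]mulnC mulnA.
have [lm | nlm] := boolP (l %| m)%N.
  have -> : z ^+ m = 1 by apply/eqP; rewrite -(prim_order_dvd z_prim).
  by rewrite (eq_bigr (fun=> 1)) ?sumr_const ?card_ord ?mulVf // => j _; rewrite expr1n.
suff -> : \sum_(j < l) z ^+ m ^+ j = 0 by rewrite mulr0.
apply/eqP; have : (z ^+ m - 1) * \sum_(j < l) z ^+ m ^+ j == 0.
  by rewrite -subrX1 exprAC (prim_expr_order z_prim) expr1n subrr.
by rewrite mulf_eq0 subr_eq0 -(prim_order_dvd z_prim) (negPf nlm).
Qed.

Lemma sifted_sum_dvd l K b : sieve_prime l ->
  \sum_(p | all (fun l => ~~ (l %| e p)%N) K) (l %| e p)%N%:R * zeta ^+ (b * e p)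
   = l%:R^-1 * \sum_(j < l) sifted_sum K (b + j * (R %/ l)).
Proof.
move=> sl; rewrite exchange_big mulr_sumr; apply: eq_bigr => p _.
rewrite dvdn_indicator // -mulrA mulr_suml; congr (_ * _); apply: eq_bigr => j _.
by rewrite mulnDl exprD mulrC.
Qed.

Lemma sifted_sum_cons l K b : sieve_prime l ->
  sifted_sum (l :: K) b = (1 - l%:R^-1) * sifted_sum K b
    - l%:R^-1 * \sum_(1 <= j < l) sifted_sum K (b + j * (R %/ l)).
Proof.
move=> sl; have /and3P[pl _ _] := sl.
have -> : sifted_sum (l :: K) b = sifted_sum K b
    - \sum_(p | all (fun l => ~~ (l %| e p)%N) K) (l %| e p)%N%:R * zeta ^+ (b * e p).
  rewrite /sifted_sum -sumrB [LHS]big_mkcond [RHS]big_mkcond; apply: eq_bigr => p _ /=.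
  by case: all; rewrite ?andbF // andbT; case: dvdn; rewrite ?mul1r ?subrr ?mul0r ?subr0.
rewrite sifted_sum_dvd // -(big_mkord xpredT (fun j => sifted_sum K (b + j * (R %/ l)))).
rewrite big_ltn ?prime_gt0 // mul0n addn0; ring.
Qed.

(** The prime [l0] guards the twist: it divides [R / l] for every [l] in [K], so each shifted twist
    stays nontrivial. Each prime multiplies the bound by [(1 - 1 / l) + (l - 1) / l = 2 (1 - 1 /
    l)]. *)
Lemma sifted_sum_bound K b l0 : uniq K -> all sieve_prime K ->
  l0 \notin K -> sieve_prime l0 -> ~~ (l0 %| b)%N ->
  `|sifted_sum K b| <= density K * 2 ^+ size K * B.
Proof.
elim: K b => [|l K IHK] b.
  move=> _ _ _ /and3P[_ lR _] lb; rewrite /density big_nil !mul1r.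
  by apply: char_bound; apply: contra lb; apply: dvdn_trans.
move=> /= /andP[lK uK] /andP[sl sK]; rewrite inE negb_or => /andP[neq_l l0K] sl0 l0b.
have /and3P[pl lR _] := sl; have /and3P[pl0 l0R _] := sl0.
have l1 : 1 <= l%:R :> algC by rewrite ler1n prime_gt0.
have l0' : 0 < l%:R :> algC by apply: lt_le_trans l1.
have linv : 0 <= l%:R^-1 :> algC by rewrite invr_ge0 ltW.
have D1 : 0 <= 1 - l%:R^-1 :> algC by rewrite subr_ge0 invf_le1.
have bd j : `|sifted_sum K (b + j * (R %/ l))| <= density K * 2 ^+ size K * B.
  apply: IHK => //; rewrite dvdn_addl //; apply: dvdn_mull.
  have : (l0 %| l * (R %/ l))%N by rewrite mulnC divnK.
  by rewrite Gauss_dvdr // prime_coprime // dvdn_prime2.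
rewrite sifted_sum_cons //; apply: le_trans (ler_normB _ _) _.
rewrite !normrM (ger0_norm D1) (ger0_norm linv).
apply: (@le_trans _ _ ((1 - l%:R^-1) * (density K * 2 ^+ size K * B)
    + l%:R^-1 * ((l.-1)%:R * (density K * 2 ^+ size K * B)))).
  apply: lerD; first by rewrite ler_wpM2l //; have := bd 0%N; rewrite mul0n addn0.
  rewrite ler_wpM2l //; apply: le_trans (ler_norm_sum _ _ _) _.
  rewrite -subn1 mulr_natl -sumr_const_nat; apply: ler_sum => j _; exact: bd.
rewrite /density big_cons exprS -subn1 natrB ?prime_gt0 //.
rewrite le_eqVlt; apply/orP; left; apply/eqP; field.
by rewrite gt_eqF.
Qed.

(** Only the trivial twist contributes a main term. The shifted sums in the recursion have twists
    prime to [l] and fall under the previous bound, and [(2^k - 1) + 2^k = 2^(k + 1) - 1]. *)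
Lemma sifted_sum0_bound K : uniq K -> all sieve_prime K ->
  `|sifted_sum K 0 - density K * #|T|%:R| <= density K * (2 ^+ size K - 1) * B.
Proof.
elim: K => [|l K IHK].
  rewrite /density big_nil expr0 subrr mulr0 mul0r mul1r /sifted_sum.
  by rewrite (eq_bigr (fun=> 1)) ?sumr_const ?subrr ?normr0 // => p _; rewrite mul0n.
move=> /= /andP[lK uK] /andP[sl sK]; have /and3P[pl lR lRl] := sl.
have l1 : 1 <= l%:R :> algC by rewrite ler1n prime_gt0.
have l0' : 0 < l%:R :> algC by apply: lt_le_trans l1.
have linv : 0 <= l%:R^-1 :> algC by rewrite invr_ge0 ltW.
have D1 : 0 <= 1 - l%:R^-1 :> algC by rewrite subr_ge0 invf_le1.
rewrite sifted_sum_cons // addrAC.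
apply: le_trans (ler_normB _ _) _.
have -> : (1 - l%:R^-1) * sifted_sum K 0 - density (l :: K) * #|T|%:R
    = (1 - l%:R^-1) * (sifted_sum K 0 - density K * #|T|%:R).
  by rewrite /density big_cons; ring.
rewrite !normrM (ger0_norm D1) (ger0_norm linv).
apply: (@le_trans _ _ ((1 - l%:R^-1) * (density K * (2 ^+ size K - 1) * B)
    + l%:R^-1 * ((l.-1)%:R * (density K * 2 ^+ size K * B)))).
  apply: lerD; first by rewrite ler_wpM2l // IHK.
  rewrite ler_wpM2l //; apply: le_trans (ler_norm_sum _ _ _) _.
  rewrite -subn1 mulr_natl -sumr_const_nat [X in X <= _]big_nat [X in _ <= X]big_nat.
  apply: ler_sum => j /andP[j_gt0 jl]; apply: (sifted_sum_bound (l0 := l)) => //.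
  by rewrite add0n Euclid_dvdM // negb_or lRl andbT gtnNdvd.
rewrite /density big_cons exprS -subn1 natrB ?prime_gt0 //.
rewrite le_eqVlt; apply/orP; left; apply/eqP; field.
by rewrite gt_eqF.
Qed.

(* [K] is sieved completely, by Legendre's formula; the primes of [S] are
   only subtracted one at a time. *)
Lemma sieve K S : uniq (K ++ S) -> all sieve_prime (K ++ S) ->
  let s := \sum_(l <- S) l%:R^-1 in
  ((size S)%:R - s) * 2 ^+ size K * B < (1 - s) * (#|T|%:R - (2 ^+ size K - 1) * B) ->
  s < 1 -> exists p, all (fun l => ~~ (l %| e p)%N) (K ++ S).
Proof.
rewrite cat_uniq all_cat => /and3P[uK disj uS] /andP[sK sS] s cond s1.
apply/existsP; apply: contraTT cond; rewrite negb_exists => /forallP noT.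
set D := density K * 2 ^+ size K * B.
have S0 : sifted_sum K 0 = (\sum_(p | all (fun l => ~~ (l %| e p)%N) K) 1)%N%:R.
  by rewrite natr_sum; apply: eq_bigr => p _; rewrite mul0n.
have dK := density_gt0 sK.
have T0 : 0 <= sifted_sum K 0 by rewrite S0 ler0n.
have k1 : 1 <= 2 ^+ size K :> algC by rewrite exprn_ege1 ?ler1n.
have lower : density K * (#|T|%:R - (2 ^+ size K - 1) * B) <= sifted_sum K 0.
  rewrite mulrBr mulrA lerBlDl -lerBlDr.
  apply: le_trans (sifted_sum0_bound uK sK).
  by rewrite distrC real_ler_norm // realB ?realM ?ger0_real // ltW.
pose c l := \sum_(p | all (fun l => ~~ (l %| e p)%N) K) (l %| e p)%N%:R : algC.
(* [c l] counts the points that [K] leaves and [l] removes: a fraction [1 / l] of those left, up to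
   sums whose nontrivial twist is guarded by [l] itself. *)
have c_bound l : l \in S -> c l <= l%:R^-1 * sifted_sum K 0 + (1 - l%:R^-1) * D.
  move=> lS; have sl := allP sS _ lS; have /and3P[pl lR lRl] := sl.
  have l1 : 1 <= l%:R :> algC by rewrite ler1n prime_gt0.
  have l0' : 0 < l%:R :> algC by apply: lt_le_trans l1.
  have linv : 0 <= l%:R^-1 :> algC by rewrite invr_ge0 ltW.
  have cE : c l - l%:R^-1 * sifted_sum K 0
      = l%:R^-1 * \sum_(1 <= j < l) sifted_sum K (j * (R %/ l)).
    have := sifted_sum_dvd K 0 sl.
    rewrite -(big_mkord xpredT (fun j => sifted_sum K (0 + j * (R %/ l)))).
    rewrite big_ltn ?prime_gt0 // mulrDr mul0n addn0.
    rewrite (eq_bigr (fun p => (l %| e p)%N%:R)) => [Ec|p _]; last by rewrite mul0n expr0 mulr1.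
    by rewrite /c Ec addrC addKr.
  rewrite -lerBlDl; apply: le_trans (_ : `|c l - l%:R^-1 * sifted_sum K 0| <= _).
    rewrite real_ler_norm // realB ?realM ?ger0_real ?invr_ge0 ?(ltW l0') //.
    by apply: sumr_ge0.
  rewrite cE normrM (ger0_norm linv).
  have -> : (1 - l%:R^-1) * D = l%:R^-1 * ((l.-1)%:R * D).
    by rewrite -subn1 natrB ?prime_gt0 //; field; rewrite gt_eqF.
  rewrite ler_wpM2l //; apply: le_trans (ler_norm_sum _ _ _) _.
  rewrite -subn1 mulr_natl -sumr_const_nat [X in X <= _]big_nat [X in _ <= X]big_nat.
  apply: ler_sum => j /andP[j_gt0 jl]; apply: (sifted_sum_bound (l0 := l)) => //.
    by apply/negP => lK; move/hasPn: disj => /(_ _ lS)/negP; apply.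
  by rewrite Euclid_dvdM // negb_or lRl andbT gtnNdvd.
(* If no point survived, each point left by [K] would be counted in some [c l]. *)
have upper : (1 - s) * sifted_sum K 0 <= ((size S)%:R - s) * D.
  rewrite mulrBl mul1r lerBlDl.
  apply: (@le_trans _ _ (\sum_(l <- S) c l)).
    rewrite /c exchange_big S0 natr_sum /=; apply: ler_sum => p Kp.
    have := noT p; rewrite all_cat Kp /= => /allPn[l lS].
    rewrite negbK => lp; rewrite (bigD1_seq l) //= lp lerDl.
    by apply: sumr_ge0.
  apply: (@le_trans _ _ (\sum_(l <- S) (l%:R^-1 * sifted_sum K 0 + (1 - l%:R^-1) * D))).
    by rewrite !big_seq; apply: ler_sum.
  rewrite big_split /= -!mulr_suml sumrB.
  by rewrite big_const_seq count_predT iter_addr_0.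
have := le_trans (ler_wpM2l _ lower) upper; rewrite subr_ge0 => /(_ (ltW s1)).
have -> : ((size S)%:R - s) * D = density K * (((size S)%:R - s) * 2 ^+ size K * B).
  by rewrite /D; ring.
rewrite mulrCA ler_pM2l // => le1; apply/negP => /lt_le_trans/(_ le1).
by rewrite ltxx.
Qed.
End Sieve.

(** Writing [s - x = (s - 1) + (1 - x)], the wanted inequality becomes [(s - 1) 2^k B < (1 - x) W]
    with [W = q + 1 + B - 2 * 2^k B]. It gets harder as [k], [s] and [x] grow, and [dn / dd] bounds
    [1 - x] from below. Squaring removes the square root in [B] and leaves a test in integers. *)
Lemma sieve_inequality (q k s k' s' dn dd : nat) (x : algC) :
  (k' <= k)%N -> (s' <= s)%N -> (0 < s)%N -> (0 < dn)%N -> (0 < dd)%N ->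
  (4 * q * (2 ^ k * (s.-1 * dd + 2 * dn) - dn) ^ 2 < q.+1 ^ 2 * dn ^ 2)%N ->
  0 <= x -> x * dd%:R + dn%:R <= dd%:R ->
  let B := 2 * sqrtC q%:R in
  (s'%:R - x) * 2 ^+ k' * B < (1 - x) * (q.+1%:R - (2 ^+ k' - 1) * B) /\ x < 1.
Proof.
move=> le_k le_s s_gt0 dn_gt0 dd_gt0 crit x0 xd B.
have B0 : 0 <= B by rewrite mulr_ge0 // sqrtC_ge0.
have BB : B ^+ 2 = (4 * q)%:R by rewrite exprMn sqrtCK natrM -natrX.
clearbody B.
have ddR : 0 < dd%:R :> algC by rewrite ltr0n.
have dnR : 0 < dn%:R :> algC by rewrite ltr0n.
set Y := (_ - dn)%N in crit.
have lin : B * Y%:R < q.+1%:R * dn%:R.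
  rewrite -(@ltr_pXn2r _ 2) ?nnegrE ?mulr_ge0 ?ler0n //.
  by rewrite !exprMn BB -!natrX -!natrM ltr_nat.
have YE : Y%:R = 2 ^+ k * (s.-1%:R * dd%:R + 2 * dn%:R) - dn%:R :> algC.
  rewrite /Y natrB; first by rewrite natrM natrX natrD !natrM.
  apply: (@leq_trans (2 * dn)); first by rewrite leq_pmull.
  apply: leq_trans (leq_addl (s.-1 * dd) _) _.
  by rewrite leq_pmull // expn_gt0.
pose W := q.+1%:R + B - 2 ^+ k * 2 * B.
have lin' : s.-1%:R * dd%:R * 2 ^+ k * B < dn%:R * W.
  rewrite -subr_gt0; move: lin; rewrite -subr_gt0 YE => lin.
  have -> : dn%:R * W - s.-1%:R * dd%:R * 2 ^+ k * B
    = q.+1%:R * dn%:R - B * (2 ^+ k * (s.-1%:R * dd%:R + 2 * dn%:R) - dn%:R).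
    by rewrite /W; ring.
  exact: lin.
have W0 : 0 < W.
  rewrite -(pmulr_rgt0 _ dnR); apply: le_lt_trans lin'.
  by rewrite !mulr_ge0 ?exprn_ge0.
have x1 : x < 1.
  rewrite -(@ltr_pM2r _ dd%:R) // mul1r; apply: lt_le_trans xd.
  by rewrite ltrDl.
split=> //.
have k1 : 2 ^+ k' <= 2 ^+ k :> algC by rewrite ler_weXn2l ?ler1n.
pose W' := q.+1%:R + B - 2 ^+ k' * 2 * B.
have WW' : W <= W'.
  by rewrite lerD2l lerN2 ler_wpM2r // ler_wpM2r.
have key : (s'%:R - 1) * 2 ^+ k' * B < (1 - x) * W'.
  apply: (@le_lt_trans _ _ (s.-1%:R * 2 ^+ k * B)).
    rewrite ler_wpM2r //; case: s' le_s => [_|s'' le_s].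
      apply: (@le_trans _ _ 0); last by rewrite mulr_ge0 ?exprn_ge0.
      by rewrite sub0r mulN1r oppr_le0 exprn_ge0.
    rewrite -natr1 addrK ler_pM ?exprn_ge0 //= ler_nat.
    by rewrite -ltnS prednK.
  apply: (@lt_le_trans _ _ ((1 - x) * W)); last by rewrite ler_wpM2l // subr_ge0 ltW.
  rewrite -(ltr_pM2l ddR).
  apply: (@le_lt_trans _ _ (s.-1%:R * dd%:R * 2 ^+ k * B)).
    by rewrite le_eqVlt; apply/orP; left; apply/eqP; ring.
  apply: lt_le_trans lin' _; rewrite mulrA ler_wpM2r ?(ltW W0) //.
  by rewrite mulrBr mulr1 lerBrDl mulrC.
rewrite -subr_gt0; move: key; rewrite -subr_gt0.
have -> : (1 - x) * W' - (s'%:R - 1) * 2 ^+ k' * B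
  = (1 - x) * (q.+1%:R - (2 ^+ k' - 1) * B) - (s'%:R - x) * 2 ^+ k' * B.
  by rewrite /W'; ring.
by [].
Qed.

Lemma prod_sieve_prime (s : seq nat) : uniq s -> all prime s ->
  all (sieve_prime (\prod_(l <- s) l)) s.
Proof.
move=> us /allP ps; apply/allP => l ls; rewrite /sieve_prime ps //.
rewrite (big_rem l ls) /= dvdn_mulr // mulKn ?prime_gt0 ?ps //.
rewrite Euclid_dvd_prod ?ps // big_has_cond; apply/hasPn => l' l's /=.
have := l's; rewrite (mem_rem_uniq _ us) inE => /andP[neq_l l's'].
by rewrite dvdn_prime2 ?ps // eq_sym.
Qed.

Lemma prod_primes_dvd (s : seq nat) m : uniq s -> all prime s ->
  all (fun l => l %| m)%N s -> (\prod_(l <- s) l %| m)%N.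
Proof.
elim: s => [|l s IHs] /=; first by rewrite big_nil dvd1n.
move=> /andP[ls us] /andP[pl ps] /andP[lm sm]; rewrite big_cons Gauss_dvd ?lm ?IHs //.
rewrite prime_coprime // Euclid_dvd_prod // big_has_cond; apply/hasPn => l' l's /=.
by rewrite dvdn_prime2 // ?(allP ps _ l's) //; apply: contra ls => /eqP->.
Qed.

Lemma sum_option (V : nmodType) (T : finType) (G : option T -> V) :
  \sum_p G p = G None + \sum_t G (Some t).
Proof.
rewrite (bigD1 None) //=; congr (_ + _).
rewrite (reindex_omap Some id) => [|[] //].
by apply: eq_bigl => t; rewrite eqxx.
Qed.

Lemma odd_mod4 q : (q %% 4 = 1)%N -> odd q.
Proof. by move=> q1; rewrite (divn_eq q 4) q1 oddD oddM andbF. Qed.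

Lemma geometric4_pred q : (q.-1 * (1 + q + q ^ 2 + q ^ 3) = (q ^ 4).-1)%N.
Proof. by rewrite predn_exp !big_ord_recl big_ord0 /= expn0 expn1 addn0 !addnA. Qed.

Lemma geometric4_factor q : (1 + q + q ^ 2 + q ^ 3 = q.+1 * (q ^ 2).+1)%N.
Proof. by rewrite !expnS expn0 !muln1; lia. Qed.

(** * The extension generated by a fourth root of a nonsquare *)

Section Binomial.
Variables (F L : finFieldType) (iota : {rmorphism F -> L}) (beta : L) (c : F).
Local Notation q := #|F|.
Hypothesis cardL : #|L| = (q ^ 4)%N.
Hypothesis q_mod4 : (q %% 4 = 1)%N.
Hypothesis beta4 : beta ^+ 4 = iota c.
Hypothesis c_nonsquare : c ^+ (q.-1 %/ 2) = -1.

Let N := (1 + q + q ^ 2 + q ^ 3)%N.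

Let q_gt1 : (1 < q)%N. Proof. exact: finNzRing_gt1. Qed.

Let q_gt0 : (0 < q)%N. Proof. exact: ltnW. Qed.

Let ND : (q.-1 * N = (q ^ 4).-1)%N. Proof. exact: geometric4_pred. Qed.

(** The multiplicative group of [L] is cyclic, so this says that [beta - t] is no [l]-th power, in a
    form that can be computed. *)
Definition odd_generator (t : F) :=
  forall l, prime l -> odd l -> (l %| N)%N -> (beta - iota t) ^+ ((q ^ 4).-1 %/ l) != 1.

Let one_neqN1 : (1 : L) != -1.
Proof. by rewrite -addr_eq0 two_neq0_of_odd // cardL oddX odd_mod4 ?orbT. Qed.

Let i4 := beta ^+ q.-1.

Lemma i4_sqr : i4 ^+ 2 = -1.
Proof.
rewrite /i4 -exprM.
have -> : (q.-1 * 2 = 4 * (q.-1 %/ 2))%N by move: (divn_eq q 4); rewrite q_mod4; lia.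
by rewrite exprM beta4 -rmorphXn /= c_nonsquare rmorphN1.
Qed.

Lemma beta_neq0 : beta != 0.
Proof.
apply/eqP => b0; have := i4_sqr; rewrite /i4 b0 -exprM expr0n.
case: eqP => [/eqP|_ /eqP]; last by rewrite eq_sym oppr_eq0 oner_eq0.
by rewrite muln_eq0 orbF; case: q q_gt1 => [|[]].
Qed.

(** [q = 1] modulo 4 makes the fourth root of unity [i4] fixed by Frobenius, so [beta] is an
    eigenvector with eigenvalue [i4]. *)
Lemma frob_beta m : beta ^+ (q ^ m) = i4 ^+ m * beta.
Proof.
elim: m => [|m IHm]; first by rewrite expr1 mul1r.
have i4q : i4 ^+ q = i4.
  rewrite (divn_eq q 4) q_mod4 addn1 exprS mulnC exprM -[4%N]/(2 * 2)%N exprM i4_sqr.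
  by rewrite sqrrN expr1n expr1n mulr1.
have bq : beta ^+ q = i4 * beta by rewrite -(prednK q_gt0) exprSr.
by rewrite expnSr exprM IHm exprMn -exprM mulnC exprM i4q bq mulrA -exprSr.
Qed.

Lemma frob_beta_neq m : (0 < m < 4)%N -> beta ^+ (q ^ m) != beta.
Proof.
move=> m4; rewrite frob_beta -subr_eq0 -{2}[beta]mul1r -mulrBl mulf_neq0 ?beta_neq0 //.
rewrite subr_eq0; case: m m4 => [|[|[|[|]]]] // _; apply/eqP => Ei.
- by have := i4_sqr; rewrite -[i4]expr1 Ei expr1n => /eqP; rewrite (negPf one_neqN1).
- by have := i4_sqr; rewrite Ei => /eqP; rewrite (negPf one_neqN1).
- have := i4_sqr; have : i4 = -1.
    by move: Ei; rewrite exprS i4_sqr mulrN1 => <-; rewrite opprK.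
  by move=> ->; rewrite sqrrN expr1n => /eqP; rewrite (negPf one_neqN1).
Qed.

(** The four conjugates [i4^m * beta] are distinct, too many roots for a nonzero polynomial of
    degree at most 3. *)
Lemma beta_free (f : {poly F}) : (size f <= 4)%N ->
  (map_poly iota f).[beta] = 0 -> f = 0.
Proof.
move=> sf fb; apply/eqP; rewrite -(map_poly_eq0 iota); apply: contraT => nz_f.
have := @max_poly_roots _ _ [seq beta ^+ (q ^ m) | m <- seq.iota 0 4] nz_f.
rewrite size_map size_iota size_map_poly ltnNge sf; apply.
  by apply/allP => x /mapP[m _ ->]; apply: root_frobenius; rewrite rootE fb.
rewrite map_inj_in_uniq ?iota_uniq // => m m'; rewrite !mem_iota !add0n /=.
have nz_i4 : i4 != 0 by rewrite expf_neq0 ?beta_neq0.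
wlog le_m : m m' / (m <= m')%N.
  by move=> IH m4 m'4 E; case/orP: (leq_total m m') => /IH; [|symmetry]; auto.
move=> _ m'4 E; apply/eqP; apply: contraT => neq_m; exfalso.
have /frob_beta_neq/eqP : (0 < m' - m < 4)%N.
  by rewrite subn_gt0 ltn_neqAle neq_m le_m (leq_ltn_trans (leq_subr _ _)).
apply; apply: (mulfI (expf_neq0 m nz_i4)).
by rewrite frob_beta mulrA -exprD subnKC // -!frob_beta E.
Qed.

(** [(q + 1) / 2] is odd and greater than 1. Such a prime excludes the point at infinity from the
    survivors of the sieve, and [t = 0] from the odd generators. *)
Lemma exists_odd_prime : exists l, [/\ prime l, odd l & (l %| N)%N].
Proof.
pose m := (q.+1)./2; have Dq := divn_eq q 4; rewrite q_mod4 in Dq.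
have Dm : m = (2 * (q %/ 4)).+1 by rewrite /m; lia.
have m_gt1 : (1 < m)%N by rewrite Dm; move: q_gt1; rewrite {1}Dq; case: (q %/ 4)%N.
have mN : (m %| N)%N.
  rewrite /N geometric4_factor dvdn_mulr //; apply/dvdnP; exists 2%N; lia.
exists (pdiv m); split; rewrite ?pdiv_prime ?(dvdn_trans (pdiv_dvd m)) //.
by apply: dvdn_odd (pdiv_dvd m) _; rewrite Dm /= oddM.
Qed.

Lemma beta_sub_neq0 t : beta - iota t != 0.
Proof.
rewrite subr_eq0; apply/eqP => Db.
have /eqP := @frob_beta_neq 1 isT; apply.
by rewrite expn1 Db -rmorphXn /= expf_card.
Qed.

(** [beta^(4 (q - 1)) = 1], and [4 (q - 1)] divides [(q^4 - 1) / l] for an odd prime [l] of [N], so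
    [beta] itself is an [l]-th power. *)
Lemma odd_generator_neq0 t : odd_generator t -> t != 0.
Proof.
have [l [pl odd_l lN]] := exists_odd_prime.
move=> /(_ l pl odd_l lN); apply: contraNneq => ->; rewrite rmorph0 subr0.
have b1 : beta ^+ (4 * q.-1) = 1.
  by rewrite mulnC exprM -/i4 -[4%N]/(2 * 2)%N exprM i4_sqr sqrrN expr1n.
have l_gt0 := prime_gt0 pl.
have : (4 * q.-1 %| (q ^ 4).-1 %/ l)%N.
  rewrite -ND [(4 * _)%N]mulnC -muln_divA // dvdn_pmul2l; last by rewrite -ltnS prednK.
  have N4 : (4 %| N)%N.
    rewrite /N geometric4_factor -[4%N]/(2 * 2)%N dvdn_mul // dvdn2 /= ?oddX ?odd_mod4 //.
  have : (4 %| l * (N %/ l))%N by rewrite mulnC divnK.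
  by rewrite Gauss_dvdr // (@coprime_pexpl 2 2) // coprime2n.
by case/dvdnP=> m ->; rewrite mulnC exprM b1 expr1n.
Qed.

(** The points sieved are the elements [t] of [F] and infinity, with values [beta - t] and 1; [e]
    gives the discrete logarithms of these values. As [R] divides [N] and the nonzero scalars are
    the powers of [g^N], the characters sending [g^m] to [zeta^(b * m)] are trivial on scalars, so
    the character sum bound applies to them. *)
Lemma sieve_criterion (K S : seq nat) (k s dn dd : nat) :
  uniq (K ++ S) ->
  (forall l, (l \in K ++ S) = [&& prime l, odd l & (l %| N)%N]) ->
  (size K <= k)%N -> (size S <= s)%N -> (0 < s)%N -> (0 < dn)%N -> (0 < dd)%N ->
  (\sum_(l <- S) (dd %/ l).+1 + dn <= dd)%N ->
  (4 * q * (2 ^ k * (s.-1 * dd + 2 * dn) - dn) ^ 2 < q.+1 ^ 2 * dn ^ 2)%N ->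
  exists t, odd_generator t.
Proof.
move=> uKS memKS le_k le_s s_gt0 dn_gt0 dd_gt0 sumS crit.
have pKS : all prime (K ++ S) by apply/allP => l; rewrite memKS => /and3P[].
have dKS : all (fun l => l %| N)%N (K ++ S) by apply/allP => l; rewrite memKS => /and3P[].
set R := (\prod_(l <- K ++ S) l)%N.
have RN : (R %| N)%N by apply: prod_primes_dvd.
have R_gt0 : (0 < R)%N by apply: dvdn_gt0 RN; rewrite /N geometric4_factor.
have Rn : (R %| (q ^ 4).-1)%N by rewrite -ND dvdn_mull.
have [g g_prim] := finField_primitive_root L.
have [nz_g g_log] := (primitive_root_neq0 g_prim, primitive_root_log g_prim).
rewrite cardL in g_prim; have n_gt0 := prim_order_gt0 g_prim.
pose pt (p : option F) := if p is Some t then beta - iota t else 1.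
have pt_neq0 p : pt p != 0 by case: p => [t|] /=; rewrite ?beta_sub_neq0 ?oner_neq0.
have /fin_all_exists[e ptE] p := g_log _ (pt_neq0 p).
have [zeta zeta_prim] := C_prim_root_exists R_gt0.
have zeta_n : zeta ^+ (q ^ 4).-1 = 1 by apply/eqP; rewrite -(prim_order_dvd zeta_prim).
pose lg y := if [pick i : 'I_(q ^ 4).-1 | y == g ^+ i] is Some i then (i : nat) else 0%N.
pose chi b y := if y == 0 then 0 else zeta ^+ (b * lg y).
have chiE b m : chi b (g ^+ m) = zeta ^+ (b * m).
  rewrite /chi expf_eq0 (negPf nz_g) andbF /lg.
  case: pickP => [i|/(_ (Ordinal (ltn_pmod m n_gt0)))].
    rewrite (eq_prim_root_expr g_prim) => /eqP Ei.
    rewrite ![(b * _)%N]mulnC !exprM -[in RHS](expr_mod _ zeta_n) Ei.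
    by rewrite (expr_mod _ zeta_n).
  by rewrite /= (expr_mod _ (prim_expr_order g_prim)) eqxx.
have char_bound b : ~~ (R %| b)%N ->
    `|\sum_p zeta ^+ (b * e p)| <= 2 * sqrtC q%:R.
  move=> Rb; have chi1 : chi b 1 = 1 by rewrite -[1 in LHS](expr0 g) chiE muln0.
  have -> : \sum_p zeta ^+ (b * e p) = 1 + \sum_t chi b (beta - iota t).
    rewrite sum_option -chi1 -chiE -ptE; congr (_ + _).
    by apply: eq_bigr => t _; rewrite -chiE -ptE.
  apply: (@projective_line_char_sum _ _ _ _ g) => //.
  - exact: beta_free.
  - exact: frob_beta_neq.
  - exact: odd_mod4.
  - by rewrite /chi eqxx.
  - move=> x y; have [-> | nz_x] := eqVneq x 0; first by rewrite mul0r /chi eqxx mul0r.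
    have [-> | nz_y] := eqVneq y 0; first by rewrite mulr0 /chi eqxx mulr0.
    have [[m ->] [m' ->]] := (g_log x nz_x, g_log y nz_y).
    by rewrite -exprD !chiE mulnDr exprD.
  - move=> a nz_a; have [|m Dm] := g_log (iota a); first by rewrite fmorph_eq0.
    have : (q.-1 * N %| q.-1 * m)%N.
      rewrite ND (prim_order_dvd g_prim) mulnC exprM -Dm -rmorphXn /=.
      by rewrite expf_pred_card // rmorph1.
    rewrite dvdn_pmul2l => [Nm|]; last by rewrite -ltnS prednK.
    rewrite Dm chiE; apply/eqP; rewrite -(prim_order_dvd zeta_prim).
    by rewrite dvdn_mull // (dvdn_trans RN).
  - by rewrite -[g]expr1 chiE muln1 -(prim_order_dvd zeta_prim).
have s_ge0 : 0 <= \sum_(l <- S) l%:R^-1 :> algC.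
  by rewrite sumr_ge0 // => l _; rewrite invr_ge0.
have s_le : (\sum_(l <- S) l%:R^-1) * dd%:R + dn%:R <= dd%:R :> algC.
  apply: (@le_trans _ _ (\sum_(l <- S) (dd %/ l).+1 + dn)%:R); last by rewrite ler_nat.
  rewrite natrD lerD2r natr_sum mulr_suml !big_seq; apply: ler_sum => l lS.
  have l_gt0 : (0 < l)%N by apply/prime_gt0/(allP pKS); rewrite mem_cat lS orbT.
  rewrite mulrC ler_pdivrMr ?ltr0n // -natrM ler_nat.
  by rewrite ltnW // ltn_ceil.
have [cond s1] := sieve_inequality le_k le_s s_gt0 dn_gt0 dd_gt0 crit s_ge0 s_le.
have [|p /allP ep] := sieve zeta_prim char_bound uKS (prod_sieve_prime uKS pKS) _ s1.
  by rewrite card_option.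
have [l0 [pl0 odd_l0 l0N]] := exists_odd_prime.
have lKS l : prime l -> odd l -> (l %| N)%N -> ~~ (l %| e p)%N.
  by move=> pl ol lN; apply: ep; rewrite memKS pl ol.
case: p ep lKS (ptE p) => [t|] _ lKS /= Dp.
  exists t => l pl ol lN; have ln : (l %| (q ^ 4).-1)%N by rewrite -ND dvdn_mull.
  rewrite Dp -exprM -(prim_order_dvd g_prim) -{1}(divnK ln) [(e _ * _)%N]mulnC.
  by rewrite dvdn_pmul2l ?lKS // divn_gt0 ?prime_gt0 // dvdn_leq.
(* The point at infinity has logarithm 0 modulo [q^4 - 1], so the prime [l0] removes it. *)
have /negP[] := lKS l0 pl0 odd_l0 l0N; apply: dvdn_trans (_ : (q ^ 4).-1 %| _)%N.
  by rewrite -ND dvdn_mull.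
by rewrite (prim_order_dvd g_prim) -Dp.
Qed.

End Binomial.

(** * Primitive and 2-normal elements *)

Lemma g_poly4E (L : fieldType) q (alpha : L) :
  g_poly q 4 alpha = alpha *: 'X^3 + alpha ^+ q *: 'X^2 + alpha ^+ (q ^ 2) *: 'X
    + (alpha ^+ (q ^ 3))%:P.
Proof.
by rewrite /g_poly !big_ord_recl big_ord0 addr0 /= expr1 expn1 alg_polyC !addrA.
Qed.

(** With [j] the product of the primes of [n] that do not divide [m], every prime of [n] divides
    exactly one of [m] and [j * N]. *)
Lemma coprime_shift m N n : (0 < n)%N -> coprime m N -> (N %| n)%N ->
  exists j, coprime (m + j * N) n.
Proof.
move=> n_gt0 mN Nn; exists (\prod_(p <- primes n | ~~ (p %| m)%N) p)%N.
set j := (\prod_(p <- _ | _) p)%N.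
have pj p : prime p -> (p %| j)%N = (p %| n)%N && ~~ (p %| m)%N.
  move=> pp; rewrite /j -big_filter Euclid_dvd_prod // big_has_cond /=.
  apply/hasP/andP => [[l] /=|[pn pm]].
    rewrite mem_filter mem_primes => /andP[lm /and3P[pl _ ln]].
    by rewrite dvdn_prime2 // => /eqP->.
  by exists p => //=; rewrite mem_filter pm mem_primes pp n_gt0.
rewrite /coprime -dvdn1; apply: contraT => g1.
have g_gt1 : (1 < gcdn (m + j * N) n)%N.
  by rewrite ltn_neqAle eq_sym -dvdn1 g1 gcdn_gt0 n_gt0 orbT.
have pp := pdiv_prime g_gt1; set p := pdiv _ in pp.
have := pdiv_dvd (gcdn (m + j * N) n); rewrite -/p dvdn_gcd => /andP[pmj pn].
have pN : ~~ ((p %| m) && (p %| N))%N.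
  rewrite -dvdn_gcd (eqP mN) dvdn1; by apply: contraTneq pp => ->.
have [pm | npm] := boolP (p %| m)%N.
  move: pmj pN; rewrite dvdn_addr // Euclid_dvdM // pj // pm pn /=.
  by move=> ->.
have : (p %| j * N)%N by rewrite dvdn_mulr // pj // pn npm.
by move/dvdn_addl => E; rewrite E (negPf npm) in pmj.
Qed.

Lemma primitive_elt_order (L : finFieldType) (alpha : L) d :
  primitive_elt alpha -> (0 < d)%N -> alpha ^+ d = 1 -> (#|L| <= d.+1)%N.
Proof.
move=> [nz_a gen] d_gt0 ad.
have : {subset enum L <= 0 :: [seq alpha ^+ i | i <- seq.iota 0 d]}.
  move=> y _; rewrite inE; case: eqVneq => //= /gen[k ->].
  apply/mapP; exists (k %% d)%N; first by rewrite mem_iota ltn_mod.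
  by rewrite (expr_mod _ ad).
move/(uniq_leq_size (enum_uniq _)); rewrite -cardE /= size_map size_iota.
by [].
Qed.

(** * Necessity of [q = 1] modulo 4 *)

Section TwoNormal.
Variables (F L : finFieldType) (iota : {rmorphism F -> L}) (alpha : L).
Local Notation q := #|F|.
Hypothesis cardL : #|L| = (q ^ 4)%N.
Hypothesis prim_a : primitive_elt alpha.
Hypothesis two_normal : k_normal q 4 2 alpha.

Let q_gt1 : (1 < q)%N. Proof. exact: finNzRing_gt1. Qed.

Let G := g_poly q 4 alpha.

Let D := gcdp ('X^4 - 1) G.

(** Otherwise [alpha^(2 (q^2 - 1)) = 1], an order too small for a generator. *)
Lemma frobenius_square_neq (e : L) : e ^+ 2 = 1 -> alpha ^+ (q ^ 2) != - e * alpha.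
Proof.
move=> e2; apply/eqP => aq; have [nz_a _] := prim_a.
have q2 : (0 < q ^ 2)%N by rewrite expn_gt0 ltnW.
have ad : alpha ^+ (2 * (q ^ 2 - 1)) = 1.
  rewrite mulnC exprM; have -> : alpha ^+ (q ^ 2 - 1) = - e.
    by apply: (mulIf nz_a); rewrite -exprSr subn1 prednK.
  by rewrite sqrrN.
have q2' : (2 ^ 2 <= q ^ 2)%N by rewrite leq_exp2r.
have := primitive_elt_order prim_a _ ad; rewrite cardL -[4%N]/(2 * 2)%N expnM.
rewrite muln_gt0 subn_gt0 => /(_ (leq_trans (isT : 1 < 2 ^ 2)%N q2')).
by move: q2'; move: (q ^ 2)%N => x; rewrite -mulnn => x3; apply/negP; rewrite -ltnNge; nia.
Qed.

(** The remainder of [G] modulo [X^2 - e] has [alpha^(q^2) + e * alpha] as coefficient of [X]. *)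
Lemma quadratic_not_dvd (e : L) : e ^+ 2 = 1 -> ~~ ('X^2 - e%:P %| G).
Proof.
move=> e2; apply: contra (frobenius_square_neq e2) => XG.
have sX : size ('X^2 - e%:P : {poly L}) = 3%N by rewrite size_XnsubC.
pose r := (alpha ^+ (q ^ 2) + e * alpha) *: 'X + (alpha ^+ (q ^ 3) + e * alpha ^+ q)%:P.
have Gr : G = (alpha *: 'X + (alpha ^+ q)%:P) * ('X^2 - e%:P) + r.
  by rewrite /G g_poly4E /r !polyCD !polyCM -!mul_polyC !polyCD !polyCM; ring.
have : 'X^2 - e%:P %| r by move: XG; rewrite Gr dvdp_addr // dvdp_mulIr.
have r2 : (size r <= 2)%N.
  apply: leq_trans (size_polyD _ _) _; rewrite geq_max.
  rewrite (leq_trans (size_scale_leq _ _)) ?size_polyX //=.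
  by rewrite (leq_trans (size_polyC_leq1 _)).
have [r0 _ | nz_r] := eqVneq r 0.
  have := congr1 (fun p : {poly L} => p`_1) r0; rewrite /r !coefE /= mulr1 addr0 => /eqP.
  by rewrite addr_eq0 mulNr.
by move/(dvdp_leq nz_r); rewrite sX leqNgt ltnS r2.
Qed.

Lemma size_D : size D = 3%N.
Proof.
move: two_normal; rewrite /k_normal -/G -/D; case: (size D) => //= n ->; by [].
Qed.

(** Frobenius shifts the coefficients of [G] cyclically, and modulo [X^4 - 1] a cyclic shift is
    multiplication by [X]; hence [G(x)^q = x^q * G(x^q)]. *)
Lemma root_frobenius_G x : x ^+ 4 = 1 -> root G x -> root G (x ^+ q).
Proof.
move=> x4; rewrite !rootE /G g_poly4E !hornerE => /eqP Gx.
have [phi phiE] := finite_frobenius iota.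
have nz_x : x != 0 by apply: contra_eq_neq x4 => ->; rewrite expr0n eq_sym oner_neq0.
have nz_y : x ^+ q != 0 by rewrite expf_neq0.
have y4 : (x ^+ q) ^+ 4 = 1 by rewrite exprAC x4 expr1n.
have aq : alpha ^+ q ^+ (q ^ 3) = alpha by rewrite -exprM -expnS -cardL expf_card.
have := congr1 phi Gx; rewrite rmorph0 !rmorphD !rmorphM !rmorphXn /= !phiE aq.
have a2 : alpha ^+ q ^+ q = alpha ^+ (q ^ 2) by rewrite -exprM mulnn.
have a3 : alpha ^+ q ^+ (q ^ 2) = alpha ^+ (q ^ 3) by rewrite -exprM -expnS.
rewrite a2 a3 => Ey.
apply/eqP/(mulfI nz_y); rewrite mulr0 -[RHS]Ey.
set y := x ^+ q in y4 *.
transitivity (alpha * y ^+ 4 + alpha ^+ q * y ^+ 3 + alpha ^+ (q ^ 2) * y ^+ 2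
   + alpha ^+ (q ^ 3) * y); first by ring.
by rewrite y4; ring.
Qed.

Lemma two_normal_mod4 : (q %% 4 = 1)%N.
Proof.
have D_dvd : D %| 'X^4 - 1 := dvdp_gcdl _ _.
have DG : D %| G := dvdp_gcdr _ _.
(* In characteristic 2, [X^4 - 1 = (X - 1)^4], whose only monic divisor of degree 2 is
   [(X - 1)^2 = X^2 - 1]. *)
have [odd_q | even_q] := boolP (odd q); last first.
  have two0 : 1 + 1 = 0 :> L.
    have [p [u [pK cardK]]] := finField_card_pchar L.
    have : ~~ odd (p ^ u) by rewrite -cardK cardL oddX (negPf even_q).
    rewrite oddX negb_or => /andP[_ p_even].
    have [p2 | p_odd] := even_prime (pcharf_prime pK); last by rewrite p_odd in p_even.
    by rewrite -[LHS]/(2%:R) -p2 (pcharf0 pK).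
  have two0P : 2%:R = 0 :> {poly L} by rewrite -polyC_natr -[2%:R]/(1 + 1 : L) two0.
  have sq : ('X - 1%:P) ^+ 2 = 'X^2 - 1%:P :> {poly L}.
    transitivity ('X^2 - 1%:P + 2%:R * (1 - 'X) : {poly L}); first by rewrite polyC1; ring.
    by rewrite two0P mul0r addr0.
  have X4 : 'X^4 - 1 = ('X - 1%:P) ^+ 4 :> {poly L}.
    have -> : ('X - 1%:P) ^+ 4 = (('X - 1%:P) ^+ 2) ^+ 2 :> {poly L} by rewrite -exprM.
    transitivity (('X^2 - 1%:P) ^+ 2 - 2%:R * (1 - 'X^2) : {poly L}).
      by rewrite polyC1; ring.
    by rewrite two0P mul0r subr0 sq.
  move: D_dvd; rewrite X4 => /dvdp_exp_XsubCP[k _ Dk].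
  have k2 : k = 2%N.
    have := eqp_size Dk; rewrite size_D polySpred ?expf_neq0 ?polyXsubC_eq0 //.
    by rewrite size_exp size_XsubC mul1n => -[].
  have /negP[] := quadratic_not_dvd (expr1n L 2).
  by rewrite -sq -k2 -(eqp_dvdl _ Dk).
have : (q %% 4 = 1 \/ q %% 4 = 3)%N by lia.
case=> // q3.
have [g g_prim] := finField_primitive_root L; rewrite cardL in g_prim.
have [i i2] : exists i : L, i ^+ 2 = -1.
  have q4 : (q ^ 4 = 4 * (q ^ 4 %/ 4) + 1)%N.
    have E1 : (q ^ 4 %% 4 = 1)%N by rewrite -modnXm q3.
    by rewrite {1}(divn_eq (q ^ 4) 4) E1 mulnC.
  set m := (q ^ 4 %/ 4)%N in q4; exists (g ^+ m).
  rewrite q4 addn1 /= in g_prim.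
  have m_gt0 : (0 < m)%N by have := prim_order_gt0 g_prim; rewrite muln_gt0.
  have /eqP : (g ^+ m ^+ 2 - 1) * (g ^+ m ^+ 2 + 1) = 0.
    rewrite -subr_sqr expr1n -!exprM -mulnA mulnC (prim_expr_order g_prim) subrr //.
  rewrite mulf_eq0 subr_eq0 addr_eq0 => /orP[|/eqP //].
  rewrite -exprM -(prim_order_dvd g_prim) => /dvdn_leq; rewrite muln_gt0 m_gt0.
  by move=> /(_ isT); rewrite mulnC leq_pmul2l.
have X4 : 'X^4 - 1 = ('X^2 - 1%:P) * ('X^2 - (-1)%:P) :> {poly L}.
  by rewrite polyCN polyC1; ring.
have X2 : 'X^2 - (-1)%:P = ('X - i%:P) * ('X - (- i)%:P) :> {poly L}.
  by rewrite -i2 !polyCN polyC_exp; ring.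
have i4 : i ^+ 4 = 1 by rewrite -[4%N]/(2 * 2)%N exprM i2 sqrrN expr1n.
have iq : i ^+ q = - i.
  rewrite (divn_eq q 4) q3 exprD mulnC exprM i4 expr1n mul1r exprS i2 mulrN1 //.
have iNi : i != - i.
  have nz_i : i != 0 by apply: contra_eq_neq i4 => ->; rewrite expr0n eq_sym oner_neq0.
  rewrite -addr_eq0 -mulr2n -mulr_natl mulf_neq0 //.
  by rewrite -[2%:R]/(1 + 1) two_neq0_of_odd // cardL oddX odd_q.
have Ni4 : (- i) ^+ 4 = 1 by rewrite exprNn -signr_odd mul1r.
have rootDG x : root D x -> root G x.
  by rewrite -!dvdp_XsubCl => /dvdp_trans; apply.
have swap x : x ^+ 4 = 1 -> root G x -> root D x.
  move=> x4 Gx; rewrite root_gcd Gx andbT.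
  by rewrite rootE !hornerE x4 subrr.
(* Since [i^q = -i], both [i] and [-i] are roots of [D] or neither is. In the first case [X^2 + 1]
   divides [D]; in the second [D] is prime to [X^2 + 1] and its degree makes it [X^2 - 1]. *)
have [Di | nDi] := boolP (root D i).
  have DNi : root D (- i).
    by apply: swap => //; rewrite -iq root_frobenius_G // rootDG.
  have XD : 'X^2 - (-1)%:P %| D.
    rewrite X2 Gauss_dvdp ?dvdp_XsubCl ?Di ?DNi //.
    by rewrite coprimep_XsubC2 // subr_eq0 eq_sym.
  have /negP[] := quadratic_not_dvd (etrans (sqrrN 1) (expr1n L 2)).
  exact: dvdp_trans XD DG.
have nDNi : ~~ root D (- i).
  apply: contra nDi => DNi; have Nq : (- i) ^+ q = i.
    by rewrite exprNn -signr_odd odd_q mulN1r iq opprK.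
  by apply: swap => //; rewrite -Nq root_frobenius_G // rootDG.
have cop : coprimep D ('X^2 - (-1)%:P).
  by rewrite X2 coprimepMr !coprimep_XsubC nDi.
have /negP[] := quadratic_not_dvd (expr1n L 2).
have D1 : D %| 'X^2 - 1%:P by move: D_dvd; rewrite X4 Gauss_dvdpl.
have DX : D %= 'X^2 - 1%:P.
  by rewrite -(dvdp_size_eqp D1) size_D size_XnsubC.
by rewrite -(eqp_dvdl _ DX).
Qed.

End TwoNormal.

(** * Sufficiency: assembling the element from eigenvectors *)

(** With [G w = (X^4 - 1) / (X - w)] and [W = (X^4 - 1) / ((X - u)(X - v))], the sum is
    [W * (B (X - u) + A (X - v))]. The last factor vanishes neither at [u] nor at [v], so the gcd is
    [W] up to a scalar, of degree 2. *)
Lemma size_gcd_eigen_sum (L : fieldType) (u v A B : L) :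
  u ^+ 4 = 1 -> v ^+ 4 = 1 -> u != v -> A != 0 -> B != 0 ->
  size (gcdp ('X^4 - 1) (\sum_(i < 4) (B * v ^+ i + A * u ^+ i) *: 'X^(3 - i))) = 3%N.
Proof.
move=> u4 v4 neq_uv nz_A nz_B.
pose G w : {poly L} := \sum_(i < 4) w ^+ i *: 'X^(3 - i).
have GE w : w ^+ 4 = 1 -> 'X^4 - 1 = ('X - w%:P) * G w.
  move=> w4; rewrite -[1 in LHS]polyC1 -w4 rmorphXn subrXX; congr (_ * _).
  apply: eq_bigr => i _; by rewrite -rmorphXn mulrC mul_polyC.
have neq_vu : v - u != 0 by rewrite subr_eq0 eq_sym.
have : 'X - u%:P %| G v.
  rewrite -(@Gauss_dvdpr _ _ ('X - v%:P)) ?coprimep_XsubC2 //.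
  by rewrite -(GE v v4) (GE u u4) dvdp_mulIl.
case/dvdpP=> W GvW.
have GuW : G u = ('X - v%:P) * W.
  apply: (@mulfI _ ('X - u%:P)); first by rewrite polyXsubC_eq0.
  by rewrite -(GE u u4) (GE v v4) GvW; ring.
have -> : \sum_(i < 4) (B * v ^+ i + A * u ^+ i) *: 'X^(3 - i) = B *: G v + A *: G u.
  rewrite /G !scaler_sumr -big_split; apply: eq_bigr => i _.
  by rewrite scalerDl -!scalerA.
have -> : B *: G v + A *: G u = W * (B *: ('X - u%:P) + A *: ('X - v%:P)).
  by rewrite GvW GuW -!mul_polyC; ring.
have -> : 'X^4 - 1 = W * (('X - u%:P) * ('X - v%:P)) by rewrite (GE v v4) GvW; ring.
have nz_W : W != 0.
  apply/eqP => W0; have : size ('X^4 - 1%:P : {poly L}) = 5%N by rewrite size_XnsubC.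
  by rewrite polyC1 (GE v v4) GvW W0 mul0r mulr0 size_poly0.
rewrite (eqp_size (gcdp_mul2l _ _ _)).
set l := _ *: _ + _.
have cop : coprimep (('X - u%:P) * ('X - v%:P)) l.
  rewrite coprimepMl ![coprimep _ l]coprimep_sym !coprimep_XsubC !rootE /l !hornerE.
  by rewrite !subrr !mulr0 add0r addr0 !mulf_neq0 // subr_eq0.
move: cop; rewrite /coprimep => /size_poly1P[c nz_c ->].
rewrite mulrC mul_polyC size_scale //.
have : size ('X^4 - 1%:P : {poly L}) = 5%N by rewrite size_XnsubC.
rewrite polyC1 (GE v v4) GvW size_monicM ?monicXsubC ?mulf_neq0 ?polyXsubC_eq0 //.
rewrite size_Mmonic ?monicXsubC // !size_XsubC.
by move: (size W) => n; lia.
Qed.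

Section TwoNormalConstruction.
Variables (F L : finFieldType) (iota : {rmorphism F -> L}) (beta : L) (c : F).
Local Notation q := #|F|.
Hypothesis cardL : #|L| = (q ^ 4)%N.
Hypothesis q_mod4 : (q %% 4 = 1)%N.
Hypothesis beta4 : beta ^+ 4 = iota c.
Hypothesis c_nonsquare : c ^+ (q.-1 %/ 2) = -1.

Let N := (1 + q + q ^ 2 + q ^ 3)%N.

Let q_gt1 : (1 < q)%N. Proof. exact: finNzRing_gt1. Qed.

Let q_gt0 : (0 < q)%N. Proof. exact: ltnW. Qed.

Let i4 := beta ^+ q.-1.

Lemma two_normal_of_eigenvectors (a t : F) s : a != 0 -> t != 0 ->
  k_normal q 4 2 (iota a * beta ^+ s * (beta - iota t)).
Proof.
move=> nz_a nz_t.
have i4_2 : i4 ^+ 2 = -1 by apply: i4_sqr beta4 c_nonsquare.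
have nz_b : beta != 0 by apply: beta_neq0 beta4 c_nonsquare.
have i4_4 : i4 ^+ 4 = 1 by rewrite -[4%N]/(2 * 2)%N exprM i4_2 sqrrN expr1n.
(* [B] and [A] are the two terms of the expanded product, with Frobenius eigenvalues [i4^(s + 1)]
   and [i4^s]. *)
pose A := - iota a * iota t * beta ^+ s; pose B := iota a * beta ^+ s.+1.
have nz_A : A != 0 by rewrite !mulf_neq0 ?oppr_eq0 ?fmorph_eq0 ?expf_neq0.
have nz_B : B != 0 by rewrite !mulf_neq0 ?fmorph_eq0 ?expf_neq0.
have u4 : (i4 ^+ s) ^+ 4 = 1 by rewrite exprAC i4_4 expr1n.
have v4 : (i4 ^+ s.+1) ^+ 4 = 1 by rewrite exprAC i4_4 expr1n.
have neq_uv : i4 ^+ s != i4 ^+ s.+1.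
  rewrite exprS -subr_eq0 -{1}[i4 ^+ s]mul1r -mulrBl mulf_neq0 ?expf_neq0 ?expf_neq0 //.
  rewrite subr_eq0 eq_sym; apply/eqP => i1.
  have := frob_beta_neq cardL q_mod4 beta4 c_nonsquare (isT : 0 < 1 < 4)%N.
  by rewrite (frob_beta cardL q_mod4 beta4 c_nonsquare) -/i4 i1 expr1n mul1r eqxx.
rewrite /k_normal /g_poly.
suff -> : \sum_(i < 4) (iota a * beta ^+ s * (beta - iota t)) ^+ (q ^ i) *: 'X^(3 - i)
    = \sum_(i < 4) (B * (i4 ^+ s.+1) ^+ i + A * (i4 ^+ s) ^+ i) *: 'X^(3 - i) :> {poly L}.
  by rewrite size_gcd_eigen_sum.
apply: eq_bigr => i _; congr (_ *: _).
have fixF (x : F) : iota x ^+ (q ^ i) = iota x.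
  elim: (i : nat) => [|m IHm]; first by rewrite expr1.
  by rewrite expnSr exprM IHm -rmorphXn /= expf_card.
have -> : (iota a * beta ^+ s * (beta - iota t)) ^+ (q ^ i)
    = iota a * (beta ^+ (q ^ i)) ^+ s * (beta ^+ (q ^ i) - iota t).
  by rewrite !exprMn fixF exprAC (frobenius_sub iota) fixF.
rewrite (frob_beta cardL q_mod4 beta4 c_nonsquare) -/i4 /A /B exprS.
by rewrite ![(i4 ^+ _) ^+ i]exprAC !exprMn [in RHS]exprS; ring.
Qed.

(** Write [N = 4 * M] with [M] odd. As [beta^(4 (q - 1)) = 1] and [beta^(2 (q - 1)) = -1], the
    logarithm of [beta] is an odd multiple of [M]: a factor [beta] flips the parity of the logarithm
    of [beta - t] and keeps its residues modulo the odd primes of [N]. The logarithms of nonzero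
    scalars are the multiples of [N], so [coprime_shift] settles the remaining primes of
    [q^4 - 1]. *)
Lemma odd_generator_two_normal t : odd_generator iota beta t ->
  exists alpha : L, primitive_elt alpha /\ k_normal q 4 2 alpha.
Proof.
move=> gen_t.
have nz_t := odd_generator_neq0 cardL q_mod4 beta4 c_nonsquare gen_t.
have i4_2 : i4 ^+ 2 = -1 by apply: i4_sqr beta4 c_nonsquare.
have nz_b : beta != 0 by apply: beta_neq0 beta4 c_nonsquare.
have ND : (q.-1 * N = (q ^ 4).-1)%N := geometric4_pred q.
have [g g_prim] := finField_primitive_root L.
have [nz_g g_log] := (primitive_root_neq0 g_prim, primitive_root_log g_prim).
rewrite cardL in g_prim; have n_gt0 := prim_order_gt0 g_prim.
have [kb Db] := g_log _ nz_b.
have [m Dm] := g_log _ (beta_sub_neq0 cardL q_mod4 beta4 c_nonsquare t).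
have q1_gt0 : (0 < q.-1)%N by rewrite -ltnS prednK.
have [M [DN oddM']] : exists M, N = (4 * M)%N /\ odd M.
  have Dq := divn_eq q 4; rewrite q_mod4 in Dq.
  exists ((2 * (q %/ 4)).+1 * (8 * (q %/ 4) ^ 2 + 4 * (q %/ 4)).+1)%N; split.
    rewrite /N; move: Dq; move: (q %/ 4)%N => x ->.
    by rewrite !expnS expn0 !muln1; lia.
  by rewrite oddM /= oddD !oddM.
have kb4 : (M %| kb)%N.
  have : (q.-1 * N %| q.-1 * (4 * kb))%N.
    rewrite ND (prim_order_dvd g_prim) mulnA mulnC exprM -Db exprM -/i4.
    by rewrite -[4%N]/(2 * 2)%N exprM i4_2 sqrrN expr1n.
  by rewrite dvdn_pmul2l // DN dvdn_pmul2l.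
have odd_kb : odd kb.
  apply: contraT => even_kb; exfalso.
  have : (q.-1 * N %| q.-1 * (2 * kb))%N.
    rewrite dvdn_pmul2l // DN -[4%N]/(2 * 2)%N -mulnA dvdn_pmul2l //.
    by rewrite Gauss_dvd ?coprime2n // kb4 dvdn2 even_kb.
  rewrite ND (prim_order_dvd g_prim) mulnA mulnC exprM -Db exprM -/i4 i4_2.
  by rewrite eq_sym -addr_eq0 (negPf (two_neq0_of_odd _)) // cardL oddX (odd_mod4 q_mod4) orbT.
pose s := ~~ odd m : nat.
have co : coprime (m + s * kb) N.
  have odd_m : odd (m + s * kb) by rewrite oddD oddM odd_kb andbT /s oddb addbN addbb.
  have l_m l : prime l -> odd l -> (l %| N)%N -> ~~ (l %| m + s * kb)%N.
    move=> pl ol lN; have lM : (l %| M)%N.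
      move: lN; rewrite DN Gauss_dvdr // -[4%N]/(2 ^ 2)%N coprimeXr // coprimen2 //.
    rewrite (dvdn_addl _ (dvdn_mull s (dvdn_trans lM kb4))).
    have ln : (l %| (q ^ 4).-1)%N by rewrite -ND dvdn_mull.
    have := gen_t l pl ol lN; rewrite Dm -exprM -(prim_order_dvd g_prim) -{1}(divnK ln).
    by rewrite [(m * _)%N]mulnC dvdn_pmul2l // divn_gt0 ?prime_gt0 // dvdn_leq.
  have [//|g_neq1] := boolP (coprime (m + s * kb) N).
  rewrite /coprime in g_neq1.
  have g_gt1 : (1 < gcdn (m + s * kb) N)%N.
    by rewrite ltn_neqAle eq_sym g_neq1 gcdn_gt0 orbC.
  have pr := pdiv_prime g_gt1; have := pdiv_dvd (gcdn (m + s * kb) N).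
  rewrite dvdn_gcd => /andP[lm lN]; have ol := dvdn_odd lm odd_m.
  by have := l_m _ pr ol lN; rewrite lm.
have [j co_j] : exists j, coprime (m + s * kb + j * N) (q ^ 4).-1.
  by apply: coprime_shift; rewrite // -ND dvdn_mull.
have [a Da] : exists a, iota a = g ^+ (j * N).
  have z1 : g ^+ (j * N) ^+ q.-1 = 1.
    by rewrite -exprM -mulnA [(N * _)%N]mulnC ND mulnC exprM (prim_expr_order g_prim) expr1n.
  apply: frobenius_fixed_image.
  by rewrite -[X in _ ^+ X = _](prednK q_gt0) exprS z1 mulr1.
have nz_a : a != 0 by rewrite -(fmorph_eq0 iota) Da expf_neq0.
exists (iota a * beta ^+ s * (beta - iota t)); split; last exact: two_normal_of_eigenvectors.
apply: primitive_root_primitive_elt.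
rewrite Da Dm Db -exprM -!exprD cardL (prim_root_exp_coprime _ g_prim).
by rewrite -addnA addnC [(kb * s + m)%N]addnC [(kb * s)%N]mulnC.
Qed.

End TwoNormalConstruction.

(** * Explicit finite field arithmetic *)

Lemma to_nat_add a b : N.to_nat (a + b)%num = (N.to_nat a + N.to_nat b)%N.
Proof. exact: N2Nat.inj_add. Qed.

Lemma to_nat_mul a b : N.to_nat (a * b)%num = (N.to_nat a * N.to_nat b)%N.
Proof. exact: N2Nat.inj_mul. Qed.

Lemma to_nat_sub a b : N.to_nat (a - b)%num = (N.to_nat a - N.to_nat b)%N.
Proof. lia. Qed.

Lemma to_nat_pred a : N.to_nat (a - 1)%num = (N.to_nat a).-1.
Proof. lia. Qed.

Lemma to_nat_eqb a b : N.eqb a b = (N.to_nat a == N.to_nat b).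
Proof. by apply/idP/eqP; lia. Qed.

Lemma to_nat_ltb a b : N.ltb a b = (N.to_nat a < N.to_nat b)%N.
Proof. by apply/idP/idP; lia. Qed.

Lemma to_nat_divmod a b : N.to_nat (N.div a b) = (N.to_nat a %/ N.to_nat b)%N
  /\ N.to_nat (N.modulo a b) = (N.to_nat a %% N.to_nat b)%N.
Proof.
have [-> | nz_b] := N.eq_dec b 0%num; first by rewrite divn0 modn0; case: a.
have Da : N.to_nat a = (N.to_nat (N.div a b) * N.to_nat b + N.to_nat (N.modulo a b))%N.
  by have := N.div_mod' a b; nia.
have lt_m : (N.to_nat (N.modulo a b) < N.to_nat b)%N by have := N.mod_lt a b nz_b; lia.
by rewrite Da modnMDl modn_small // divnMDl ?divn_small ?addn0 //; case: (N.to_nat b) lt_m.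
Qed.

Lemma to_nat_div a b : N.to_nat (N.div a b) = (N.to_nat a %/ N.to_nat b)%N.
Proof. by case: (to_nat_divmod a b). Qed.

Lemma to_nat_mod a b : N.to_nat (N.modulo a b) = (N.to_nat a %% N.to_nat b)%N.
Proof. by case: (to_nat_divmod a b). Qed.

Lemma N_mod0_dvdn a b : N.eqb (N.modulo a b) 0%num -> (N.to_nat b %| N.to_nat a)%N.
Proof. by rewrite to_nat_eqb to_nat_mod. Qed.

Record arith (C : Type) := Arith { azero : C; aadd : C -> C -> C; amul : C -> C -> C }.

(** [ev] is only asked to be a homomorphism on well-formed data: computed equalities transfer to [R]
    without any algebraic law for the data themselves. *)
Definition arith_sound (C : Type) (o : arith C) (R : comNzRingType) (ev : C -> R)
    (wf : C -> bool) :=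
  [/\ ev (azero o) = 0, wf (azero o),
      forall x y, wf x -> wf y -> ev (aadd o x y) = ev x + ev y /\ wf (aadd o x y) &
      forall x y, wf x -> wf y -> ev (amul o x y) = ev x * ev y /\ wf (amul o x y)].

(* [ext_arith o red] computes in [C[X]/(X^d - red)] with [d = size red];
   elements are lists of exactly [d] coefficients, constant term first. *)
Section Extension.
Variables (C : Type) (o : arith C) (red : seq C).

Definition ext_add (a b : seq C) := [seq aadd o xy.1 xy.2 | xy <- zip a b].

Definition ext_scale (x : C) (a : seq C) := [seq amul o x y | y <- a].

Definition ext_shift (a : seq C) :=
  ext_add (azero o :: take (size a).-1 a) (ext_scale (last (azero o) a) red).

Definition ext_mul (a b : seq C) :=
  foldr (fun x acc => ext_add (ext_scale x b) (ext_shift acc))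
    (nseq (size red) (azero o)) a.

Definition ext_arith := Arith (nseq (size red) (azero o)) ext_add ext_mul.

Variables (R : comNzRingType) (ev : C -> R) (wf : C -> bool) (x : R).
Hypothesis ev_sound : arith_sound o ev wf.

Definition ext_ev (a : seq C) : R := foldr (fun c acc => ev c + x * acc) 0 a.

Definition ext_wf (a : seq C) := (size a == size red) && all wf a.

Hypothesis wf_red : all wf red.
Hypothesis red_gt0 : (0 < size red)%N.
Hypothesis x_root : x ^+ size red = ext_ev red.

Lemma ext_ev_zero d : ext_ev (nseq d (azero o)) = 0.
Proof.
have [ev0 _ _ _] := ev_sound.
by elim: d => //= d ->; rewrite ev0 mulr0 addr0.
Qed.

Lemma ext_addP a b : size a = size b -> all wf a -> all wf b ->
  [/\ ext_ev (ext_add a b) = ext_ev a + ext_ev b, all wf (ext_add a b)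
    & size (ext_add a b) = size a].
Proof.
have [_ _ evD _] := ev_sound; rewrite /ext_add.
elim: a b => [|c a IHa] [|c' b] //= => [_ _ _|[sab] /andP[wc wa] /andP[wc' wb]].
  by rewrite addr0.
have [-> -> ->] := IHa b sab wa wb; have [-> ->] := evD c c' wc wc'.
by split=> //; ring.
Qed.

Lemma ext_scaleP c a : wf c -> all wf a ->
  [/\ ext_ev (ext_scale c a) = ev c * ext_ev a, all wf (ext_scale c a)
    & size (ext_scale c a) = size a].
Proof.
have [_ _ _ evM] := ev_sound; rewrite /ext_scale => wc.
elim: a => [|c' a IHa] //= => [_|/andP[wc' wa]]; first by rewrite mulr0.
have [-> -> ->] := IHa wa; have [-> ->] := evM c c' wc wc'.
by split=> //; ring.
Qed.

Lemma ext_ev_rcons a c : ext_ev (rcons a c) = ext_ev a + ev c * x ^+ size a.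
Proof.
elim: a => [|c' a IHa] /=; first by rewrite expr0; ring.
by rewrite IHa exprS; ring.
Qed.

Lemma ext_shiftP a : ext_wf a -> ext_ev (ext_shift a) = x * ext_ev a /\ ext_wf (ext_shift a).
Proof.
have [ev0 wf0 _ _] := ev_sound; case/andP=> /eqP sa wa.
case/lastP: a sa wa => [s0|a c]; first by have := red_gt0; rewrite -s0.
rewrite size_rcons all_rcons => sa /andP[wc wa].
rewrite /ext_shift size_rcons last_rcons -cats1 take_size_cat //=.
have [E1 W1 S1] := ext_scaleP wc wf_red.
have [|||E2 W2 S2] := @ext_addP (azero o :: a) (ext_scale c red).
- by rewrite S1 -sa.
- by rewrite /= wf0.
- exact: W1.
split; last by rewrite /ext_wf S2 W2 -sa eqxx.
by rewrite E2 //= E1 ev0 -x_root -sa cats1 ext_ev_rcons exprS; ring.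
Qed.

Lemma ext_mulP a b : all wf a -> ext_wf b ->
  ext_ev (ext_mul a b) = ext_ev a * ext_ev b /\ ext_wf (ext_mul a b).
Proof.
have [ev0 wf0 _ _] := ev_sound; move=> wa wb; have /andP[/eqP sb wb'] := wb.
rewrite /ext_mul; elim: a wa => [_|c a IHa /= /andP[wc wa]].
  by rewrite /= mul0r ext_ev_zero /ext_wf size_nseq eqxx all_nseq wf0 orbT.
have [E1 /ext_shiftP[E2 /andP[/eqP S2 W2]]] := IHa wa.
have [E3 W3 S3] := ext_scaleP wc wb'.
have [|E4 W4 S4] := @ext_addP (ext_scale c b) _ _ W3 W2; first by rewrite S3 S2.
split; first by rewrite E4 E3 E2 E1; ring.
by rewrite /ext_wf W4 S4 S3 sb eqxx.
Qed.

Lemma ext_sound : arith_sound ext_arith ext_ev ext_wf.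
Proof.
have [ev0 wf0 _ _] := ev_sound; split=> /=.
- exact: ext_ev_zero.
- by rewrite /ext_wf size_nseq eqxx all_nseq wf0 orbT.
- move=> a b /andP[/eqP sa wa] /andP[/eqP sb wb].
  have [|E W S] := @ext_addP a b _ wa wb; first by rewrite sa sb.
  by rewrite /ext_wf E W S sa eqxx.
- by move=> a b /andP[_ wa] wb; apply: ext_mulP.
Qed.

End Extension.

Fixpoint pow_pos (C : Type) (o : arith C) (a : C) (e : positive) : C :=
  match e with
  | xH => a
  | xO e' => let b := pow_pos o a e' in amul o b b
  | xI e' => let b := pow_pos o a e' in amul o a (amul o b b)
  end.

Lemma pow_posP (C : Type) (o : arith C) (R : comNzRingType) (ev : C -> R) wf a e :
  arith_sound o ev wf -> wf a ->
  ev (pow_pos o a e) = ev a ^+ Pos.to_nat e /\ wf (pow_pos o a e).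
Proof.
move=> [_ _ _ evM] wa; elim: e => [e [IHe W]|e [IHe W]|] /=.
- have [E1 W1] := evM _ _ W W; have [E2 W2] := evM _ _ wa W1.
  split=> //; rewrite E2 E1 IHe -exprD -exprS; congr (_ ^+ _); lia.
- have [E1 W1] := evM _ _ W W; split=> //.
  rewrite E1 IHe -exprD; congr (_ ^+ _); lia.
- by split=> //; rewrite expr1.
Qed.

Definition mod_arith (p : N) : arith N :=
  Arith 0%num (fun a b => N.modulo (N.add a b) p) (fun a b => N.modulo (N.mul a b) p).

Lemma mod_sound (p : N) (R : comNzRingType) : (0 < N.to_nat p)%N -> (N.to_nat p)%:R = 0 :> R ->
  arith_sound (mod_arith p) (fun a => (N.to_nat a)%:R : R) predT.
Proof.
move=> p_gt0 p0.
have modE a : (N.to_nat (N.modulo a p))%:R = (N.to_nat a)%:R :> R.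
  by rewrite to_nat_mod [in RHS](divn_eq (N.to_nat a) (N.to_nat p)) natrD natrM p0 mulr0 add0r.
split=> //= a b _ _; split=> //; rewrite modE.
  by rewrite -natrD; congr (_%:R); lia.
by rewrite -natrM; congr (_%:R); lia.
Qed.

Lemma arith_sound_comp (C : Type) (o : arith C) (R R' : comNzRingType)
    (f : {rmorphism R -> R'}) (ev : C -> R) wf :
  arith_sound o ev wf -> arith_sound o (f \o ev) wf.
Proof.
case=> ev0 wf0 evD evM; split=> //= [|x y wx wy|x y wx wy].
- by rewrite ev0 rmorph0.
- by have [-> ->] := evD x y wx wy; rewrite rmorphD.
- by have [-> ->] := evM x y wx wy; rewrite rmorphM.
Qed.

Definition base_arith (p : N) (m : seq N) := ext_arith (mod_arith p) m.

Definition base_const (m : seq N) (a : N) : seq N := a :: nseq (size m).-1 0%num.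

Definition quartic_arith (p : N) (m c : seq N) :=
  let z := azero (base_arith p m) in ext_arith (base_arith p m) [:: c; z; z; z].

Definition pow_N (C : Type) (o : arith C) (one a : C) (e : N) : C :=
  if e is Npos e' then pow_pos o a e' else one.

Definition geometric4 (Q : N) : N := (1 + Q + Q * Q + Q * Q * Q)%num.

Definition prodN (s : seq N) : N := foldr N.mul 1%num s.

Definition fe_eqb (a b : seq N) := all2 N.eqb a b.

(* [F = F_p[w]/(w^d - m)], [L = F[beta]/(beta^4 - c)]: [(beta + t)^(N / l)] is not in
   [F], since one of its coordinates on [beta, beta^2, beta^3] is invertible. The
   eighth powers are there because the primes of [N] may be repeated. *)
Definition witness (p Q : N) (m c t : seq N) (ls : seq N) : bool :=
  let Fo := base_arith p m in
  let one := base_const m 1%num in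
  let Lo := quartic_arith p m c in
  let z := azero Fo in
  [&& size c == size m, size t == size m, (0 < size m)%N,
      N.eqb (N.div (Q - 1) 2 * 2)%num (Q - 1)%num,
      fe_eqb (pow_N Fo one c (N.div (Q - 1) 2)) (base_const m (p - 1)%num),
      N.eqb (N.modulo (prodN (flatten (nseq 8 (2%num :: ls)))) (geometric4 Q)) 0%num,
      all (fun l => prime (N.to_nat l)) ls &
      all (fun l =>
        let e := N.div (geometric4 Q) l in
        N.eqb (e * l)%num (geometric4 Q) &&
        has (fun y => fe_eqb (pow_N Fo one y (Q - 1)%num) one)
          (behead (pow_N Lo [:: one; z; z; z] [:: t; one; z; z] e))) ls].

Lemma to_nat_geometric4 Q (q := N.to_nat Q) :
  N.to_nat (geometric4 Q) = (1 + q + q ^ 2 + q ^ 3)%N.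
Proof. by rewrite /q /geometric4 !expnS expn0 !muln1; lia. Qed.

Lemma to_nat_prodN s : N.to_nat (prodN s) = (\prod_(x <- s) N.to_nat x)%N.
Proof. by elim: s => [|x s IHs]; rewrite ?big_nil // big_cons -IHs /=; lia. Qed.

Section Witness.
Variables (F L : finFieldType) (iota : {rmorphism F -> L}).
Local Notation q := #|F|.
Hypothesis cardL : #|L| = (q ^ 4)%N.
Hypothesis q_mod4 : (q %% 4 = 1)%N.

Let q_gt1 : (1 < q)%N. Proof. exact: finNzRing_gt1. Qed.

Let q_gt0 : (0 < q)%N. Proof. exact: ltnW. Qed.

(** A nonzero element of [F] has a logarithm in [L] divisible by [N], and 4 divides [N]. *)
Lemma nonsquare_fourth_root (c : F) : c ^+ (q.-1 %/ 2) = -1 ->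
  exists beta : L, beta ^+ 4 = iota c.
Proof.
move=> c_ns; have nz_c : c != 0.
  apply: contra_eq_neq c_ns => ->; rewrite expr0n.
  case: (_ == 0)%N; last by rewrite eq_sym oppr_eq0 oner_eq0.
  by rewrite -addr_eq0 two_neq0_of_odd ?odd_mod4.
have [g g_prim] := finField_primitive_root L; rewrite cardL in g_prim.
have cq : (iota c) ^+ q.-1 = 1.
  by rewrite -rmorphXn /= expf_pred_card // rmorph1.
have ND := geometric4_pred q.
have /(prim_rootP g_prim)[i Di] : iota c ^+ (q ^ 4).-1 = 1.
  by rewrite -ND exprM cq expr1n.
have : (4 %| i)%N.
  have : (q.-1 * (1 + q + q ^ 2 + q ^ 3) %| q.-1 * i)%N.
    by rewrite ND (prim_order_dvd g_prim) mulnC exprM -Di cq.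
  rewrite dvdn_pmul2l; last by rewrite -ltnS prednK.
  apply: dvdn_trans; rewrite geometric4_factor -[4%N]/(2 * 2)%N dvdn_mul //.
    by rewrite dvdn2 /= odd_mod4.
  by rewrite dvdn2 /= oddX odd_mod4.
by case/dvdnP=> j Dj; exists (g ^+ j); rewrite -exprM -Dj -Di.
Qed.

Lemma fe_eqbP (a b : seq N) : size a = size b -> fe_eqb a b -> a = b.
Proof.
elim: a b => [|x a IHa] [|y b] //= [sab] /andP[/N.eqb_eq-> Eab].
by rewrite (IHa b sab Eab).
Qed.

Lemma pow_NP (C : Type) (o : arith C) (R : comNzRingType) (ev : C -> R) wf one a e :
  arith_sound o ev wf -> wf a -> ev one = 1 -> wf one ->
  ev (pow_N o one a e) = ev a ^+ N.to_nat e /\ wf (pow_N o one a e).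
Proof. by case: e => [|e] // so wa ev1 w1; apply: pow_posP. Qed.

Lemma base_sound (R : comNzRingType) p m (w : R) : (0 < N.to_nat p)%N ->
  (N.to_nat p)%:R = 0 :> R -> (0 < size m)%N ->
  w ^+ size m = ext_ev (fun a => (N.to_nat a)%:R) w m ->
  arith_sound (base_arith p m) (ext_ev (fun a => (N.to_nat a)%:R) w)
    (fun a => size a == size m).
Proof.
move=> p_gt0 p0 m_gt0 wm.
have [H0 H1 H2 H3] := ext_sound (mod_sound p_gt0 p0) (all_predT m) m_gt0 wm.
have wfE (a : seq N) : ext_wf m predT a = (size a == size m).
  by rewrite /ext_wf all_predT andbT.
split=> //= [|x y wx wy|x y wx wy]; first by rewrite -wfE.
- by have := H2 x y; rewrite !wfE; apply.
- by have := H3 x y; rewrite !wfE; apply.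
Qed.

Lemma ev_base_const (R : comNzRingType) m (w : R) a :
  ext_ev (fun a => (N.to_nat a)%:R) w (base_const m a) = (N.to_nat a)%:R.
Proof.
have E n : ext_ev (fun a => (N.to_nat a)%:R) w (nseq n 0%num) = 0 :> R.
  by elim: n => //= n ->; rewrite mulr0 addr0.
by have /= -> := E (size m).-1; rewrite mulr0 addr0.
Qed.

(** If [(beta + t)^((q^4 - 1) / l)] were 1, then [(beta + t)^(N / l)] would be fixed by Frobenius,
    hence lie in [F], and [beta_free] would kill its other coordinates. The table stores [t] for
    [beta + t], hence [t' = -t]. *)
Lemma witness_odd_generator (p Q : N) (m c t ls : seq N) (w : F) :
  witness p Q m c t ls -> prime (N.to_nat p) -> N.to_nat Q = q ->
  (N.to_nat p)%:R = 0 :> F ->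
  w ^+ size m = ext_ev (fun a => (N.to_nat a)%:R) w m ->
  exists (beta : L) (c' t' : F), [/\ beta ^+ 4 = iota c', c' ^+ (q.-1 %/ 2) = -1 &
    odd_generator iota beta t'].
Proof.
case/and5P=> /eqP sc /eqP st m_gt0 /N.eqb_eq Q_even /and4P[c_ns complete ls_prime wit] pp DQ p0 wm.
have p_gt0 := prime_gt0 pp.
pose evF : seq N -> F := ext_ev (fun a => (N.to_nat a)%:R) w.
have soF : arith_sound (base_arith p m) evF (fun a => size a == size m) by apply: base_sound.
have size_const a : size (base_const m a) = size m by rewrite /= size_nseq prednK.
have one1 : evF (base_const m 1%num) = 1 by rewrite /evF ev_base_const.
have c'_ns : (evF c) ^+ (q.-1 %/ 2) = -1.
  have [|||E W] := @pow_NP _ _ _ _ _ (base_const m 1%num) c (N.div (Q - 1) 2) soF.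
  1-3: by rewrite ?sc ?size_const.
  have De : (q.-1 %/ 2)%N = N.to_nat (N.div (Q - 1) 2).
    have -> : q.-1 = N.to_nat (N.div (Q - 1) 2 * 2) by rewrite Q_even to_nat_pred DQ.
    by rewrite to_nat_mul mulnK.
  rewrite De -E (fe_eqbP _ c_ns); last by rewrite (eqP W) size_const.
  rewrite /evF ev_base_const; apply/eqP; rewrite -addr_eq0 -[1]/(1%:R) -natrD.
  have -> : (N.to_nat (p - 1) + 1 = N.to_nat p)%N by lia.
  by rewrite p0.
have [beta beta4] := nonsquare_fourth_root c'_ns.
exists beta, (evF c), (- evF t); split=> // l pl ol lN.
pose z := azero (base_arith p m).
have soL : arith_sound (quartic_arith p m c) (ext_ev (iota \o evF) beta)
    (ext_wf [:: c; z; z; z] (fun a => size a == size m)).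
  have [ev0 wf0 _ _] := soF.
  apply: ext_sound => //=; first exact: arith_sound_comp.
    by rewrite /z wf0 sc eqxx.
  by rewrite beta4 [RHS]/= /z ev0 rmorph0 !(mulr0, addr0).
(* [N] divides the eighth power of the product of 2 and the listed primes, so every odd prime of [N]
   is listed. *)
have [l' l'_in Dl] : exists2 l', l' \in ls & N.to_nat l' = l.
  have := N_mod0_dvdn complete; rewrite to_nat_geometric4 DQ => /(dvdn_trans lN).
  rewrite to_nat_prodN Euclid_dvd_prod // big_has_cond => /hasP[x x_in /= lx].
  have : x \in 2%num :: ls by case/flattenP: x_in => s; rewrite mem_nseq => /andP[_ /eqP->].
  rewrite inE => /orP[/eqP x2 | x_ls].
    by move: lx; rewrite x2 dvdn_prime2 // => /eqP l2; rewrite l2 in ol.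
  exists x => //; apply/esym/eqP; rewrite -dvdn_prime2 //.
  exact: (allP ls_prime).
have /andP[/N.eqb_eq El /hasP[y y_in y_unit]] := allP wit _ l'_in.
set e := N.div _ l' in El y_in.
have De : ((1 + q + q ^ 2 + q ^ 3) %/ l = N.to_nat e)%N.
  rewrite -DQ -to_nat_geometric4 -El -Dl to_nat_mul mulnK // Dl prime_gt0 //.
pose a0 := [:: t; base_const m 1%num; z; z].
pose one4 := [:: base_const m 1%num; z; z; z].
have [ev0 wf0 _ _] := soF.
have wf_a0 : ext_wf [:: c; z; z; z] (fun a => size a == size m) a0.
  by rewrite /ext_wf /= wf0 st size_nseq prednK // !eqxx.
have wf_one4 : ext_wf [:: c; z; z; z] (fun a => size a == size m) one4.
  by rewrite /ext_wf /= wf0 size_nseq prednK // !eqxx.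
have ev_one4 : ext_ev (iota \o evF) beta one4 = 1.
  rewrite /= /z ev0 rmorph0 !(mulr0, addr0).
  by have /= -> := one1; rewrite rmorph1.
have ev_a0 : ext_ev (iota \o evF) beta a0 = beta - iota (- evF t).
  rewrite /= /z ev0 rmorph0 !(mulr0, addr0) rmorphN opprK addrC.
  by have /= -> := one1; rewrite rmorph1 mulr1.
have [Ev Wv] := pow_NP e soL wf_a0 ev_one4 wf_one4.
rewrite ev_a0 in Ev.
have -> : ((q ^ 4).-1 %/ l = (N.to_nat e) * q.-1)%N.
  by rewrite -De -geometric4_pred -muln_divA // mulnC.
rewrite exprM -{}Ev; move: Wv y_in; rewrite -/a0 -/one4.
set v := pow_N _ _ _ _; move=> /andP[/eqP sv wv] y_in.
(* [y^(Q - 1)] computes to 1 and [Q - 1] is positive, so [y] does not evaluate to 0. *)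
have y_neq0 : evF y != 0.
  have wy : size y == size m by apply: (allP wv); apply: mem_behead.
  have [E W] := pow_NP (Q - 1) soF wy one1 (introT eqP (size_const 1%num)).
  rewrite (fe_eqbP _ y_unit) ?(eqP W) ?size_const // one1 in E.
  apply: contra_eq_neq E => ->; rewrite expr0n.
  rewrite to_nat_pred DQ.
  have -> : (q.-1 == 0)%N = false by apply/negbTE; rewrite -lt0n -ltnS prednK.
  by rewrite oner_neq0.
apply/eqP => v1.
have [a Da] : exists a, iota a = ext_ev (iota \o evF) beta v.
  by apply: frobenius_fixed_image; rewrite -(prednK q_gt0) exprS v1 mulr1.
move: sv y_in v1 Da; case: v wv => [|v0 [|v1 [|v2 [|v3 []]]]] // _ _ y_in _ Da.
pose f := Poly [:: evF v0 - a; evF v1; evF v2; evF v3].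
have f0 : f = 0.
  apply: (beta_free cardL q_mod4 beta4 c'_ns); first exact: size_Poly.
  rewrite /f map_Poly ?rmorph0 // horner_Poly /= rmorphB Da /=; ring.
move: y_in; rewrite /= !inE; case/or3P => /eqP Dy; move/eqP: y_neq0; apply; rewrite Dy.
- by rewrite -[RHS](coef0 F 1) -f0 coef_Poly.
- by rewrite -[RHS](coef0 F 2) -f0 coef_Poly.
- by rewrite -[RHS](coef0 F 3) -f0 coef_Poly.
Qed.
End Witness.

(** * The numerical verification *)

Definition pow2 (k : nat) : N := iter k N.double 1%num.

Lemma to_nat_pow2 k : N.to_nat (pow2 k) = (2 ^ k)%N.
Proof. by elim: k => //= k IHk; rewrite expnS -IHk /pow2 /=; lia. Qed.

Definition sieve_error (k s : nat) (dn dd : N) : N :=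
  (pow2 k * (N.of_nat s.-1 * dd + 2 * dn) - dn)%num.

Lemma to_nat_sieve_error k s dn dd : N.to_nat (sieve_error k s dn dd)
  = (2 ^ k * (s.-1 * N.to_nat dd + 2 * N.to_nat dn) - N.to_nat dn)%N.
Proof.
rewrite /sieve_error -to_nat_pow2; move: (pow2 k) => x.
by rewrite to_nat_sub to_nat_mul to_nat_add !to_nat_mul Nat2N.id.
Qed.

Definition sumN (s : seq N) : N := foldr N.add 0%num s.

Lemma to_nat_sumN s : N.to_nat (sumN s) = (\sum_(x <- s) N.to_nat x)%N.
Proof. by elim: s => [|x s IHs]; rewrite ?big_nil // big_cons -IHs /=; lia. Qed.

(** Each quotient is rounded up, so this bounds [dd] times the sum of the reciprocals from above. *)
Definition recip_sum (dd : N) (s : seq N) : N := sumN [seq (N.div dd l + 1)%num | l <- s].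

Lemma to_nat_recip_sum dd s : N.to_nat (recip_sum dd s)
  = (\sum_(l <- [seq N.to_nat l | l <- s]) (N.to_nat dd %/ l).+1)%N.
Proof.
rewrite to_nat_sumN !big_map; apply: eq_bigr => l _; rewrite -to_nat_div; lia.
Qed.

Definition denom : N := 1000000%num.

Definition primes256 : seq N :=
  [:: 3; 5; 7; 11; 13; 17; 19; 23; 29; 31; 37; 41; 43; 47; 53; 59; 61; 67; 71; 73; 79;
      83; 89; 97; 101; 103; 107; 109; 113; 127; 131; 137; 139; 149; 151; 157; 163; 167;
      173; 179; 181; 191; 193; 197; 199; 211; 223; 227; 229; 233; 239; 241; 251]%num.

(** The sixty primes from 7 to 307. For large [q] they stand in, as the worst case, for the primes
    of [N] other than 2, 3 and 5. *)
Definition primes7 : seq N :=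
  drop 2 primes256 ++ [:: 257; 263; 269; 271; 277; 281; 283; 293; 307]%num.

(* Unlike [has], stops at the first success under [vm_compute]. *)
Fixpoint lazy_has (T : Type) (p : T -> bool) (s : seq T) : bool :=
  if s is x :: s' then if p x then true else lazy_has p s' else false.

(* Primes above 256 are not enumerated: [s'] bounds how many can divide [N] once the
   smaller ones are factored out, and each counts for at most [1/256]. *)
Definition small_sieve (Q : N) : bool :=
  let A := [seq l <- primes256 | N.eqb (N.modulo (geometric4 (N.modulo Q l)) l) 0%num] in
  let M := N.div (geometric4 Q) (prodN A * 4) in
  let s' := N.to_nat (N.div (N.log2 M) 8) in
  lazy_has (fun k =>
    let S := drop k A in
    let s := maxn 1 (size S + s') in
    let dn := (denom - (recip_sum denom S + N.of_nat s' * (N.div denom 256 + 1)))%num in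
    let Y := sieve_error k s dn denom in
    if N.ltb 0 dn then N.ltb (4 * Q * (Y * Y)) ((Q + 1) * (Q + 1) * (dn * dn)) else false)%num
  (iota 0 5).

(* If [Q < 2^16] is a power of [l], then it divides [l^16]. *)
Definition not_prime_power (Q : N) : bool :=
  lazy_has (fun l => if N.eqb (N.modulo Q l) 0
    then negb (N.eqb (N.modulo (prodN (nseq 16 l)) Q) 0) else false)%num primes256.

(** Entries [(p, c, t, ls)]: [beta^4 = c] with [c] a nonsquare, [beta + t] is the element tested,
    [ls] lists the odd primes of [N]. *)
Definition prime_witnesses : seq (N * N * N * seq N) :=
  [:: (5, 2, 1, [:: 3; 13]); (13, 2, 1, [:: 5; 7; 17]); (17, 3, 1, [:: 3; 5; 29]);
      (29, 2, 2, [:: 3; 5; 421]); (37, 2, 1, [:: 5; 19; 137]); (41, 3, 2, [:: 3; 7; 29]);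
      (53, 2, 1, [:: 3; 5; 281]); (73, 5, 1, [:: 5; 13; 37; 41]);
      (89, 3, 1, [:: 3; 5; 17; 233]); (109, 2, 1, [:: 5; 11; 13; 457]);
      (113, 3, 1, [:: 3; 5; 19; 1277]); (137, 3, 3, [:: 3; 5; 23; 1877]);
      (149, 2, 1, [:: 3; 5; 17; 653]); (173, 2, 1, [:: 3; 5; 29; 41; 73]);
      (197, 2, 5, [:: 3; 5; 11; 3881]); (233, 3, 2, [:: 3; 5; 13; 61; 89]);
      (293, 2, 3, [:: 3; 5; 7; 17; 101]); (317, 2, 4, [:: 3; 5; 13; 53; 773]);
      (353, 3, 2, [:: 3; 5; 17; 59; 733]); (389, 2, 5, [:: 3; 5; 13; 29; 2609]);
      (593, 3, 1, [:: 3; 5; 11; 13; 541]); (857, 3, 1, [:: 3; 5; 11; 13; 37; 397]);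
      (1217, 3, 1, [:: 3; 5; 7; 13; 29; 11393]);
      (2309, 2, 1, [:: 3; 5; 7; 11; 13; 53; 73])]%num.

(** In [(p, Q, m, c, t, ls)] the list [m] expresses a power of the generator [w]: [w^2 = 2] for
    [Q = 9], [w^3 = 1 + w^2] for [Q = 125], and [w = 0] for prime fields. *)
Definition witnesses : seq (N * N * seq N * seq N * seq N * seq N) :=
  [:: (3, 9, [:: 2; 0], [:: 1; 1], [:: 1; 0], [:: 5; 41]);
      (5, 125, [:: 1; 0; 1], [:: 2; 0; 0], [:: 2; 1; 0], [:: 3; 7; 13; 601])]%num
  ++ [seq let: (p, c, t, ls) := x in (p, p, [:: 0%num], [:: c], [:: t], ls) | x <- prime_witnesses].

Definition exceptional : seq N := [seq x.1.1.1.1.2 | x <- witnesses].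

(* The generator of [F_p[w]/(w^d - m)] is fixed by [x |-> x^Q]: it lies in [F_Q]. *)
Definition frobenius_fixed (p Q : N) (m : seq N) : bool :=
  let o := base_arith p m in
  let w := ext_shift (mod_arith p) m (base_const m 1%num) in
  fe_eqb (pow_N o (base_const m 1%num) w Q) w.

Definition settled (Q : N) : bool :=
  if not_prime_power Q then true else if small_sieve Q then true else has (N.eqb Q) exceptional.

Fixpoint check_from (p : N -> bool) (n : nat) (Q : N) : bool :=
  if n is n'.+1 then if p Q then check_from p n' (Q + 4)%num else false else true.

Lemma witnesses_ok : all (fun x => let: (p, Q, m, c, t, ls) := x in
  [&& prime (N.to_nat p), N.eqb (N.modulo Q p) 0%num, frobenius_fixed p Q m &
      witness p Q m c t ls]) witnesses.
Proof. by vm_compute. Qed.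

(** The values tested are those equal to 1 modulo 4 from 5 to 36001. *)
Lemma check_from_ok : check_from settled (N.to_nat 9000) 5%num.
Proof. by vm_compute. Qed.

(** * From the computations to the sieve criterion *)

(** The numerical hypotheses of [sieve_criterion], which speak of [q] alone; small and large [q]
    both aim at them. *)
Definition sieve_success (q : nat) := exists (K S : seq nat) (k s dn dd : nat),
  [/\ uniq (K ++ S),
      forall l, (l \in K ++ S) = [&& prime l, odd l & (l %| 1 + q + q ^ 2 + q ^ 3)%N],
      (size K <= k)%N, (size S <= s)%N
    & [/\ (0 < s)%N, (0 < dn)%N, (0 < dd)%N,
          (\sum_(l <- S) (dd %/ l).+1 + dn <= dd)%N
        & (4 * q * (2 ^ k * (s.-1 * dd + 2 * dn) - dn) ^ 2 < q.+1 ^ 2 * dn ^ 2)%N]].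

Lemma lazy_hasE (T : Type) (p : T -> bool) s : lazy_has p s = has p s.
Proof. by elim: s => //= x s ->; case: (p x). Qed.

Lemma log2_geq n M : (0 < N.to_nat M)%N -> (2 ^ n <= N.to_nat M)%N ->
  (n <= N.to_nat (N.log2 M))%N.
Proof.
move=> M_gt0 le_nM; rewrite -[n]Nat2N.id.
have powE m : N.to_nat (N.pow 2 (N.of_nat m)) = (2 ^ m)%N.
  elim: m => // m IHm; rewrite Nat2N.inj_succ N.pow_succ_r' expnS -IHm; lia.
have : (N.pow 2 (N.of_nat n) <= M)%num by move: le_nM; rewrite -powE; lia.
have M0 : (0 < M)%num by lia.
by move/(N.log2_le_pow2 _ _ M0); lia.
Qed.

Lemma primes256E : [seq N.to_nat l | l <- primes256] = [seq l <- iota 0 256 | prime l && odd l].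
Proof. by vm_compute. Qed.

Lemma geometric4_modn q l :
  (l %| 1 + q %% l + (q %% l) ^ 2 + (q %% l) ^ 3)%N = (l %| 1 + q + q ^ 2 + q ^ 3)%N.
Proof.
rewrite /dvdn -modnDm -[in RHS]modnDm modnXm; congr ((_ + _) %% _ == _)%N.
rewrite -modnDm -[in RHS]modnDm modnXm; congr ((_ + _) %% _)%N.
by rewrite modnDmr.
Qed.

Lemma geometric4_dvd4 q : (q %% 4 = 1)%N -> (4 %| 1 + q + q ^ 2 + q ^ 3)%N.
Proof. by move=> q1; rewrite -geometric4_modn q1. Qed.

Lemma odd_primes_dvd (s : seq nat) q : (q %% 4 = 1)%N -> uniq s ->
  all (fun l => [&& prime l, odd l & (l %| 1 + q + q ^ 2 + q ^ 3)%N]) s ->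
  (4 * \prod_(l <- s) l <= 1 + q + q ^ 2 + q ^ 3)%N.
Proof.
move=> q1 us /allP Hs; apply: dvdn_leq; first by [].
rewrite Gauss_dvd.
  rewrite geometric4_dvd4 // prod_primes_dvd //; apply/allP => l /Hs; by case/and3P.
rewrite (_ : 4 = 2 ^ 2)%N // coprimeXl // coprime2n big_seq.
by elim/big_rec: _ => // l x /Hs /and3P[_ ol _]; rewrite oddM ol.
Qed.

Lemma prod_geq (b : nat) (s : seq nat) : all (fun l => b <= l)%N s ->
  (b ^ size s <= \prod_(l <- s) l)%N.
Proof.
elim: s => [|l s IHs] /=; first by rewrite big_nil.
by move=> /andP[bl /IHs H]; rewrite big_cons expnS leq_mul.
Qed.

(** The odd primes of [N] split at 256 into [A'], found by trial division, and [B], of which only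
    the number is controlled: 4 times the product of [A'] times [256^|B|] is at most [N], whence
    [8 |B| <= log2 M]. *)
Lemma small_sieveP Q : (N.to_nat Q %% 4 = 1)%N -> small_sieve Q -> sieve_success (N.to_nat Q).
Proof.
set q := N.to_nat Q => q1; rewrite /small_sieve.
set A := [seq l <- primes256 | _]; set M := N.div (geometric4 Q) _; set s' := N.to_nat (N.div _ 8).
rewrite lazy_hasE => /hasP[k _]; set S0 := drop k A; set dn := N.sub _ _.
case: ifP => // dn_gt0 crit.
pose N := (1 + q + q ^ 2 + q ^ 3)%N.
pose A' := [seq N.to_nat l | l <- A].
have memA l : (l \in A') = [&& prime l, odd l & (l %| N)%N] && (l < 256)%N.
  have -> : A' = [seq l <- [seq N.to_nat l | l <- primes256] | (l %| N)%N].
    rewrite filter_map /A' /A; congr map; apply: eq_in_filter => x _ /=.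
    by rewrite to_nat_eqb to_nat_mod to_nat_geometric4 to_nat_mod -[RHS]geometric4_modn.
  rewrite mem_filter primes256E mem_filter mem_iota add0n leq0n /=.
  case: (prime l); case: (odd l); case: (_ %| _)%N; case: (l < _)%N => //.
have uA : uniq A'.
  rewrite /A' /A; apply: (@subseq_uniq _ _ [seq N.to_nat l | l <- primes256]).
    by apply: map_subseq; apply: filter_subseq.
  by rewrite primes256E; apply: filter_uniq; apply: iota_uniq.
pose B := [seq l <- primes N | odd l && (256 <= l)%N].
have memB l : (l \in B) = [&& prime l, odd l & (l %| N)%N] && (256 <= l)%N.
  rewrite mem_filter mem_primes /=.
  by case: (prime l); case: (odd l); case: (l %| N)%N; case: (256 <= l)%N.
have mem l : (l \in A' ++ B) = [&& prime l, odd l & (l %| N)%N].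
  by rewrite mem_cat memA memB -andb_orr ltnNge orNb andbT.
have uAB : uniq (A' ++ B).
  rewrite cat_uniq uA filter_uniq ?primes_uniq // andbT /=.
  by apply/hasPn => l; rewrite memA memB => /andP[_]; rewrite leqNgt => /negbTE->; rewrite andbF.
have sizeB : (size B <= s')%N.
  have posAB (s : seq nat) : {subset s <= A' ++ B} -> (0 < \prod_(l <- s) l)%N.
    move=> sub; rewrite big_seq prodn_cond_gt0 // => l /sub.
    by rewrite mem => /and3P[/prime_gt0].
  have : (256 ^ size B <= N.to_nat M)%N.
    have DA : (\prod_(x <- A) N.to_nat x = \prod_(x <- A') x)%N by rewrite big_map.
    rewrite /M to_nat_div to_nat_geometric4 to_nat_mul to_nat_prodN -/q -/N DA.
    rewrite leq_divRL; last by rewrite muln_gt0 posAB // => l; rewrite mem_cat => ->.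
    have : (4 * \prod_(l <- A' ++ B) l <= N)%N.
      by apply: odd_primes_dvd => //; apply/allP => l; rewrite mem.
    apply: leq_trans; rewrite big_cat /= [leqLHS]mulnC -mulnA mulnCA leq_mul2l leq_mul2l.
    by rewrite prod_geq ?orbT //; apply/allP => l; rewrite memB => /andP[].
  rewrite (_ : 256 = 2 ^ 8)%N // -expnM => le_M.
  rewrite /s' to_nat_div leq_divRL // mulnC log2_geq //.
  by apply: leq_trans le_M; rewrite expn_gt0.
exists (take k A'), (drop k A' ++ B), k, (maxn 1 (size S0 + s')), (N.to_nat dn), (N.to_nat denom).
rewrite catA cat_take_drop; split=> //.
- by rewrite size_take_min geq_minl.
- by rewrite size_cat leq_max -map_drop size_map leq_add2l sizeB orbT.
split=> //; first by rewrite leq_maxl.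
- by move: dn_gt0; rewrite to_nat_ltb.
- move: dn_gt0; rewrite to_nat_ltb /dn to_nat_sub to_nat_add to_nat_recip_sum.
  rewrite to_nat_mul to_nat_add to_nat_div /S0 map_drop -/A' Nat2N.id.
  set D := N.to_nat denom; rewrite big_cat /= => dn_gt0.
  have : (\sum_(l <- B) (D %/ l).+1 <= s' * (D %/ 256 + 1))%N.
    apply: leq_trans (leq_mul sizeB (leqnn _)).
    rewrite -sum1_size big_distrl /= big_seq [X in (_ <= X)%N]big_seq.
    apply: leq_sum => l; rewrite memB mul1n addn1 ltnS => /andP[_ le_l].
    by rewrite leq_div2l.
  move: dn_gt0; move: (\sum_(l <- drop k A') _)%N (\sum_(l <- B) _)%N (s' * _)%N => x y z.
  clearbody D; clear; change (N.to_nat 256) with 256%N; lia.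
move: crit; rewrite to_nat_ltb !to_nat_mul to_nat_sieve_error to_nat_add -/q.
by rewrite addn1 !expnS !expn0 !muln1 !mulnA.
Qed.

Definition table7 : seq nat := [seq N.to_nat l | l <- primes7].

Lemma table7E : table7 = [seq l <- iota 7 301 | prime l].
Proof. by vm_compute. Qed.

Lemma size_table7 : size table7 = 60%N. Proof. by []. Qed.

Lemma sorted_table7 : sorted ltn table7.
Proof. by rewrite table7E sorted_filter ?iota_ltn_sorted //; apply: ltn_trans. Qed.

(** Otherwise the [i + 1] least elements of [S] would all be among the first [i] entries of [c]. *)
Lemma sorted_nth_leq (c S : seq nat) i : sorted ltn c -> sorted ltn S ->
  {in S, forall x, (x < nth 0%N c i)%N -> x \in c} -> (i < size S)%N -> (i < size c)%N ->
  (nth 0%N c i <= nth 0%N S i)%N.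
Proof.
rewrite !ltn_sorted_uniq_leq => /andP[_ so_c] /andP[uS so_S] Sc iS ic.
rewrite leqNgt; apply/negP => lt_i.
have sub : {subset take i.+1 S <= take i c}.
  move=> x /(nthP 0%N)[j]; rewrite size_takel // => lt_j.
  rewrite nth_take // => Dx.
  have le_x : (x <= nth 0%N S i)%N.
    rewrite -Dx; apply: (sorted_leq_nth leq_trans leqnn); rewrite ?inE //.
    exact: leq_trans lt_j _.
  have lt_x := leq_ltn_trans le_x lt_i.
  have x_c : x \in c by apply: Sc => //; rewrite -Dx mem_nth // (leq_trans lt_j).
  rewrite in_take // ltnNge; apply/negP => le_i; move: lt_x.
  by rewrite -(nth_index 0%N x_c) ltnNge (sorted_leq_nth leq_trans leqnn) ?inE ?index_mem.
by have := uniq_leq_size (take_uniq _ uS) sub; rewrite !size_takel ?ltnn // ltnW.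
Qed.

Lemma table7_lower_bound (S : seq nat) i : sorted ltn S ->
  all (fun l => prime l && (7 <= l)%N) S -> (i < size S)%N -> (i < 60)%N ->
  (nth 0%N table7 i <= nth 0%N S i)%N.
Proof.
move=> so_S /allP pS iS i60; apply: (sorted_nth_leq sorted_table7 so_S); rewrite ?size_table7 //.
move=> x /pS/andP[px x7] lt_x; have /(mem_nth 0%N) : (i < size table7)%N by rewrite size_table7.
rewrite table7E !mem_filter !mem_iota px x7 => /and3P[_ _ lt_t].
exact: ltn_trans lt_x lt_t.
Qed.

(** Replacing [S] by an initial segment of the table makes the product smallest and, in the next
    lemma, the sum of reciprocals largest. *)
Lemma table7_leq_prod (S : seq nat) : sorted ltn S ->
  all (fun l => prime l && (7 <= l)%N) S -> (size S <= 60)%N ->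
  (\prod_(l <- take (size S) table7) l <= \prod_(l <- S) l)%N.
Proof.
move=> so_S pS sS; rewrite (big_nth 0%N) [leqRHS](big_nth 0%N) size_takel //.
rewrite big_nat [leqRHS]big_nat; apply: leq_prod => i /andP[_ iS].
by rewrite nth_take // table7_lower_bound // (leq_trans iS).
Qed.

Lemma table7_geq_recip_sum (D : nat) (S : seq nat) : sorted ltn S ->
  all (fun l => prime l && (7 <= l)%N) S -> (size S <= 60)%N ->
  (\sum_(l <- S) (D %/ l).+1 <= \sum_(l <- take (size S) table7) (D %/ l).+1)%N.
Proof.
move=> so_S pS sS; rewrite (big_nth 0%N) [leqRHS](big_nth 0%N) size_takel //.
rewrite big_nat [leqRHS]big_nat; apply: leq_sum => i /andP[_ iS].
have i60 := leq_trans iS sS; rewrite nth_take // ltnS leq_div2l ?table7_lower_bound //.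
have : nth 0%N table7 i \in table7 by apply: mem_nth; rewrite size_table7.
by rewrite table7E mem_filter => /andP[/prime_gt0].
Qed.

(* For [q >= t] the sieve applies; [4 P] bounds [N] from below, hence [q] too. *)
Definition large_check (s : nat) : bool :=
  let dn := (denom - recip_sum denom (take s primes7))%num in
  let Y := sieve_error 2 (maxn 1 s) dn denom in
  let t := (N.div (4 * (Y * Y)) (dn * dn) + 1)%num in
  N.ltb 0 dn && (N.leb t 36000 || N.leb (t * t * t) (4 * prodN (take s primes7)))%num.

Lemma large_check_ok : all large_check (iota 0 61).
Proof. by vm_compute. Qed.

(** [2^384 = 64^64]: four factors 64 to spare beyond the sixty primes. *)
Lemma table7_prod : (2 ^ 384 <= 4 * \prod_(l <- table7) l)%N.
Proof.
have : N.leb (pow2 384) (4 * prodN primes7)%num by vm_compute.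
move/N.leb_le; rewrite /table7 big_map -to_nat_prodN -to_nat_pow2.
by move: (pow2 384) (prodN primes7) => x y; lia.
Qed.

(** [N] is less than [(q + 1)^3], so lower bounds on [N] by cubes become lower bounds on [q]. *)
Lemma cube_leq_geometric4 t q : (0 < q)%N -> (t ^ 3 <= 1 + q + q ^ 2 + q ^ 3)%N -> (t <= q)%N.
Proof.
move=> q_gt0 le_t; rewrite leqNgt; apply/negP => lt_q.
have : (q.+1 ^ 3 <= 1 + q + q ^ 2 + q ^ 3)%N by apply: leq_trans le_t; rewrite leq_exp2r.
have -> : (q.+1 ^ 3 = 1 + 3 * q + 3 * q ^ 2 + q ^ 3)%N by rewrite !expnS !expn0; lia.
lia.
Qed.

(** With at most sixty primes from 7 on, 3 and 5 are sieved completely, the others are subtracted,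
    and the table decides. With more, [N] is so large that all its odd primes can be sieved
    completely. *)
Lemma large_success q : (q %% 4 = 1)%N -> (N.to_nat 36000 <= q)%N -> sieve_success q.
Proof.
move=> q1 le_q; pose N := (1 + q + q ^ 2 + q ^ 3)%N.
have q_gt0 : (0 < q)%N by apply: leq_trans le_q.
pose S := [seq l <- primes N | (7 <= l)%N].
have so_S : sorted ltn S by rewrite sorted_filter ?sorted_primes //; apply: ltn_trans.
have memS l : (l \in S) = [&& prime l, odd l & (l %| N)%N] && (7 <= l)%N.
  rewrite mem_filter mem_primes /=; case: leqP => l7; rewrite ?andbF ?andbT //=.
  case pl: (prime l); case: (boolP (odd l)) => //= /(prime_oddPn pl) l2.
  by rewrite l2 in l7.
have uS : uniq S by rewrite filter_uniq ?primes_uniq.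
have pS : all (fun l => prime l && (7 <= l)%N) S.
  by apply/allP => l; rewrite memS => /andP[/and3P[->]].
have lower (s : seq nat) : uniq s -> {subset s <= [seq l <- primes N | odd l]} ->
    (4 * \prod_(l <- s) l <= N)%N.
  move=> us sub; apply: odd_primes_dvd => //; apply/allP => l /sub.
  by rewrite mem_filter mem_primes => /and4P[-> -> _ ->].
have lowerS s : uniq s -> {subset s <= S} -> (4 * \prod_(l <- s) l <= N)%N.
  move=> us sub; apply: lower => // l /sub; rewrite memS mem_filter mem_primes.
  by case/andP=> /and3P[-> -> ->].
have [small_S | large_S] := leqP (size S) 60.
  have : large_check (size S) by apply: (allP large_check_ok); rewrite mem_iota.
  rewrite /large_check; set dn := N.sub _ _; set Y := sieve_error _ _ _ _.
  set t := (N.div _ _ + 1)%num; set P := prodN _ => /andP[dn_gt0 crit].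
  have dn_gt0' : (0 < N.to_nat dn)%N by move: dn_gt0; rewrite to_nat_ltb.
  have le_t : (N.to_nat t <= q)%N.
    case/orP: crit => /N.leb_le.
      by move: (t) => x le_x; apply: leq_trans le_q; lia.
    move=> le_t.
    apply: cube_leq_geometric4 => //; rewrite -/N; apply: leq_trans (lowerS S uS _) => //.
    apply: leq_trans (leq_mul (leqnn 4) (table7_leq_prod so_S pS small_S)).
    rewrite /table7 -map_take big_map -to_nat_prodN -/P !expnS expn0 muln1 mulnA.
    by rewrite -!to_nat_mul; lia.
  have [K [uK memK sizeK]] : exists K, [/\ uniq K,
      forall l, (l \in K) = ((l == 3) || (l == 5)) && (l %| N)%N & (size K <= 2)%N].
    exists [seq l <- [:: 3; 5]%N | (l %| N)%N]; split; first by rewrite filter_uniq.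
      by move=> l; rewrite mem_filter !inE andbC.
    by rewrite size_filter count_size.
  exists K, S, 2%N, (maxn 1 (size S)), (N.to_nat dn), (N.to_nat denom).
  split=> //; try split=> //.
  - rewrite cat_uniq uS uK andbT /=; apply/hasPn => l; rewrite memS memK => /andP[_ l7].
    by case: eqP l7 => [->|_] //; case: eqP => [->|_].
  - move=> l; rewrite mem_cat memS memK; case: leqP => [l7|l7].
      by rewrite andbF orbF -/N; do 7![case: l l7 => [|l] l7 //].
    by rewrite andbT; case: eqP l7 => [->|_] //; case: eqP => [->|_].
  - by rewrite leq_maxr.
  - by rewrite leq_maxl.
  - apply: leq_trans (leq_add (table7_geq_recip_sum _ so_S pS small_S) (leqnn _)) _.
    rewrite /table7 -map_take -to_nat_recip_sum.
    move: dn_gt0'; rewrite /dn to_nat_sub; move: (N.to_nat (recip_sum _ _)) (N.to_nat denom).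
    by move=> x D; rewrite subn_gt0 => /ltnW le_D; rewrite subnKC.
  - rewrite -to_nat_sieve_error -/Y.
    have : (4 * N.to_nat Y ^ 2 <= q * N.to_nat dn ^ 2)%N.
      apply: leq_trans (leq_mul le_t (leqnn _)).
      rewrite /t to_nat_add to_nat_div !to_nat_mul -!mulnn addn1 ltnW // ltn_ceil //.
      by rewrite muln_gt0 dn_gt0'.
    move: (N.to_nat Y) (N.to_nat dn) dn_gt0' => y d d_gt0 le_y.
    apply: (@leq_ltn_trans (q * (q * d ^ 2))).
      by rewrite [(4 * q)%N]mulnC -mulnA leq_mul2l le_y orbT.
    by rewrite mulnA ltn_pmul2r ?expn_gt0 ?d_gt0 // mulnn ltn_exp2r.
set w := size S in large_S.
pose K := [seq l <- primes N | odd l].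
have sizeK : (size K <= w + 2)%N.
  have sub : {subset K <= S ++ [:: 3; 5]%N}.
    move=> l; rewrite mem_filter mem_primes mem_cat memS !inE => /and4P[ol pl _ lN].
    rewrite ol pl lN /=; case: leqP => //=; do 7![case: l ol pl lN => [|l] ol pl lN //].
  have := uniq_leq_size _ sub; rewrite size_cat; apply.
  by rewrite filter_uniq ?primes_uniq.
(* 4 times the product of sixty primes exceeds [64^64], every further prime exceeds [64]. *)
have le_w : (4 ^ (w + 4) <= q)%N.
  apply: cube_leq_geometric4 => //; rewrite -/N -expnM mulnC expnM -/N.
  apply: leq_trans (lowerS S uS _) => //; rewrite -(cat_take_drop 60 S) big_cat /= mulnA.
  have -> : ((4 ^ 3) ^ (w + 4) = 2 ^ 384 * (4 ^ 3) ^ (size (drop 60 S)))%N.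
    rewrite size_drop -/w -[384%N]/(6 * 64)%N expnM -[(2 ^ 6)%N]/(4 ^ 3)%N -expnD.
    congr (_ ^ _)%N; lia.
  apply: leq_mul.
    apply: leq_trans table7_prod _; rewrite leq_mul2l /=.
    have st : size (take 60 S) = 60%N by rewrite size_takel // ltnW.
    have := @table7_leq_prod (take 60 S); rewrite st -[X in take X]size_table7 take_size.
    apply=> //; first exact: take_sorted.
    by apply/allP => l /mem_take; apply: (allP pS).
  apply: prod_geq; apply/(all_nthP 0%N) => i; rewrite size_drop => lt_i.
  rewrite nth_drop; apply: (@leq_trans (nth 0%N S 59)).
    by apply: leq_trans (table7_lower_bound so_S pS _ _); rewrite // ltnW.
  move: so_S; rewrite ltn_sorted_uniq_leq => /andP[_ so_S'].
  rewrite (sorted_leq_nth leq_trans leqnn) ?inE // -/w; lia.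
(* No prime is subtracted, so [s = dn = dd = 1] and the criterion reads
   [4 q (2^(w + 3) - 1)^2 < (q + 1)^2], which follows from [4^(w + 4) <= q]. *)
exists K, [::], (w + 2)%N, 1%N, 1%N, 1%N; rewrite cats0 big_nil; split=> //.
- by rewrite filter_uniq ?primes_uniq.
- by move=> l; rewrite mem_filter mem_primes /=; case: (odd l); case: (prime l).
split=> //; rewrite /= mul0n add0n muln1 exp1n muln1.
apply: (@leq_ltn_trans (q * 4 ^ (w + 4))); last first.
  apply: (@leq_ltn_trans (q * q)); first by rewrite leq_mul2l le_w orbT.
  by rewrite mulnn ltn_exp2r.
rewrite [(4 * q)%N]mulnC -mulnA leq_mul2l; apply/orP; right.
have -> : (4 ^ (w + 4) = (2 ^ (w + 2) * 2) ^ 2 * 4)%N.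
  rewrite -expnSr -expnM -[4%N]/(2 ^ 2)%N -expnM -expnD; congr (_ ^ _)%N; lia.
by rewrite mulnC leq_mul2r leq_exp2r // leq_subr.
Qed.

Lemma check_fromP p n Q : check_from p n Q -> forall j, (j < n)%N ->
  p (Q + N.of_nat (4 * j))%num.
Proof.
elim: n Q => //= n IHn Q; case: ifP => // okQ /IHn ok [_|j lt_j].
  by rewrite muln0 N.add_0_r.
by have := ok j lt_j; rewrite (_ : Q + 4 + _ = Q + N.of_nat (4 * j.+1))%num //; lia.
Qed.

Lemma settledE Q :
  settled Q = [|| not_prime_power Q, small_sieve Q | has (N.eqb Q) exceptional].
Proof. by rewrite /settled; case: (not_prime_power Q); case: (small_sieve Q). Qed.

Lemma pchar_dvd_card (F : finFieldType) l : prime l -> (l %| #|F|)%N -> l%:R = 0 :> F.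
Proof.
have [p [u [pF ->]]] := finField_card_pchar F; have /andP[pp /eqP p0] := pF.
by move=> pl; rewrite Euclid_dvdX // dvdn_prime2 // => /andP[/eqP->].
Qed.

Lemma not_prime_powerF (F : finFieldType) Q : N.to_nat Q = #|F| -> (#|F| < 2 ^ 16)%N ->
  not_prime_power Q = false.
Proof.
move=> DQ lt_q; apply/negP; rewrite /not_prime_power lazy_hasE => /hasP[l l_in].
case: ifP => // /N_mod0_dvdn; rewrite DQ => lF /negP; apply.
have pl : prime (N.to_nat l).
  have : N.to_nat l \in [seq N.to_nat l | l <- primes256] by apply: map_f.
  by rewrite primes256E mem_filter => /andP[/andP[]].
have [p [u [pF cardF]]] := finField_card_pchar F; have /andP[pp /eqP p0] := pF.
have Dl : N.to_nat l = p.
  by move: lF; rewrite cardF Euclid_dvdX // dvdn_prime2 // => /andP[/eqP].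
have lt_u : (u < 16)%N.
  rewrite -(@ltn_exp2l 2) //; apply: leq_ltn_trans lt_q; rewrite cardF.
  by case: (u) => // u'; rewrite leq_exp2r // prime_gt1.
rewrite to_nat_eqb to_nat_mod to_nat_prodN big_nseq -/(_ %| _)%N DQ cardF Dl.
by rewrite iter_muln muln1 dvdn_exp2l // ltnW.
Qed.

(** A root [x] of the defining polynomial is taken in a splitting field. Evaluated there, the
    computed identity says [x^q = x], so [x] already lies in [F]. *)
Lemma frobenius_fixed_root (F : finFieldType) (p Q : N) (m : seq N) :
  (0 < N.to_nat p)%N -> (N.to_nat p)%:R = 0 :> F -> N.to_nat Q = #|F| -> (0 < size m)%N ->
  frobenius_fixed p Q m ->
  exists w : F, w ^+ size m = ext_ev (fun a => (N.to_nat a)%:R) w m.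
Proof.
move=> p_gt0 p0 DQ m_gt0 fixed.
pose P : {poly F} := 'X^(size m) - Poly [seq (N.to_nat a)%:R | a <- m].
have sP : size P = (size m).+1.
  rewrite size_polyDl ?size_polyXn // size_polyN ltnS.
  by apply: leq_trans (size_Poly _) _; rewrite size_map.
have nzP : P != 0 by rewrite -size_poly_eq0 sP.
have [L [rs Drs _]] := FinSplittingFieldFor nzP.
have evE (R : comNzRingType) (x : R) :
    ext_ev (fun a => (N.to_nat a)%:R) x m = (Poly [seq (N.to_nat a)%:R | a <- m]).[x].
  by rewrite horner_Poly; elim: (m) => //= a s ->; rewrite addrC mulrC.
have [x xP] : exists x : L, root (map_poly (in_alg L) P) x.
  case: rs Drs => [|x rs] Drs; last by exists x; rewrite (eqp_root Drs) root_prod_XsubC mem_head.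
  have := eqp_size Drs; rewrite size_map_poly sP big_nil size_poly1 => [[]] s0.
  by rewrite s0 in m_gt0.
have xm : x ^+ size m = ext_ev (fun a => (N.to_nat a)%:R) x m.
  apply/eqP; rewrite -subr_eq0 evE; move: xP; rewrite rootE /P rmorphB /= map_polyXn.
  rewrite map_Poly ?rmorph0 // -map_comp hornerD hornerN hornerXn.
  by rewrite (eq_map (g := fun a => (N.to_nat a)%:R)) // => a /=; rewrite scaler_nat.
have p0L : (N.to_nat p)%:R = 0 :> L by rewrite -(rmorph_nat (in_alg L)) p0 rmorph0.
have so := base_sound p_gt0 p0L m_gt0 xm.
have one1 := ev_base_const m x 1%num.
have size_one : size (base_const m 1%num) = size m by rewrite /= size_nseq prednK.
have wf_one : ext_wf m predT (base_const m 1%num) by rewrite /ext_wf size_one eqxx all_predT.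
have [Ew /andP[Sw _]] := ext_shiftP (mod_sound p_gt0 p0L) (all_predT m) m_gt0 xm wf_one.
have [Eq Wq] := pow_NP Q so Sw one1 (introT eqP size_one).
move: fixed Eq => /fe_eqbP ->; last by rewrite (eqP Wq) (eqP Sw).
rewrite Ew one1 mulr1 DQ => xq.
have [w Dx] : exists w, w%:A = x.
  have := congr1 (fun P => (map_poly (in_alg L) P).[x]) (finField_genPoly F).
  rewrite rmorphB rmorph_prod /= map_polyXn map_polyX !hornerE -xq subrr.
  move/esym/eqP; rewrite horner_prod prodf_seq_eq0 => /hasP[w _] /=.
  by rewrite rmorphB /= map_polyX map_polyC !hornerE subr_eq0 => /eqP->; exists w.
exists w; apply: (fmorph_inj (in_alg L)); rewrite rmorphXn /= Dx xm !evE -Dx.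
rewrite -[w%:A]/(in_alg L w) -[RHS]/(in_alg L _) -horner_map map_Poly ?rmorph0 // -map_comp.
by rewrite (eq_map (g := fun a => (N.to_nat a)%:R)) // => a /=; rewrite scaler_nat.
Qed.

(** * Existence of an odd generator for every [q = 1] modulo 4 *)

Section Existence.
Variables (F L : finFieldType) (iota : {rmorphism F -> L}).
Local Notation q := #|F|.
Hypothesis cardL : #|L| = (q ^ 4)%N.
Hypothesis q_mod4 : (q %% 4 = 1)%N.

Lemma sieve_success_odd_generator : sieve_success q ->
  exists (beta : L) (c t : F), [/\ beta ^+ 4 = iota c, c ^+ (q.-1 %/ 2) = -1 &
    odd_generator iota beta t].
Proof.
case=> K [S [k [s [dn [dd [uKS memKS sK sS [s0 dn0 dd0 sum_S crit]]]]]]].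
have [c c_prim] := finField_primitive_root F.
have c_ns : c ^+ (q.-1 %/ 2) = -1.
  have q_gt1 := finNzRing_gt1 F.
  have D2 : (q.-1 %/ 2 * 2 = q.-1)%N by move: (divn_eq q 4); rewrite q_mod4; lia.
  have : (c ^+ (q.-1 %/ 2)) ^+ 2 == 1 by rewrite -exprM D2 (prim_expr_order c_prim).
  rewrite sqrf_eq1 => /orP[|/eqP //]; rewrite -(prim_order_dvd c_prim) => le_q.
  have h_gt0 : (0 < q.-1 %/ 2)%N
    by rewrite -(@ltn_pmul2r 2) // D2 -ltnS prednK // ltnW.
  have := dvdn_leq h_gt0 le_q.
  by rewrite -[leqLHS]D2 muln2 -addnn -[leqRHS]addn0 leq_add2l leqNgt h_gt0.
have [beta beta4] := nonsquare_fourth_root iota cardL q_mod4 c_ns.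
have [t gen_t] := sieve_criterion cardL q_mod4 beta4 c_ns uKS memKS sK sS s0 dn0 dd0 sum_S crit.
by exists beta, c, t.
Qed.

Lemma exists_odd_generator :
  exists (beta : L) (c t : F), [/\ beta ^+ 4 = iota c, c ^+ (q.-1 %/ 2) = -1 &
    odd_generator iota beta t].
Proof.
have [large | small] := leqP (N.to_nat 36000) q.
  by apply: sieve_success_odd_generator; apply: large_success.
(* [q = 1] modulo 4 and [q > 1] give [q = 5 + 4 * j], the numbering of [check_from]. *)
pose j := (q %/ 4).-1.
have Dq : q = (5 + 4 * j)%N.
  have := finNzRing_gt1 F; rewrite /j [in X in _ -> X = _](divn_eq q 4) q_mod4.
  rewrite {1}(divn_eq q 4) q_mod4; case: (q %/ 4)%N => // u _ /=; lia.
have lt_j : (j < N.to_nat 9000)%N by lia.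
pose Q := (5 + N.of_nat (4 * j))%num.
have DQ : N.to_nat Q = q by rewrite Dq /Q; lia.
have := check_fromP check_from_ok lt_j.
rewrite -/Q settledE => /or3P[npp | sieve | exc].
- move: npp; rewrite (not_prime_powerF DQ) // -to_nat_pow2; apply: leq_trans small _.
  by have /N.leb_le : N.leb 36000 (pow2 16) by []; lia.
- by apply: sieve_success_odd_generator; rewrite -DQ; apply: small_sieveP; rewrite // DQ.
case/hasP: exc => Q' /mapP[[[[[[p Q''] m] c] t] ls]] x_in /= -> /N.eqb_eq EQ.
have := allP witnesses_ok _ x_in; rewrite -EQ => /and4P[pp /N_mod0_dvdn pQ fixed wit].
have p0 : (N.to_nat p)%:R = 0 :> F by apply: pchar_dvd_card; rewrite // -DQ.
have m_gt0 : (0 < size m)%N by case/and3P: wit => _ _ /andP[].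
have [w wm] := frobenius_fixed_root (prime_gt0 pp) p0 DQ m_gt0 fixed.
exact: (witness_odd_generator iota cardL q_mod4 wit pp DQ p0 wm).
Qed.

End Existence.

Theorem theorem7p8 (F : finFieldType) (L : fieldExtType F)
  (hdim : (\dim {: L})%VS = 4%N) :
  (exists alpha : L, primitive_elt alpha /\ k_normal #|F| 4 2 alpha)
  <-> (#|F| %% 4 = 1)%N.
Proof.
pose L' : finFieldType := finvect_type L.
pose iota : {rmorphism F -> L'} := in_alg L.
have cardL : #|L'| = (#|F| ^ 4)%N.
  have := @card_vspace F L' _ {: finvect_type L}%VS.
  rewrite card_vspacef => ->; congr (_ ^ _)%N; exact: hdim.
split=> [[alpha [prim normal]] | q_mod4].
  exact: (two_normal_mod4 iota cardL prim normal).
have [beta [c [t [beta4 c_ns gen_t]]]] := exists_odd_generator iota cardL q_mod4.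
exact: (odd_generator_two_normal cardL q_mod4 beta4 c_ns gen_t).
Qed.
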